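(* Let $e\ge2$ and $n\ge0$ be integers, and let $\lambda=(2^x,1^y)\in\mathsf{Par}_{\le2}(n)$. Suppose that $y\equiv-j-1\pmod e$ for some $1\le j<e$ and that $x\ge j$. Let $\mu=(2^{x-j},1^{y+2j})$. Then there is a dominated $R^{\Lambda_0}_{n,\mathbb Z}$-module homomorphism $$\phi_{\lambda,\mu}\colon S^\mu_{\mathbb Z}\longrightarrow S^\lambda_{\mathbb Z},\qquad v^\mu\longmapsto v^{\mathtt T^\lambda_e},$$ which is homogeneous of degree $1$.
   Context: **Partitions and tableaux.** $I=\mathbb Z/e\mathbb Z$. $\mathsf{Par}_{\le2}(n)$ is the set of partitions of $n$ with all parts at most $2$; $(2^x,1^y)$ has $x$ parts $2$ and $y$ parts $1$. The Young diagram is $[\lambda]=\{(a,b)\mid 1\le b\le\lambda_a\}$ ($a$ = row, numbered from the top; $b$ = column). A standard $\lambda$-tableau is a bijection $\mathtt t\colon\{1,\dots,n\}\to[\lambda]$ ($\mathtt t(r)$ is the node containing $r$) with entries increasing along rows and down columns; $\mathsf{Std}(\lambda)$ is the set of these. $\mathtt t^\lambda$ is the standard tableau filled row by row from the top. The residue of $(a,b)$ is $b-a+e\mathbb Z\in I$, and $\boldsymbol i^\lambda=(\operatorname{res}\mathtt t^\lambda(1),\dots,\operatorname{res}\mathtt t^\lambda(n))\in I^n$. Degree: a node is addable (removable) for $\lambda$ if adding it to (removing it from) $[\lambda]$ gives a Young diagram of a partition; $(a,b)$ is below $(a',b')$ if $a>a'$. For a removable node $A$ of residue $i$, $d_A(\lambda)$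 is the number of addable nodes of residue $i$ below $A$ minus the number of removable nodes of residue $i$ below $A$. Put $\deg_e(\mathtt t)=0$ if $n=0$, and $\deg_e(\mathtt t)=d_{\mathtt t(n)}(\lambda)+\deg_e(\mathtt t\!\downarrow_{n-1})$ otherwise, where $\mathtt t\!\downarrow_{m}$ is the restriction to $\{1,\dots,m\}$. **The tableau $\mathtt T^\lambda_e$.** For $\lambda=(2^x,1^y)$ with $y\equiv-j-1\pmod e$, $1\le j<e$, $x\ge j$, $\mathtt T^\lambda_e\in\mathsf{Std}(\lambda)$ is defined by: the entry in node $(a,b)$ is $2(a-1)+b$ if $a\le x-j$; $x-j+a$ if $a>x-j$ and $b=1$; $x+y+a$ if $a>x-j$ and $b=2$. **Cyclotomic KLR algebra.** For $i,j\in I$: if $e>2$, write $i\to j$ (equivalently $j\leftarrow i$) if $j=i-1$; if $e=2$, write $i\leftrightarrows j$ if $i\ne j$; write $i\nmid j$ if $j\notin\{i,i+1,i-1\}$. Put $c_{ij}=2,-1,-2,0$ according as $i=j$; $i\to j$ or $j\to i$; $i\leftrightarrows j$; $i\nmid j$. $\mathfrak S_n$ acts on $I^n$ by place permutations, $s_r=(r,r+1)$. $R_{n,\mathbb Z}$ is the $\mathbb Z$-algebra generated by $1_{\boldsymbol i}$ ($\boldsymbol i\in I^n$), $\psi_r$ ($1\le r<n$), $y_r$ ($1\le r\le n$) with relations (all admissible $r,s,\boldsymbol i,\boldsymbol j$): $1_{\boldsymbol i}1_{\boldsymbol j}=\delta_{\boldsymbol i,\boldsymbol j}1_{\boldsymbol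 i}$; $\sum_{\boldsymbol i}1_{\boldsymbol i}=1$; $y_r1_{\boldsymbol i}=1_{\boldsymbol i}y_r$; $\psi_r1_{\boldsymbol i}=1_{s_r\boldsymbol i}\psi_r$; $y_ry_s=y_sy_r$; $\psi_ry_{r+1}1_{\boldsymbol i}=(y_r\psi_r+\delta_{i_r,i_{r+1}})1_{\boldsymbol i}$; $y_{r+1}\psi_r1_{\boldsymbol i}=(\psi_ry_r+\delta_{i_r,i_{r+1}})1_{\boldsymbol i}$; $\psi_ry_s=y_s\psi_r$ if $s\ne r,r+1$; $\psi_r\psi_s=\psi_s\psi_r$ if $|r-s|>1$; $\psi_r^21_{\boldsymbol i}=0$, $1_{\boldsymbol i}$, $(y_{r+1}-y_r)1_{\boldsymbol i}$, $(y_r-y_{r+1})1_{\boldsymbol i}$, $(y_{r+1}-y_r)(y_r-y_{r+1})1_{\boldsymbol i}$ according as $i_r=i_{r+1}$, $i_r\nmid i_{r+1}$, $i_r\to i_{r+1}$, $i_r\leftarrow i_{r+1}$, $i_r\leftrightarrows i_{r+1}$; and $(\psi_r\psi_{r+1}\psi_r-\psi_{r+1}\psi_r\psi_{r+1})1_{\boldsymbol i}=1_{\boldsymbol i}$, $-1_{\boldsymbol i}$, $(-2y_{r+1}+y_r+y_{r+2})1_{\boldsymbol i}$, $0$ according as $i_{r+2}=i_r\to i_{r+1}$, $i_{r+2}=i_r\leftarrow i_{r+1}$, $i_{r+2}=i_r\leftrightarrows i_{r+1}$, otherwise. $R^{\Lambda_0}_{n,\mathbb Z}$ is the quotient of $R_{n,\mathbb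 Z}$ by the two-sided ideal generated by $\{1_{\boldsymbol i}\mid i_1\ne0\}\cup\{y_1\}$. Both are $\mathbb Z$-graded with $\deg1_{\boldsymbol i}=0$, $\deg y_r=2$, $\deg(\psi_r1_{\boldsymbol i})=-c_{i_r,i_{r+1}}$. **Specht modules (2-column $\lambda$).** $S^\lambda_{\mathbb Z}$ is the left $R_{n,\mathbb Z}$-module with one generator $v^\lambda$ and relations: $1_{\boldsymbol i}v^\lambda=\delta_{\boldsymbol i,\boldsymbol i^\lambda}v^\lambda$; $y_rv^\lambda=0$; $\psi_rv^\lambda=0$ whenever $r,r+1$ are in the same row of $\mathtt t^\lambda$; and the Garnir relations: for each node $(a,b)$ with $(a+1,b)\in[\lambda]$, with $u:=(\mathtt t^\lambda)^{-1}(a,b)$: $\psi_uv^\lambda=0$ if $\lambda_a=1$; $\psi_u\psi_{u+1}v^\lambda=0$ if $\lambda_a=2$, $b=1$; $\psi_{u+1}\psi_uv^\lambda=0$ if $b=2$ (these are the Kleshchev–Mathas–Ram Garnir relations written out for 2-column partitions). The action factors through $R^{\Lambda_0}_{n,\mathbb Z}$. Fix a reduced expression $w=s_{r_1}\cdots s_{r_m}$ for each $w\in\mathfrak S_n$ and put $\psi_w=\psi_{r_1}\cdots\psi_{r_m}$. For $\mathtt t\in\mathsf{Std}(\lambda)$ let $d(\mathtt t)\in\mathfrak S_n$ be the element with $\mathtt t(d(\mathtt t)r)=\mathtt t^\lambda(r)$ for all $r$, and $v^{\mathtt t}=\psi_{d(\mathtt t)}v^\lambda$. Then $\{v^{\mathtt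 t}\}_{\mathtt t\in\mathsf{Std}(\lambda)}$ is a $\mathbb Z$-basis of $S^\lambda_{\mathbb Z}$, and $S^\lambda_{\mathbb Z}$ is graded with $v^{\mathtt t}$ homogeneous of degree $\deg_e(\mathtt t)$. **Dominated homomorphisms.** For partitions $\lambda,\mu$ of $n$, $\mathsf{Std}^\mu(\lambda)$ is the set of $\mathtt t\in\mathsf{Std}(\lambda)$ such that every $r\in\{1,\dots,n\}$ lies in $\mathtt t$ in a row whose index is at most the index of the row containing $r$ in $\mathtt t^\mu$. A homomorphism $\phi\colon S^\mu_{\mathbb Z}\to S^\lambda_{\mathbb Z}$ is dominated if $\phi(v^\mu)$ lies in the $\mathbb Z$-span of $\{v^{\mathtt t}\mid\mathtt t\in\mathsf{Std}^\mu(\lambda)\}$. It is homogeneous of degree $m$ if it maps each degree-$k$ component into the degree-$(k+m)$ component. *)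

(* Defs.v *)
From HB Require Import structures.
From mathcomp Require Import all_boot all_order all_fingroup all_algebra.
From mathcomp Require Import generic_quotient boolp monalg zify.
Set Implicit Arguments.
Unset Strict Implicit.
Unset Printing Implicit Defensive.
Import GRing.Theory.
Local Open Scope ring_scope.
Local Open Scope quotient_scope.

(* The ring R / (two-sided ideal generated by the l - r with rel l r). *)
Section RingPresentation.
Variables (R : pzRingType) (rel : R -> R -> Prop).

Inductive ideal_spec : R -> Prop :=
| ideal_spec0 : ideal_spec 0
| ideal_specD a b l r s :
    rel l r -> ideal_spec s -> ideal_spec (a * (l - r) * b + s).

Definition ideal : {pred R} := fun a => `[< ideal_spec a >].

Lemma idealP a : reflect (ideal_spec a) (a \in ideal).
Proof. exact: asboolP. Qed.

Lemma ideal_zmod_closed : zmod_closed ideal.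
Proof.
split; first exact/idealP/ideal_spec0.
move=> x y /idealP hx /idealP hy; apply/idealP.
elim: hx => [|a b l r s lr _ IH]; last by rewrite -addrA; apply: ideal_specD.
rewrite sub0r; elim: hy => [|a b l r s lr _ IH].
  by rewrite oppr0; exact: ideal_spec0.
by rewrite opprD -!mulNr; apply: ideal_specD.
Qed.

HB.instance Definition _ := GRing.isZmodClosed.Build R ideal ideal_zmod_closed.

Lemma idealMl a u : u \in ideal -> a * u \in ideal.
Proof.
move/idealP=> hu; apply/idealP; elim: hu => [|b c l r s lr _ IH].
  by rewrite mulr0; exact: ideal_spec0.
by rewrite mulrDr !mulrA; rewrite -(mulrA _ (l - r)) mulrA; apply: ideal_specD.
Qed.

Lemma idealMr a u : u \in ideal -> u * a \in ideal.
Proof.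
move/idealP=> hu; apply/idealP; elim: hu => [|b c l r s lr _ IH].
  by rewrite mul0r; exact: ideal_spec0.
by rewrite mulrDl -(mulrA _ c); apply: ideal_specD.
Qed.

Lemma ideal_rel l r : rel l r -> l - r \in ideal.
Proof.
move=> lr; apply/idealP; rewrite -[l - r]mulr1 -[l - r]mul1r -[X in ideal_spec X]addr0.
by apply: ideal_specD => //; exact: ideal_spec0.
Qed.

Definition qring : Type := {ideal_quot ideal}.
HB.instance Definition _ := GRing.Zmodule.on qring.

Definition qring_pi (a : R) : qring := \pi_({ideal_quot ideal}) a.
Definition qring_repr (u : qring) : R := repr (u : {ideal_quot ideal}).

Lemma qring_reprK u : qring_pi (qring_repr u) = u.
Proof. exact: reprK. Qed.

Lemma qring_eq a b : (qring_pi a = qring_pi b) <-> (a - b \in ideal).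
Proof. by rewrite Quotient.idealrBE; split=> /eqP. Qed.

Lemma qring_piB : {morph qring_pi : a b / a - b}.
Proof. by move=> a b; rewrite /qring_pi raddfB. Qed.

Definition qring_one : qring := qring_pi 1.
Definition qring_mul (u v : qring) : qring :=
  qring_pi (qring_repr u * qring_repr v).

Lemma qring_mulE a b : qring_mul (qring_pi a) (qring_pi b) = qring_pi (a * b).
Proof.
apply/qring_eq; set a' := qring_repr _; set b' := qring_repr _.
have Ha : a' - a \in ideal by apply/qring_eq; rewrite qring_reprK.
have Hb : b' - b \in ideal by apply/qring_eq; rewrite qring_reprK.
have -> : a' * b' - a * b = (a' - a) * b' + a * (b' - b).
  by rewrite mulrBl mulrBr addrA subrK.
by apply: rpredD; [exact: idealMr | exact: idealMl].
Qed.

Lemma qring_piD : {morph qring_pi : a b / a + b}.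
Proof. by move=> a b; rewrite /qring_pi raddfD. Qed.

Fact qring_mulA : associative qring_mul.
Proof.
move=> u v w; rewrite -[u]qring_reprK -[v]qring_reprK -[w]qring_reprK.
by rewrite !qring_mulE mulrA.
Qed.
Fact qring_mul1 : left_id qring_one qring_mul.
Proof. by move=> u; rewrite -[u]qring_reprK qring_mulE mul1r. Qed.
Fact qring_mulr1 : right_id qring_one qring_mul.
Proof. by move=> u; rewrite -[u]qring_reprK qring_mulE mulr1. Qed.
Fact qring_mulDl : left_distributive qring_mul +%R.
Proof.
move=> u v w; rewrite -[u]qring_reprK -[v]qring_reprK -[w]qring_reprK.
by rewrite -qring_piD !qring_mulE -qring_piD mulrDl.
Qed.
Fact qring_mulDr : right_distributive qring_mul +%R.
Proof.
move=> u v w; rewrite -[u]qring_reprK -[v]qring_reprK -[w]qring_reprK.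
by rewrite -qring_piD !qring_mulE -qring_piD mulrDr.
Qed.

HB.instance Definition _ := GRing.Zmodule_isPzRing.Build qring
  qring_mulA qring_mul1 qring_mulr1 qring_mulDl qring_mulDr.

HB.instance Definition _ := GRing.isZmodMorphism.Build R qring qring_pi qring_piB.
Fact qring_pi_monoid : monoid_morphism qring_pi.
Proof. by split=> // a b; rewrite -qring_mulE. Qed.
HB.instance Definition _ :=
  GRing.isMonoidMorphism.Build R qring qring_pi qring_pi_monoid.

Lemma qring_pi_rel l r : rel l r -> qring_pi l = qring_pi r.
Proof. by move=> lr; apply/qring_eq/ideal_rel. Qed.

(* An R-module on which the relations hold, seen as a module over the
   quotient ring [qring rel]; see [descend_scaleE]. *)
Section Descent.
Variable V : lmodType R.

Definition satisfies_rel := forall l r, rel l r -> forall v : V, l *: v = r *: v.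

Definition descend of satisfies_rel : Type := V.

Variable hV : satisfies_rel.
HB.instance Definition _ := GRing.Zmodule.on (descend hV).

Lemma ideal_scale a (v : V) : a \in ideal -> a *: v = 0.
Proof.
move=> /idealP; elim=> [|b c l r s lr _ IH]; first by rewrite scale0r.
by rewrite scalerDl IH addr0 -!scalerA scalerBl (hV lr) subrr scaler0.
Qed.

Definition descend_scale (u : qring) (v : descend hV) : descend hV :=
  qring_repr u *: (v : V).

Lemma descend_scaleE a v : descend_scale (qring_pi a) v = a *: (v : V).
Proof.
apply/eqP; rewrite -subr_eq0 -scalerBl ideal_scale //.
by apply/qring_eq; rewrite qring_reprK.
Qed.

Fact descend_scaleA u w v :
  descend_scale u (descend_scale w v) = descend_scale (u * w) v.
Proof.
by rewrite -[u]qring_reprK -[w]qring_reprK -rmorphM !descend_scaleE scalerA.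
Qed.
Fact descend_scale1 : left_id 1 descend_scale.
Proof. by move=> v; rewrite -(rmorph1 qring_pi) descend_scaleE scale1r. Qed.
Fact descend_scaleDr : right_distributive descend_scale +%R.
Proof. by move=> u v w; exact: scalerDr. Qed.
Fact descend_scaleDl v : {morph descend_scale^~ v : a b / a + b}.
Proof.
move=> u w; rewrite -[u]qring_reprK -[w]qring_reprK -rmorphD !descend_scaleE.
exact: scalerDl.
Qed.
HB.instance Definition _ := GRing.Zmodule_isLmodule.Build qring (descend hV)
  descend_scaleA descend_scale1 descend_scaleDr descend_scaleDl.
End Descent.

End RingPresentation.

(* The left R-module with one generator v and the relations l v = r v, rel l r,
   that is, R / (left ideal generated by the l - r). *)
Section CyclicModule.
Variables (R : pzRingType) (rel : R -> R -> Prop).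

Inductive lideal_spec : R -> Prop :=
| lideal_spec0 : lideal_spec 0
| lideal_specD a l r s :
    rel l r -> lideal_spec s -> lideal_spec (a * (l - r) + s).

Definition lideal : {pred R} := fun a => `[< lideal_spec a >].

Lemma lidealP a : reflect (lideal_spec a) (a \in lideal).
Proof. exact: asboolP. Qed.

Lemma lideal_zmod_closed : zmod_closed lideal.
Proof.
split; first exact/lidealP/lideal_spec0.
move=> x y /lidealP hx /lidealP hy; apply/lidealP.
elim: hx => [|a l r s lr _ IH]; last by rewrite -addrA; apply: lideal_specD.
rewrite sub0r; elim: hy => [|a l r s lr _ IH].
  by rewrite oppr0; exact: lideal_spec0.
by rewrite opprD -!mulNr; apply: lideal_specD.
Qed.

HB.instance Definition _ := GRing.isZmodClosed.Build R lideal lideal_zmod_closed.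

Lemma lidealM a u : u \in lideal -> a * u \in lideal.
Proof.
move/lidealP=> hu; apply/lidealP; elim: hu => [|b l r s lr _ IH].
  by rewrite mulr0; exact: lideal_spec0.
by rewrite mulrDr mulrA; apply: lideal_specD.
Qed.

Lemma lideal_rel l r : rel l r -> l - r \in lideal.
Proof.
move=> lr; apply/lidealP; rewrite -[l - r]mul1r -[X in lideal_spec X]addr0.
by apply: lideal_specD => //; exact: lideal_spec0.
Qed.

Definition cyclic_mod : Type := {ideal_quot lideal}.
HB.instance Definition _ := GRing.Zmodule.on cyclic_mod.

Definition cyclic_pi (a : R) : cyclic_mod := \pi_({ideal_quot lideal}) a.
Definition cyclic_repr (u : cyclic_mod) : R := repr (u : {ideal_quot lideal}).

Lemma cyclic_reprK u : cyclic_pi (cyclic_repr u) = u.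
Proof. exact: reprK. Qed.

Lemma cyclic_eq a b : (cyclic_pi a = cyclic_pi b) <-> (a - b \in lideal).
Proof. by rewrite Quotient.idealrBE; split=> /eqP. Qed.

Lemma cyclic_piD : {morph cyclic_pi : a b / a + b}.
Proof. by move=> a b; rewrite /cyclic_pi raddfD. Qed.

Definition cyclic_scale (a : R) (u : cyclic_mod) : cyclic_mod :=
  cyclic_pi (a * cyclic_repr u).

Lemma cyclic_scaleE a b : cyclic_scale a (cyclic_pi b) = cyclic_pi (a * b).
Proof.
apply/cyclic_eq; rewrite -mulrBr; apply: lidealM.
by apply/cyclic_eq; rewrite cyclic_reprK.
Qed.

Fact cyclic_scaleA a b u :
  cyclic_scale a (cyclic_scale b u) = cyclic_scale (a * b) u.
Proof. by rewrite -[u]cyclic_reprK !cyclic_scaleE mulrA. Qed.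
Fact cyclic_scale1 : left_id 1 cyclic_scale.
Proof. by move=> u; rewrite -[u]cyclic_reprK cyclic_scaleE mul1r. Qed.
Fact cyclic_scaleDr : right_distributive cyclic_scale +%R.
Proof.
move=> a u w; rewrite -[u]cyclic_reprK -[w]cyclic_reprK -cyclic_piD.
by rewrite !cyclic_scaleE mulrDr cyclic_piD.
Qed.
Fact cyclic_scaleDl u : {morph cyclic_scale^~ u : a b / a + b}.
Proof.
move=> a b; rewrite -[u]cyclic_reprK.
by rewrite !cyclic_scaleE mulrDl cyclic_piD.
Qed.
HB.instance Definition _ := GRing.Zmodule_isLmodule.Build R cyclic_mod
  cyclic_scaleA cyclic_scale1 cyclic_scaleDr cyclic_scaleDl.

Definition cyclic_gen : cyclic_mod := cyclic_pi 1.

Lemma cyclic_piE a : cyclic_pi a = a *: cyclic_gen.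
Proof. by rewrite -[RHS]/(cyclic_scale a (cyclic_pi 1)) cyclic_scaleE mulr1. Qed.

Lemma cyclic_gen_rel l r : rel l r -> l *: cyclic_gen = r *: cyclic_gen.
Proof. by move=> lr; rewrite -!cyclic_piE; apply/cyclic_eq/lideal_rel. Qed.

End CyclicModule.

Definition is_partition (lam : seq nat) : bool := sorted geq lam && (0 \notin lam).

(* Nodes are pairs (row, column), both counted from 1; the sequence lists them
   row by row from the top, which is the reading order of the initial tableau. *)
Definition young (lam : seq nat) : seq (nat * nat) :=
  [seq (a, b) | a <- iota 1 (size lam), b <- iota 1 (nth 0 lam a.-1)]%N.

Definition two_col (x y : nat) : seq nat := nseq x 2 ++ nseq y 1.

Record par2 n := Par2 {
  par2_val :> seq nat;
  par2P : [&& is_partition par2_val, all (leq^~ 2) par2_val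
            & sumn par2_val == n] }.

Definition res (e : nat) (A : nat * nat) : 'Z_e := A.2%:R - A.1%:R.

Lemma two_colP n (lam : par2 n) :
  {xy : nat * nat | par2_val lam = nseq xy.1 2 ++ nseq xy.2 1}%N.
Proof.
case: lam => lam /= /and3P[/andP[+ +] + _].
elim: lam => [|a lam IH]; first by exists (0, 0).
rewrite inE negb_or /= => hs /andP[a0 h0] /andP[a2 h2].
have [[x y] /= E] := IH (path_sorted hs) h0 h2.
case: a hs a0 a2 => [|[|[|a]]] //= hs _ _.
- exists (0, y.+1); rewrite /= E.
  case: x E => [|x] //= E; last by rewrite E in hs.
- by exists (x.+1, y); rewrite /= E.
Qed.

Lemma size_young lam : size (young lam) = sumn lam.
Proof.
rewrite size_allpairs_dep; congr sumn.
apply: (@eq_from_nth _ 0) => [|k]; rewrite size_map size_iota // => hk.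
by rewrite (nth_map 0) ?size_iota // nth_iota //= size_iota.
Qed.

(* The node at position k (from 0) of the diagram of (2^x, 1^y). *)
Definition two_col_node (x k : nat) : nat * nat :=
  if (k < x.*2)%N then (k./2.+1, (odd k).+1) else ((k - x).+1, 1)%N.

Lemma young_cons a lam :
  young (a :: lam) =
  [seq (1, b) | b <- iota 1 a] ++ [seq (A.1.+1, A.2) | A <- young lam]%N.
Proof.
rewrite /young /= map_allpairs; congr (_ ++ _).
rewrite (iotaDl 1 1) allpairs_mapl; congr flatten.
by apply/eq_in_map => c; rewrite mem_iota; case: c.
Qed.

Lemma young_two_col x y :
  young (nseq x 2 ++ nseq y 1) = [seq two_col_node x k | k <- iota 0 (x.*2 + y)].
Proof.
elim: x => [|x IH].
  rewrite double0 add0n /=; elim: y => [//|y IH].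
  rewrite [nseq _ _]/= young_cons IH -map_comp /=; congr (_ :: _).
  rewrite (iotaDl 1 0) -map_comp; apply: eq_map => k /=.
  by rewrite /two_col_node /= !subn0 add1n.
rewrite [nseq _ _ ++ _]/= young_cons IH -map_comp doubleS !addSn /=.
congr [:: _, _ & _]; rewrite (iotaDl 2 0) -map_comp; apply: eq_map => k /=.
rewrite /two_col_node add2n doubleS !ltnS /= negbK; case: ltnP => // hk.
by rewrite subSS subSn // (leq_trans _ hk) // -addnn leq_addr.
Qed.

Definition node (lam : seq nat) : finType := seq_sub (young lam).

(* Entries are shifted by one: r : 'I_n stands for the entry r + 1. *)
Definition tableau n (lam : seq nat) := {ffun 'I_n -> node lam}.

Section Tableaux.
Variables (n : nat) (lam : par2 n).

Lemma size_young_par2 : size (young lam) = n.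
Proof. by rewrite size_young; case: lam => l /= /and3P[_ _ /eqP]. Qed.

Fact tini_subproof (r : 'I_n) : nth (0, 0)%N (young lam) r \in young lam.
Proof. by rewrite mem_nth // size_young_par2. Qed.

Definition tini : tableau n lam := [ffun r => SeqSub (tini_subproof r)].

Implicit Type t : tableau n lam.

Definition is_std t : bool :=
  [&& injectiveb t, [forall A, exists r, t r == A],
      [forall r, forall s, ((val (t r)).1 == (val (t s)).1) ==>
        ((val (t r)).2 < (val (t s)).2)%N ==> (r < s)%N]
    & [forall r, forall s, ((val (t r)).2 == (val (t s)).2) ==>
        ((val (t r)).1 < (val (t s)).1)%N ==> (r < s)%N]].

(* For a bijective t such a d exists and is unique, so the default is not used. *)
Definition dperm t : 'S_n := odflt 1%g [pick d : 'S_n | [forall r, t (d r) == tini r]].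

(* The tableau with entry f A in each node A, if f is a bijection from the
   diagram onto {1..n}. *)
Definition tab_of_entry (f : nat * nat -> nat) : tableau n lam :=
  [ffun r => odflt (tini r) [pick A | f (val A) == r.+1]].

Definition ires (e : nat) : {ffun 'I_n -> 'Z_e} := [ffun r => res e (val (tini r))].
End Tableaux.
Arguments tini {n} lam.

Definition is_dominated n (lam mu : par2 n) (t : tableau n lam) : bool :=
  [forall r, (val (t r)).1 <= (val (tini mu r)).1]%N.

Section Degree.
Variable e : nat.
Implicit Types (A : nat * nat) (D : seq (nat * nat)).

(* [is_diagram D]: the duplicate-free sequence D lists the Young diagram of a
   partition, which is then [row_lengths D]. *)
Definition row_lengths D : seq nat :=
  [seq count (fun A => A.1 == a) D | a <- iota 1 (foldr maxn 0 (unzip1 D))]%N.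
Definition is_diagram D : bool :=
  is_partition (row_lengths D) && perm_eq (young (row_lengths D)) D.

Definition addable D A := (A \notin D) && is_diagram (A :: D).
Definition removable D A := (A \in D) && is_diagram (rem A D).

(* Every node addable to or removable from D lies in [box (size D).+1]. *)
Definition box m := [seq (a, b) | a <- iota 1 m, b <- iota 1 m].

Definition dnode D A : int :=
  let cnt (P : pred (nat * nat)) :=
    count (fun B => [&& P B, res e B == res e A & A.1 < B.1]%N) (box (size D).+1) in
  (cnt (addable D))%:Z - (cnt (removable D))%:Z.

(* D lists the nodes t(n), ..., t(1), so that dropping its head restricts t to
   {1..n-1}. *)
Fixpoint deg_rev D : int :=
  if D is A :: D' then dnode D A + deg_rev D' else 0.
End Degree.

Definition deg n lam (e : nat) (t : tableau n lam) : int :=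
  deg_rev e (rev [seq val (t r) | r <- enum 'I_n]).

Section Ord.
Variable n : nat.
(* Indices are shifted by one: r : 'I_n.-1 stands for the index r+1 of psi_{r+1}
   and s_{r+1}, which exchanges the positions r+1 (lo r) and r+2 (hi r). *)
Definition lo (r : 'I_n.-1) : 'I_n := widen_ord (leq_pred n) r.
Fact hi_subproof (r : 'I_n.-1) : (r.+1 < n)%N.
Proof. by case: n r => [|m] [r]. Qed.
Definition hi (r : 'I_n.-1) : 'I_n := Ordinal (hi_subproof r).
Definition sperm (r : 'I_n.-1) : 'S_n := tperm (lo r) (hi r).
End Ord.

Section KLR.
Variables e n : nat.

Definition iseq := {ffun 'I_n -> 'Z_e}.

Definition to_arrow (i j : 'Z_e) : bool := (2 < e)%N && (j == i - 1).
Definition lr_arrow (i j : 'Z_e) : bool := (e == 2)%N && (i != j).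
Definition no_arrow (i j : 'Z_e) : bool := [&& j != i, j != i + 1 & j != i - 1].

(* The place permutation by s_r; s_r is its own inverse. *)
Definition sact (r : 'I_n.-1) (i : iseq) : iseq := [ffun k => i (sperm r k)].

Section Relations.
Variables (R : pzRingType) (E : iseq -> R) (P : 'I_n.-1 -> R) (Y : 'I_n -> R).

Definition psi_sq (r : 'I_n.-1) (i : iseq) : R :=
  let a := i (lo r) in let b := i (hi r) in
  if a == b then 0
  else if no_arrow a b then 1
  else if to_arrow a b then Y (hi r) - Y (lo r)
  else if to_arrow b a then Y (lo r) - Y (hi r)
  else if lr_arrow a b then (Y (hi r) - Y (lo r)) * (Y (lo r) - Y (hi r))
  else 0.

Definition braid_err (r s : 'I_n.-1) (i : iseq) : R :=
  let a := i (lo r) in let b := i (hi r) in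
  if i (hi s) != a then 0
  else if to_arrow a b then 1
  else if to_arrow b a then -1
  else if lr_arrow a b then - (2%:R * Y (hi r)) + Y (lo r) + Y (hi s)
  else 0.

(* The KLR relations between families of elements E (idempotents), P (the psi_r)
   and Y (the y_r) of a ring. *)
Inductive klr_rel : R -> R -> Prop :=
| klr_idem (i j : iseq) : klr_rel (E i * E j) (if i == j then E i else 0)
| klr_sum1 : klr_rel (\sum_i E i) 1
| klr_y1 r i : klr_rel (Y r * E i) (E i * Y r)
| klr_psi1 r i : klr_rel (P r * E i) (E (sact r i) * P r)
| klr_yy r s : klr_rel (Y r * Y s) (Y s * Y r)
| klr_psiy r i :
    klr_rel (P r * Y (hi r) * E i)
            ((Y (lo r) * P r + (i (lo r) == i (hi r))%:R) * E i)
| klr_ypsi r i :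
    klr_rel (Y (hi r) * P r * E i)
            ((P r * Y (lo r) + (i (lo r) == i (hi r))%:R) * E i)
| klr_psiyC r s : s != lo r -> s != hi r -> klr_rel (P r * Y s) (Y s * P r)
| klr_psiC (r s : 'I_n.-1) : (r.+1 < s)%N || (s.+1 < r)%N ->
    klr_rel (P r * P s) (P s * P r)
| klr_psi_sq r i : klr_rel (P r * P r * E i) (psi_sq r i * E i)
| klr_braid (r s : 'I_n.-1) i : s = r.+1 :> nat ->
    klr_rel ((P r * P s * P r - P s * P r * P s) * E i) (braid_err r s i * E i).
End Relations.

Definition klr_gen : choiceType := (iseq + ('I_n.-1 + 'I_n))%type.
Definition free_klr : pzRingType := {malg int[{fmonom klr_gen}]}.

Definition fgen (g : klr_gen) : free_klr := mkmalgU (fmu g) 1.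
Definition free_rel : free_klr -> free_klr -> Prop :=
  klr_rel (fun i => fgen (inl i)) (fun r => fgen (inr (inl r)))
          (fun r => fgen (inr (inr r))).

Definition klr : pzRingType := qring free_rel.

Definition kgen (g : klr_gen) : klr := qring_pi free_rel (fgen g).
Definition idem (i : iseq) : klr := kgen (inl i).
Definition psi (r : 'I_n.-1) : klr := kgen (inr (inl r)).
Definition yk (r : 'I_n) : klr := kgen (inr (inr r)).

(* r = 0 is the first position. *)
Inductive cyc_rel : klr -> klr -> Prop :=
| cyc_idem (i : iseq) (r : 'I_n) : r = 0%N :> nat -> i r != 0 -> cyc_rel (idem i) 0
| cyc_y (r : 'I_n) : r = 0%N :> nat -> cyc_rel (yk r) 0.

Definition cklr : pzRingType := qring cyc_rel.

Variable lam : par2 n.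

(* The premises of the three Garnir relations say that lo r is the position u of
   the node (a, b) in the initial tableau and that (a+1, b) is a node. *)
Inductive specht_rel : klr -> klr -> Prop :=
| sp_idem (i : iseq) : specht_rel (idem i) (i == ires lam e)%:R
| sp_y (r : 'I_n) : specht_rel (yk r) 0
| sp_row (r : 'I_n.-1) :
    (val (tini lam (lo r))).1 = (val (tini lam (hi r))).1 -> specht_rel (psi r) 0
| sp_garnir1 (r : 'I_n.-1) a b :
    val (tini lam (lo r)) = (a, b) -> (a.+1, b) \in young lam ->
    nth 0%N lam a.-1 = 1%N -> specht_rel (psi r) 0
| sp_garnir2 (r s : 'I_n.-1) a :
    val (tini lam (lo r)) = (a, 1)%N -> (a.+1, 1)%N \in young lam ->
    nth 0%N lam a.-1 = 2 -> s = r.+1 :> nat -> specht_rel (psi r * psi s) 0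
| sp_garnir3 (r s : 'I_n.-1) a :
    val (tini lam (lo r)) = (a, 2)%N -> (a.+1, 2)%N \in young lam ->
    s = r.+1 :> nat -> specht_rel (psi s * psi r) 0.

Definition specht : lmodType klr := cyclic_mod specht_rel.
Definition vgen : specht := cyclic_gen specht_rel.
End KLR.

(* The relations of the cyclotomic quotient hold in the Specht modules. The proof
   writes every element of the KLR algebra as a combination of elements
   h * psi_1 ... psi_k * p, with h in the subalgebra generated by the psi_r, r > 1,
   and the y_r and idempotents, and p a polynomial in the y_r and idempotents. *)
Module CyclotomicFactor.
Section KLRtheory.
Variables e n : nat.
Notation iseq := (iseq e n).
Variables (A : pzRingType) (idem : iseq -> A) (psi : 'I_n.-1 -> A) (yk : 'I_n -> A).
Hypothesis relE : forall l r, klr_rel idem psi yk l r -> l = r.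
Implicit Types (i : iseq) (r s : 'I_n.-1) (k : 'I_n).

Lemma idem_sum : \sum_i idem i = 1. Proof. exact/relE/klr_sum1. Qed.
Lemma yk_idem k i : yk k * idem i = idem i * yk k.
Proof. exact/relE/klr_y1. Qed.
Lemma psi_idem r i : psi r * idem i = idem (sact r i) * psi r.
Proof. exact/relE/klr_psi1. Qed.
Lemma psi_yk r k : k != lo r -> k != hi r -> psi r * yk k = yk k * psi r.
Proof. by move=> h1 h2; apply/relE/klr_psiyC. Qed.
Lemma psiC r s : (r.+1 < s)%N || (s.+1 < r)%N -> psi r * psi s = psi s * psi r.
Proof. by move=> h; apply/relE/klr_psiC. Qed.
Lemma psi_y_idem r i : psi r * yk (hi r) * idem i =
  (yk (lo r) * psi r + (i (lo r) == i (hi r))%:R) * idem i.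
Proof. exact/relE/klr_psiy. Qed.
Lemma y_psi_idem r i : yk (hi r) * psi r * idem i =
  (psi r * yk (lo r) + (i (lo r) == i (hi r))%:R) * idem i.
Proof. exact/relE/klr_ypsi. Qed.
Lemma psi_sq_idem r i : psi r * psi r * idem i = psi_sq yk r i * idem i.
Proof. exact/relE/klr_psi_sq. Qed.
Lemma psi_braid_idem r s i : s = r.+1 :> nat ->
  (psi r * psi s * psi r - psi s * psi r * psi s) * idem i =
  braid_err yk r s i * idem i.
Proof. by move=> h; apply/relE/klr_braid. Qed.

Lemma mul_idem_sum (a : A) : a = \sum_i a * idem i.
Proof. by rewrite -mulr_sumr idem_sum mulr1. Qed.

Definition dlt r : A := \sum_(i : iseq) (i (lo r) == i (hi r))%:R * idem i.

Lemma psi_y_hi r : psi r * yk (hi r) = yk (lo r) * psi r + dlt r.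
Proof.
rewrite [LHS]mul_idem_sum (mul_idem_sum (yk _ * _)) -big_split /=.
by apply: eq_bigr => i _; rewrite psi_y_idem mulrDl.
Qed.

Lemma y_hi_psi r : yk (hi r) * psi r = psi r * yk (lo r) + dlt r.
Proof.
rewrite [LHS]mul_idem_sum (mul_idem_sum (psi r * _)) -big_split /=.
by apply: eq_bigr => i _; rewrite y_psi_idem mulrDl.
Qed.

Lemma sactK r : involutive (sact r : iseq -> _).
Proof. by move=> i; apply/ffunP => k; rewrite !ffunE tpermK. Qed.

Inductive Ypol : A -> Prop :=
| Y1 : Ypol 1
| Yy k p : Ypol p -> Ypol (yk k * p)
| Yi i p : Ypol p -> Ypol (idem i * p)
| YD p q : Ypol p -> Ypol q -> Ypol (p + q)
| YN p : Ypol p -> Ypol (- p).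

Lemma Y0 : Ypol 0.
Proof. by rewrite -(subrr 1); apply: YD; [|apply: YN]; exact: Y1. Qed.

Lemma YM p q : Ypol p -> Ypol q -> Ypol (p * q).
Proof.
move=> hp hq; elim: hp => [|k p' _|i p' _|p' p'' _ h1 _ h2|p' _ h]; rewrite ?mul1r -?mulrA //.
- exact: Yy.
- exact: Yi.
- by rewrite mulrDl; apply: YD.
- by rewrite mulNr; apply: YN.
Qed.

Lemma Yyk k : Ypol (yk k). Proof. by rewrite -[yk k]mulr1; apply/Yy/Y1. Qed.
Lemma Yidem i : Ypol (idem i). Proof. by rewrite -[idem i]mulr1; apply/Yi/Y1. Qed.
Lemma Ynat m : Ypol m%:R.
Proof. by elim: m => [|m IH]; [exact: Y0 | rewrite mulrS; apply: YD (Y1) IH]. Qed.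
Lemma Ysum (I : Type) (l : seq I) (P : pred I) (F : I -> A) :
  (forall j, Ypol (F j)) -> Ypol (\sum_(i <- l | P i) F i).
Proof. by move=> h; apply: big_ind => //; [exact: Y0 | exact: YD]. Qed.

Lemma Ydlt r : Ypol (dlt r).
Proof. by apply: Ysum => i; apply: YM (Ynat _) (Yidem _). Qed.

Lemma Ysub p q : Ypol p -> Ypol q -> Ypol (p - q).
Proof. by move=> hp hq; apply: YD => //; apply: YN. Qed.

Lemma YB k l : Ypol (yk k - yk l).
Proof. by apply: Ysub; exact: Yyk. Qed.

Lemma Ypsi2 r : Ypol (psi r * psi r).
Proof.
rewrite [X in Ypol X]mul_idem_sum; apply: Ysum => i; rewrite psi_sq_idem.
apply: YM (Yidem _); rewrite /psi_sq.
by do !case: ifP => _; [exact: Y0 | exact: Y1 | exact: YB | exact: YB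
  | apply: YM; exact: YB | exact: Y0].
Qed.

Lemma Ybraid r s : s = r.+1 :> nat ->
  exists2 E, Ypol E & psi r * psi s * psi r = psi s * psi r * psi s + E.
Proof.
move=> h; exists (psi r * psi s * psi r - psi s * psi r * psi s); last by rewrite addrC subrK.
rewrite [X in Ypol X]mul_idem_sum; apply: Ysum => i; rewrite psi_braid_idem //.
apply: YM (Yidem _); rewrite /braid_err.
do !case: ifP => _; try exact: Y0; try exact: Y1; first by apply: YN; exact: Y1.
apply: YD (Yyk _); apply: YD (Yyk _).
by apply: YN; apply: YM (Ynat _) (Yyk _).
Qed.

Lemma Ypsi p r : Ypol p ->
  exists p' p'', [/\ Ypol p', Ypol p'' & p * psi r = psi r * p' + p''].
Proof.
elim=> [|k q _|i q _|q1 q2 _ IH1 _ IH2|q _].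
- by exists 1, 0; rewrite mul1r mulr1 addr0; split=> //; [exact: Y1 | exact: Y0].
- case=> p' [p'' [h1 h2 E]].
  have [->|nhi] := eqVneq k (hi r).
    exists (yk (lo r) * p'), (dlt r * p' + yk (hi r) * p''); split.
    + exact: Yy.
    + by apply: YD; [apply: YM (Ydlt _) _ | apply: Yy].
    + by rewrite -mulrA E mulrDr mulrA y_hi_psi mulrDl !mulrA addrA.
  have [->|nlo] := eqVneq k (lo r).
    exists (yk (hi r) * p'), (- (dlt r * p') + yk (lo r) * p''); split.
    + exact: Yy.
    + by apply: YD; [apply/YN/YM => //; exact: Ydlt | apply: Yy].
    + rewrite -mulrA E mulrDr addrA (mulrA (psi r)) psi_y_hi mulrDl.
      by rewrite addrK mulrA.
  exists (yk k * p'), (yk k * p''); split; try exact: Yy.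
  by rewrite -mulrA E mulrDr !mulrA psi_yk.
- case=> p' [p'' [h1 h2 E]]; exists (idem (sact r i) * p'), (idem i * p''); split; try exact: Yi.
  by rewrite -mulrA E mulrDr !mulrA psi_idem sactK.
- case: IH1 IH2 => p1 [p2 [h1 h2 E]] [p3 [p4 [h3 h4 E']]].
  exists (p1 + p3), (p2 + p4); split; try exact: YD.
  by rewrite mulrDl E E' mulrDr addrACA.
- case=> p' [p'' [h1 h2 E]]; exists (- p'), (- p''); split; try exact: YN.
  by rewrite mulNr E opprD mulrN.
Qed.

Definition psik (k : nat) : A := oapp psi 0 (insub k).
Lemma psikE r : psik r = psi r.
Proof. by rewrite /psik valK. Qed.
Lemma psik_case (k : nat) : (psik k = 0) \/ exists2 r : 'I_n.-1, r = k :> nat & psik k = psi r.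
Proof. by rewrite /psik; case: insubP => [r _ <-|_]; [right; exists r | left]. Qed.

Definition pref (k : nat) : A := \prod_(0 <= j < k) psik j.

Inductive Ppol : A -> Prop :=
| Pgen (k : nat) p : Ypol p -> Ppol (pref k * p)
| Py k a : Ppol a -> Ppol (yk k * a)
| Pi i a : Ppol a -> Ppol (idem i * a)
| Ppsi r a : (0 < r)%N -> Ppol a -> Ppol (psi r * a)
| PD a b : Ppol a -> Ppol b -> Ppol (a + b)
| PN a : Ppol a -> Ppol (- a).

Lemma PY p : Ypol p -> Ppol p.
Proof. by move=> h; have := Pgen 0 h; rewrite /pref big_geq // mul1r. Qed.
Lemma P0 : Ppol 0. Proof. exact/PY/Y0. Qed.

Lemma psik_comm (j k : nat) : (j.+1 < k)%N -> psik j * psik k = psik k * psik j.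
Proof.
move=> jk; case: (psik_case j) => [->|[r hr ->]]; first by rewrite mul0r mulr0.
case: (psik_case k) => [->|[s hs ->]]; first by rewrite mul0r mulr0.
by rewrite psiC // hr hs jk.
Qed.

Lemma Ppsik (k : nat) a : (0 < k)%N -> Ppol a -> Ppol (psik k * a).
Proof.
move=> k0 ha; case: (psik_case k) => [->|[r hr ->]]; first by rewrite mul0r; exact: P0.
by apply: Ppsi; rewrite ?hr.
Qed.

Lemma pref_comm (m k : nat) : (m < k)%N -> pref m * psik k = psik k * pref m.
Proof.
elim: m => [|m IH] hm; first by rewrite /pref big_geq // mul1r mulr1.
rewrite /pref big_nat_recr //= -/(pref m) -mulrA psik_comm //.
by rewrite mulrA IH ?mulrA // (ltn_trans _ hm).
Qed.

Lemma Pclaim m q w p : Ypol q -> Ypol p -> all (ltn m) w ->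
  Ppol (pref m * q * (\prod_(k <- w) psik k) * p).
Proof.
move=> hq hp; elim: w q hq => [|k w IH] q hq /=.
  by rewrite big_nil mulr1 -mulrA => _; apply/Pgen/YM.
case/andP=> mk hw; rewrite big_cons.
case: (psik_case k) => [->|[r hr Er]].
  by rewrite mul0r mulr0 mul0r; exact: P0.
have [q1 [q2 [h1 h2 E]]] := Ypsi r hq.
rewrite Er !mulrA -(mulrA (pref m)) E mulrDr !mulrDl.
apply: PD; last exact: IH.
rewrite mulrA -Er pref_comm // -!mulrA; apply: Ppsik; first by apply: leq_ltn_trans mk.
by rewrite !mulrA; apply: IH.
Qed.

Lemma Pl_psik_right (k : nat) r p : Ypol p -> Ppol (pref k * psi r * p).
Proof.
move=> hp; case: (ltngtP r k) => [rk|kr|E].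
- move: rk; rewrite leq_eqVlt => /orP[/eqP E|rk].
    rewrite -E /pref big_nat_recr //= -/(pref r) psikE -!mulrA.
    by rewrite (mulrA (psi r)); apply/Pgen/YM => //; exact: Ypsi2.
  have Ek : pref k = pref r * psik r * psik r.+1 * \prod_(r.+2 <= j < k) psik j.
    rewrite /pref (@big_cat_nat _ _ _ r.+2) //=.
    by rewrite !big_nat_recr.
  case: (psik_case r.+1) => [E0|[s hs Es]].
    by rewrite Ek E0 mulr0 !mul0r; exact: P0.
  have [D hD EB] := Ybraid hs.
  have comm_tail : (\prod_(r.+2 <= j < k) psik j) * psi r
      = psi r * \prod_(r.+2 <= j < k) psik j.
    rewrite big_seq; elim/big_ind: _ => [|a b ha hb|j].
    - by rewrite mul1r mulr1.
    - by rewrite -mulrA hb mulrA ha mulrA.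
    - by rewrite mem_index_iota -psikE => /andP[hj _]; rewrite (psik_comm hj).
  have -> : pref k * psi r * p = psi s * (pref k * p) +
      pref r * D * (\prod_(j <- index_iota r.+2 k) psik j) * p.
    rewrite {1}Ek -(mulrA _ _ (psi r)) comm_tail Es psikE !mulrA.
    have := congr1 (fun z => pref r * z) EB; rewrite mulrDr !mulrA => ->.
    rewrite !mulrDl; congr (_ + _).
    by rewrite Ek Es psikE !mulrA -Es pref_comm.
  apply: PD; first by apply: Ppsi; [rewrite hs | apply: Pgen].
  apply: Pclaim => //; apply/allP => j; rewrite mem_index_iota => /andP[hj _].
  by apply: ltn_trans hj.
- rewrite -psikE pref_comm // -mulrA; apply: Ppsik; first exact: leq_ltn_trans kr.
  exact: Pgen.
- have -> : pref k * psi r = pref k.+1.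
    by rewrite /pref [RHS]big_nat_recr //= -{3}E psikE.
  exact: Pgen.
Qed.

Lemma Pr_Y a q : Ppol a -> Ypol q -> Ppol (a * q).
Proof.
move=> + hq; elim=> [k p hp|k b _ h|i b _ h|r b r0 _ h|b c _ h _ h'|b _ h].
- by rewrite -mulrA; apply/Pgen/YM.
- by rewrite -mulrA; apply: Py.
- by rewrite -mulrA; apply: Pi.
- by rewrite -mulrA; apply: Ppsi.
- by rewrite mulrDl; apply: PD.
- by rewrite mulNr; apply: PN.
Qed.

Lemma Pr_psi a r : Ppol a -> Ppol (a * psi r).
Proof.
elim=> [k p hp|k b _ h|i b _ h|s b r0 _ h|b c _ h _ h'|b _ h].
- have [p' [p'' [h1 h2 E]]] := Ypsi r hp.
  rewrite -mulrA E mulrDr mulrA; apply: PD; first exact: Pl_psik_right.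
  exact: Pgen.
- by rewrite -mulrA; apply: Py.
- by rewrite -mulrA; apply: Pi.
- by rewrite -mulrA; apply: Ppsi.
- by rewrite mulrDl; apply: PD.
- by rewrite mulNr; apply: PN.
Qed.

Section Module.
Variables (V : lmodType A) (i0 : iseq) (v : V).
Hypothesis v_idem : forall i, idem i *: v = (i == i0)%:R *: v.
Hypothesis v_y : forall k, yk k *: v = 0.
Hypothesis i0_0 : forall k, k = 0%N :> nat -> i0 k = 0.
Hypothesis v_pref : forall k : nat, (0 < k)%N -> pref k *: v = 0.

Definition killed (m : V) : Prop :=
  (forall k, k = 0%N :> nat -> yk k *: m = 0) /\
  (forall i k, k = 0%N :> nat -> i k != 0 -> idem i *: m = 0).

Lemma Yv p : Ypol p -> exists c : int, p *: v = v *~ c.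
Proof.
elim=> [|k q _ [c E]|i q _ [c E]|q1 q2 _ [c E] _ [c' E']|q _ [c E]].
- by exists 1; rewrite scale1r.
- by exists 0; rewrite -scalerA E -scaler_int scalerA commr_int -scalerA v_y scaler0.
- exists (c *+ (i == i0)); rewrite -scalerA E -scaler_int scalerA commr_int.
  rewrite -scalerA v_idem; case: eqP => _; first by rewrite scale1r scaler_int.
  by rewrite scale0r scaler0.
- by exists (c + c'); rewrite scalerDl E E' mulrzDr.
- by exists (- c); rewrite scaleNr E mulrNz.
Qed.

Lemma Pkilled a : Ppol a -> killed (a *: v).
Proof.
elim=> [k p hp|k b _ [h h']|i b _ [h h']|s b s0 _ [h h']|b c _ [h1 h1'] _ [h2 h2']|b _ [h h']].
- have [c E] := Yv hp; rewrite -scalerA E -scaler_int.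
  rewrite [pref k *: _]scalerA commr_int -scalerA.
  case: k => [|k]; last by rewrite v_pref // scaler0; split=> *; rewrite scaler0.
  rewrite {1}/pref big_geq // scale1r; split=> [l hl|i l hl il].
    by rewrite scalerA commr_int -scalerA v_y scaler0.
  rewrite scalerA commr_int -scalerA v_idem; case: eqP => [Ei|_]; last by rewrite scale0r scaler0.
  by rewrite Ei i0_0 ?eqxx in il.
- split=> [l hl|i l hl il]; rewrite !scalerA mulrA.
    by rewrite (relE (klr_yy _ _ _ l k)) -!scalerA h // scaler0.
  by rewrite -yk_idem -!scalerA (h' i l) // scaler0.
- split=> [l hl|j l hl jl]; rewrite !scalerA mulrA.
    by rewrite yk_idem -!scalerA h // scaler0.
  rewrite (relE (klr_idem _ _ _ j i)); case: eqP => [E|_]; last by rewrite mul0r scale0r.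
  by rewrite -scalerA (h' j l).
- split=> [l hl|i l hl il]; rewrite !scalerA mulrA.
    have [n1 n2] : l != lo s /\ l != hi s.
      by rewrite -!val_eqE /= hl; case: (s : nat) s0.
    by rewrite -psi_yk // -!scalerA h // scaler0.
  rewrite -[i](sactK s) -psi_idem -!scalerA (h' _ l) ?scaler0 //.
  by rewrite ffunE tpermD // -val_eqE /= hl; case: (s : nat) s0.
- by split=> [l hl|i l hl il]; rewrite scalerDl scalerDr ?h1 ?h2 ?(h1' _ l) ?(h2' _ l) // addr0.
- by split=> [l hl|i l hl il]; rewrite scaleNr scalerN ?h ?(h' _ l) // oppr0.
Qed.
End Module.
End KLRtheory.
End CyclotomicFactor.

Lemma free_ind (X : choiceType) (Q : {malg int[{fmonom X}]} -> Prop) :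
  Q 1 -> (forall a b, Q a -> Q b -> Q (a + b)) -> (forall a, Q a -> Q (- a)) ->
  (forall a x, Q a -> Q (a * mkmalgU (fmu x) 1)) -> forall a, Q a.
Proof.
move=> Q1 QD QN QM a.
have Q0 : Q 0 by rewrite -(subrr 1); apply: QD (QN _ _).
have Qw (w : seq X) : Q (mkmalgU (FMonom w) 1).
  elim/last_ind: w => [|w x IH].
    by rewrite (_ : FMonom [::] = mone) //; apply/val_inj; rewrite /= fm1.
  rewrite (_ : mkmalgU _ 1 = mkmalgU (FMonom w) 1 * mkmalgU (fmu x) 1); first exact: QM.
  rewrite malgM_def fgmulUU mulr1; congr mkmalgU.
  by apply/val_inj; rewrite /= fmM fmU cats1.
rewrite [a]monalgE; apply: big_ind => // w _.
have -> : mkmalgU w a@_w = mkmalgU w 1 *~ a@_w.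
  by rewrite -raddfMz /= intz.
have Q1w : Q (mkmalgU w 1) by case: (w).
have Qn k : Q (mkmalgU w 1 *+ k).
  by elim: k => [|k IH]; rewrite ?mulr0n // mulrS; apply: QD.
by case: (a@_ _) => m; [exact: Qn | apply/QN/Qn].
Qed.

Lemma kgen_ind e n (Q : klr e n -> Prop) :
  Q 1 -> (forall a b, Q a -> Q b -> Q (a + b)) -> (forall a, Q a -> Q (- a)) ->
  (forall a x, Q a -> Q (a * kgen x)) -> forall a, Q a.
Proof.
move=> Q1 QD QN QM a; rewrite -[a]qring_reprK; move: (qring_repr a) => {a}.
apply: free_ind => [|a b ha hb|a ha|a x ha].
- by rewrite rmorph1.
- by rewrite rmorphD; apply: QD.
- by rewrite rmorphN; apply: QN.
- by rewrite rmorphM; apply: QM.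
Qed.

Lemma klr_rel_lift e n (R S : pzRingType) (f : {rmorphism R -> S}) E P Y l r :
  @klr_rel e n S (f \o E) (f \o P) (f \o Y) l r ->
  exists l0 r0, [/\ klr_rel E P Y l0 r0, f l0 = l & f r0 = r].
Proof.
case=> [i j||k i|s i|s k|s i|s i|s k h1 h2|s k h|s i|s k i h] /=.
- do 2!eexists; split; [exact: (klr_idem _ _ _ i j)|by rewrite rmorphM|].
  by case: eqP; rewrite ?rmorph0.
- do 2!eexists; split; [exact: klr_sum1|by rewrite rmorph_sum|by rewrite rmorph1].
- by do 2!eexists; split; [exact: (klr_y1 _ _ _ k i)|..]; rewrite rmorphM.
- by do 2!eexists; split; [exact: (klr_psi1 _ _ _ s i)|..]; rewrite rmorphM.
- by do 2!eexists; split; [exact: (klr_yy _ _ _ s k)|..]; rewrite rmorphM.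
- by do 2!eexists; split; [exact: (klr_psiy _ _ _ s i)|..];
    rewrite !(rmorphM, rmorphD, rmorph_nat).
- by do 2!eexists; split; [exact: (klr_ypsi _ _ _ s i)|..];
    rewrite !(rmorphM, rmorphD, rmorph_nat).
- by do 2!eexists; split; [exact: (klr_psiyC _ _ _ h1 h2)|..]; rewrite rmorphM.
- by do 2!eexists; split; [exact: (klr_psiC _ _ _ h)|..]; rewrite rmorphM.
- do 2!eexists; split; [exact: (klr_psi_sq _ _ _ s i)|by rewrite !rmorphM|].
  rewrite rmorphM; congr (_ * _); rewrite /psi_sq /=.
  by do !case: ifP => _; rewrite ?(rmorph0, rmorph1, rmorphB, rmorphM).
- do 2!eexists; split; [exact: (klr_braid _ _ _ i h)|by rewrite !(rmorphM, rmorphB)|].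
  rewrite rmorphM; congr (_ * _); rewrite /braid_err /=; do !case: ifP => _;
  by rewrite ?(rmorph0, rmorph1, rmorphN1, rmorphD, rmorphN, rmorphM, rmorph_nat).
Qed.

Lemma klr_relE e n (l r : klr e n) :
  klr_rel (@idem e n) (@psi e n) (@yk e n) l r -> l = r.
Proof.
by case/(klr_rel_lift (f := qring_pi (@free_rel e n))) => l0 [r0 [/qring_pi_rel + <- <-]].
Qed.

Section Factor.
Import CyclotomicFactor.

Lemma kgen_P e n (a : klr e n) : Ppol (@idem e n) (@psi e n) (@yk e n) a.
Proof.
have relE := @klr_relE e n.
elim/kgen_ind: a => [|a b|a|a [i|[r|k]] ha].
- exact/PY/Y1.
- exact: PD.
- exact: PN.
- by apply: Pr_Y => //; exact: Yidem.
- exact: (Pr_psi relE).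
- by apply: Pr_Y => //; exact: Yyk.
Qed.

Variables (e n : nat) (lam : par2 n).
Local Notation v := (vgen e lam).

Lemma tiniE x y (r : 'I_n) : par2_val lam = nseq x 2 ++ nseq y 1 ->
  val (tini lam r) = two_col_node x r.
Proof.
move=> E; rewrite ffunE /= E young_two_col (nth_map 0%N) ?nth_iota ?size_iota //.
all: have := size_young_par2 lam; rewrite E young_two_col size_map size_iota => ->.
all: exact: ltn_ord.
Qed.

Lemma tini0 (r : 'I_n) : r = 0%N :> nat -> val (tini lam r) = (1, 1)%N.
Proof.
have [[x y] /= E] := two_colP lam; rewrite (tiniE _ E) /two_col_node => ->.
by case: x E.
Qed.

Lemma vgen_rel l r : specht_rel lam l r -> l *: v = r *: v.
Proof. exact: cyclic_gen_rel. Qed.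

Lemma vgen_pref (k : nat) : (0 < k)%N -> pref (@psi e n) k *: v = 0.
Proof.
case: k => // k _; rewrite /pref big_nat_recr //= -/(pref _ _).
case: (psik_case (@psi e n) k) => [->|[r hr ->]]; first by rewrite mulr0 scale0r.
have [[x y] /= E] := two_colP lam.
have sz : (x.*2 + y)%N = n.
  by have := size_young_par2 lam; rewrite E young_two_col size_map size_iota.
have El : val (tini lam (lo r)) = two_col_node x k by rewrite (tiniE _ E) -hr.
have Eh : val (tini lam (hi r)) = two_col_node x k.+1 by rewrite (tiniE _ E) -hr.
have mem (q : nat) : (q < n)%N -> two_col_node x q \in young lam.
  by move=> hq; rewrite E young_two_col map_f // mem_iota /= sz.
have zero s : specht_rel lam s 0 -> s *: v = 0 by move/vgen_rel; rewrite scale0r.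
have rn := hi_subproof r; rewrite hr in rn.
have nodeE q : (q < x)%N -> two_col_node x q.*2 = (q.+1, 1)%N.
  by move=> qx; rewrite /two_col_node ltn_double qx doubleK odd_double.
have nodeO q : (q < x)%N -> two_col_node x q.*2.+1 = (q.+1, 2)%N.
  by move=> qx; rewrite /two_col_node ltn_Sdouble qx /= uphalf_double odd_double.
have nodeT q : (x.*2 <= q)%N -> two_col_node x q = ((q - x).+1, 1)%N.
  by move=> qx; rewrite /two_col_node ltnNge qx.
case: (ltnP k x.*2) => [kx|xk]; last first.
  rewrite -scalerA (zero (psi e r)) ?scaler0 //.
  apply: (@sp_garnir1 _ _ _ _ (k - x).+1 1).
  - by rewrite El nodeT.
  - rewrite (_ : (_, _) = two_col_node x k.+1); first exact: mem.
    by rewrite nodeT ?leqW // subSn //; lia.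
  - rewrite E nth_cat size_nseq /= nth_nseq.
    have -> : (k - x < x)%N = false by lia.
    have h : (k - x - x < y)%N by lia.
    by rewrite nth_nseq h.
have Ek := odd_double_half k; move: Ek kx; case: (odd k); rewrite ?add1n ?add0n; last first.
  move=> Ek kx; set q := k./2 in Ek.
  have qx : (q < x)%N by rewrite -ltn_double Ek.
  rewrite -scalerA (zero (psi e r)) ?scaler0 //; apply: sp_row.
  by rewrite El Eh -Ek nodeE // nodeO.
move=> Ek kx; set q := k./2 in Ek.
have qx : (q < x)%N by rewrite -ltn_Sdouble Ek.
have hi_node : two_col_node x k.+1 = (q.+2, 1)%N.
  rewrite -Ek -doubleS; have [h|h] := ltnP q.+1 x; first exact: nodeE.
  have -> : x = q.+1 by apply/eqP; rewrite eqn_leq h qx.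
  by rewrite /two_col_node ltnn -addnn addnK.
have qn : (q.*2 < n.-1)%N by have := ltn_ord r; rewrite hr -Ek; apply: ltn_trans.
pose s := Ordinal qn.
rewrite -{1}Ek /pref big_nat_recr //= -/(pref _ _) -[q.*2]/(s : nat) psikE -mulrA.
rewrite -scalerA (zero (psi e s * psi e r)) ?scaler0 //.
apply: (@sp_garnir2 _ _ _ _ _ q.+1).
- by rewrite (tiniE _ E) /= nodeE.
- by rewrite -hi_node; apply: mem.
- by rewrite E nth_cat size_nseq qx nth_nseq qx.
- by rewrite hr -Ek.
Qed.

Lemma vgen_killed (m : specht e lam) :
  killed (@idem e n) (@yk e n) m.
Proof.
have -> : m = cyclic_repr m *: v by rewrite -cyclic_piE cyclic_reprK.
apply: (Pkilled (@klr_relE e n) (i0 := ires lam e)); last exact: kgen_P.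
- by move=> i; apply/vgen_rel/sp_idem.
- by move=> k; rewrite (vgen_rel (sp_y _ _ k)) scale0r.
- by move=> k k0; rewrite ffunE tini0 // /res subrr.
- exact: vgen_pref.
Qed.

Lemma specht_cyc : satisfies_rel (@cyc_rel e n) (specht e lam).
Proof.
move=> l r lr m; have [h1 h2] := vgen_killed m.
by case: lr => [i k k0 ik|k k0]; rewrite scale0r; [apply: h2 ik | apply: h1].
Qed.

(* The Specht module as a module over the cyclotomic quotient: same underlying
   group as [specht e lam], and qring_pi _ a acts as a does. *)
Definition cspecht : lmodType (cklr e n) := descend specht_cyc.
End Factor.

Section Basis.
Variables (e n : nat).

(* Permutations act on the left: the word r_1 ... r_m stands for the composite map
   s_{r_1} o ... o s_{r_m}, while (u * v)%g is v o u. *)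
Definition perm_of_word (w : seq 'I_n.-1) : 'S_n :=
  foldr (fun r u => (u * sperm r)%g) 1%g w.

Definition reduced_expr (u : 'S_n) (w : seq 'I_n.-1) : Prop :=
  perm_of_word w = u /\
  forall w', perm_of_word w' = u -> (size w <= size w')%N.

Variable rex : 'S_n -> seq 'I_n.-1.

Definition psi_perm (u : 'S_n) : klr e n := \prod_(r <- rex u) psi e r.

Definition vtab (lam : par2 n) (t : tableau n lam) : specht e lam :=
  psi_perm (dperm t) *: vgen e lam.

Definition in_span (lam : par2 n) (Q : pred (tableau n lam)) (m : specht e lam) :
  Prop := exists c : tableau n lam -> int,
    m = \sum_(t | is_std t && Q t) vtab t *~ c t.

(* The degree k component: the Specht module is graded by giving each basis
   element vtab t the degree deg e t. *)
Definition homogeneous_elt (lam : par2 n) (k : int) : specht e lam -> Prop :=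
  in_span (fun t : tableau n lam => deg e t == k).

Definition dominated (mu lam : par2 n) (phi : specht e mu -> specht e lam) : Prop :=
  in_span (@is_dominated n lam mu) (phi (vgen e mu)).

Definition homogeneous (mu lam : par2 n) (phi : specht e mu -> specht e lam)
    (d : int) : Prop :=
  forall k m, homogeneous_elt k m -> homogeneous_elt (k + d) (phi m).
End Basis.

Section TheTableau.
Variables x y j : nat.

Definition T_entry (A : nat * nat) : nat :=
  let: (a, b) := A in
  if (a <= x - j)%N then (2 * (a - 1) + b)%N
  else if b == 1%N then (x - j + a)%N else (x + y + a)%N.

Definition T_tab n (lam : par2 n) : tableau n lam := tab_of_entry lam T_entry.

Lemma young_two_colP a b : reflect
  (0 < a /\ (b = 1 /\ a <= x + y \/ b = 2 /\ a <= x))%N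
  ((a, b) \in young (two_col x y)).
Proof.
rewrite /two_col young_two_col; apply: (iffP mapP) => [[k]|[a0 h]].
  rewrite mem_iota /two_col_node /= => hk; case: ifP => hx [-> ->]; last by lia.
  by have := odd_double_half k; case: (odd k); lia.
case: h => [[-> ha]|[-> ha]].
- case: (leqP a x) => hx.
    exists (a.-1).*2; first by rewrite mem_iota; lia.
    rewrite /two_col_node ltn_double doubleK odd_double.
    have -> : (a.-1 < x)%N by lia.
    by rewrite prednK.
  exists (a.-1 + x)%N; first by rewrite mem_iota; lia.
  rewrite /two_col_node.
  have -> : (a.-1 + x < x.*2)%N = false by lia.
  by rewrite addnK prednK.
- exists (a.-1).*2.+1; first by rewrite mem_iota; lia.
  rewrite /two_col_node ltn_Sdouble /= uphalf_double odd_double.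
  have -> : (a.-1 < x)%N by lia.
  by rewrite prednK.
Qed.

Lemma T_tab_std n (lam : par2 n) :
  (j <= x)%N -> par2_val lam = two_col x y -> is_std (T_tab lam).
Proof.
move=> jx E.
have sz : (x.*2 + y)%N = n.
  by have := size_young_par2 lam; rewrite E young_two_col size_map size_iota.
have nodeP (A : node lam) : let: (a, b) := val A in
    (0 < a /\ (b = 1 /\ a <= x + y \/ b = 2 /\ a <= x))%N.
  have : val A \in young (two_col x y) by rewrite -E; exact: (valP A).
  by case: (val A) => a b /young_two_colP.
have entry_inj (A B : node lam) : T_entry (val A) = T_entry (val B) -> A = B.
  move=> h; apply: val_inj; move: (nodeP A) (nodeP B) h.
  case: (val A) (val B) => [a b] [a' b'] /=.
  by move=> h1 h2 h; congr (_, _); move: h; do !case: ifP; lia.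
have entry_n (A : node lam) : (0 < T_entry (val A) <= n)%N.
  have := nodeP A; case: (val A) => a b /=; do !case: ifP; lia.
have entry_ex (r : 'I_n) : exists A : node lam, T_entry (val A) = r.+1.
  have hr := ltn_ord r.
  have [A hA AE] : exists2 A, A \in young lam & T_entry A = r.+1.
    rewrite E; have [h1|h1] := ltnP r (x - j).*2.
      exists (r./2.+1, (odd r).+1)%N; first by apply/young_two_colP; case: (odd r); lia.
      by have := odd_double_half r; rewrite /T_entry ifT; lia.
    have [h2|h2] := ltnP r (x.*2 + y - j).
      exists (r.+1 - (x - j), 1)%N; first by apply/young_two_colP; lia.
      by rewrite /T_entry ifF /=; lia.
    exists (r.+1 - (x + y), 2)%N; first by apply/young_two_colP; lia.
    by rewrite /T_entry ifF /=; lia.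
  by exists (SeqSub hA).
have TE r : T_entry (val (T_tab lam r)) = r.+1.
  rewrite ffunE; case: pickP => [A /eqP //|h].
  by have [A /eqP] := entry_ex r; rewrite h.
apply/and4P; split.
- by apply/injectiveP => r s h; apply/ord_inj/succn_inj; rewrite -!TE h.
- apply/forallP => A; have := entry_n A; case hk: (T_entry (val A)) => [//|k] /= hkn.
  by apply/existsP; exists (Ordinal hkn); apply/eqP/entry_inj; rewrite TE hk.
- apply/forallP => r; apply/forallP => s; apply/implyP => h1; apply/implyP => h2.
  rewrite -ltnS -!TE; move: h1 h2 (nodeP (T_tab lam r)) (nodeP (T_tab lam s)).
  case: (val (T_tab lam r)) (val (T_tab lam s)) => [a b] [a' b'] /=.
  by do !case: ifP; lia.
- apply/forallP => r; apply/forallP => s; apply/implyP => h1; apply/implyP => h2.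
  rewrite -ltnS -!TE; move: h1 h2 (nodeP (T_tab lam r)) (nodeP (T_tab lam s)).
  case: (val (T_tab lam r)) (val (T_tab lam s)) => [a b] [a' b'] /=.
  by do !case: ifP; lia.
Qed.
End TheTableau.

(* Main.v *)
Require Import Defs.
From HB Require Import structures.
From mathcomp Require Import all_boot all_order all_fingroup all_algebra.
From mathcomp Require Import zify ring.
Set Implicit Arguments.
Unset Strict Implicit.
Unset Printing Implicit Defensive.
Import Order.TTheory GRing.Theory Num.Theory.
Local Open Scope ring_scope.

(** A standard tableau of shape (2^x, 1^y) is a lattice path that never goes below
    height 0: an entry of column 1 is an up step U, an entry of column 2 is a down
    step D. The initial tableau is UDUD...UD U...U, and the word defining v^t turns,
    one letter at a time, valleys DU into peaks UD until the path of t is reached. A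
    descent r of t is a peak at the entries r and r+1 that ends above height 0; then
    v^t = psi_r v^s, where s has the peak flattened to a valley ([vtab_peel]). Since
    two different descents are never adjacent, reduced words of the same tableau
    differ by commutations only, which makes v^t independent of the chosen reduced
    word ([psiw_indep]).

    The proof rests on a triangularity statement ([tame_std]): y_k v^t, and psi_r v^t
    unless t has a valley at r, are integer combinations of vectors v^s where s has
    the residue sequence and the degree that the grading predicts and takes strictly
    fewer swaps to reach than t. At a descent this is the quadratic relation. At equal
    steps or at a peak of height 0 one peels off another descent s: if s is far from
    r, then psi_s and psi_r commute; if s is adjacent, the braid relation leads to
    lower tableaux, except one swap above the initial tableau, where a Garnir relation
    gives 0. Degrees match because d_A(lambda) depends on the height only
    ([deg_sum]), so that flattening a peak changes the degree by a Cartan integer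
    ([deg_descent]).

    Let T be the tableau of the theorem, with path (UD)^(x-j) U^(y+j) D^j, and mu the
    shape of path (UD)^(x-j) U^(y+2j). As y + j + 1 is 0 modulo e, the final down steps
    of T have the residues of the final up steps of the initial mu-tableau, so the
    residue sequences agree ([T_res]); the first of these down steps is the only step
    whose weight distinguishes the degrees, which gives degree 1 ([deg_T]). The vector
    v^T satisfies the relations of the Specht module of mu ([T_specht_vector]).
    Relations in the first x - j rows involve generators that commute with the word of
    T, so they are inherited from v^lambda ([vtab_commute]). The others say that
    y_k v^T and some psi_u v^T vanish; by triangularity these are combinations of
    vectors of degree larger than that of T with prescribed residues, and no such
    tableau exists ([deg_le_T]).

    Finally, the homomorphism sends v^s = psi_r v^s' to psi_r phi(v^s'), so its
    homogeneity follows from the triangularity for lambda by induction on s. *)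

(** * Inversions and words *)

Section Inversions.
Variable n : nat.
Implicit Types (u : 'S_n) (r s : 'I_n.-1) (p : 'I_n).

Lemma lo_neq_hi r : lo r != hi r.
Proof. by rewrite -val_eqE /=; lia. Qed.

Lemma sperm_lo r : sperm r (lo r) = hi r. Proof. exact: tpermL. Qed.
Lemma sperm_hi r : sperm r (hi r) = lo r. Proof. exact: tpermR. Qed.
Lemma sperm_far r (k : 'I_n) : k != lo r -> k != hi r -> sperm r k = k.
Proof. by move=> h1 h2; rewrite /sperm tpermD // eq_sym. Qed.
Lemma spermK r : involutive (sperm r). Proof. exact: tpermK. Qed.

Variant sperm_spec r (k : 'I_n) : 'I_n -> bool -> bool -> Type :=
| SpermLo of k = lo r : sperm_spec r k (hi r) true false
| SpermHi of k = hi r : sperm_spec r k (lo r) false true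
| SpermFar of (k != r :> nat) & (k != r.+1 :> nat) : sperm_spec r k k false false.

Lemma spermP r k : sperm_spec r k (sperm r k) (k == lo r) (k == hi r).
Proof.
have [->|h1] := eqVneq k (lo r).
  by rewrite sperm_lo (negbTE (lo_neq_hi r)); constructor.
have [->|h2] := eqVneq k (hi r); first by rewrite sperm_hi; constructor.
by rewrite sperm_far //; constructor.
Qed.

Lemma lo_hi_succ r s : s = r.+1 :> nat -> lo s = hi r.
Proof. by move=> h; apply: val_inj; rewrite /= h. Qed.

Lemma sperm_succ_lo r s : s = r.+1 :> nat -> sperm s (lo r) = lo r.
Proof. by move=> h; rewrite sperm_far // -val_eqE /= h; lia. Qed.

Lemma sperm_succ_hi r s : s = r.+1 :> nat -> sperm r (hi s) = hi s.
Proof. by move=> h; rewrite sperm_far // -val_eqE /= h; lia. Qed.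

Lemma sperm_braid r s p : s = r.+1 :> nat ->
  sperm r (sperm s (sperm r p)) = sperm s (sperm r (sperm s p)).
Proof.
move=> h; have ls := lo_hi_succ h; have sl := sperm_succ_lo h; have sh := sperm_succ_hi h.
have [->|p1] := eqVneq p (lo r); first by rewrite sl sperm_lo -ls sperm_lo sh.
have [->|p2] := eqVneq p (hi r); first by rewrite sperm_hi sl sperm_lo -ls sperm_lo sh sperm_hi.
have [->|p3] := eqVneq p (hi s); first by rewrite sh sperm_hi ls sperm_hi sl.
by rewrite (sperm_far p1 p2) sperm_far ?ls // sperm_far ?sperm_far ?ls.
Qed.

Lemma sperm_lt r (p q : 'I_n) :
  (p < q)%N -> (p != lo r) || (q != hi r) -> (sperm r p < sperm r q)%N.
Proof.
have L : nat_of_ord (lo r) = r by []. have H : nat_of_ord (hi r) = r.+1 by [].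
by case: spermP => [->|->|a b]; case: spermP => [->|->|c d]; rewrite ?L ?H ?orbT ?orbF //=; lia.
Qed.

Definition inversions u : {set 'I_n * 'I_n} :=
  [set p : 'I_n * 'I_n | (p.1 < p.2)%N && ((u^-1)%g p.2 < (u^-1)%g p.1)%N].
Definition ninv u := #|inversions u|.

(** The involution s_r x s_r preserves the set of increasing pairs of positions except
    (r, r+1), so it matches the inversions of u with those of s_r u other than that
    pair. *)
Lemma ninv_sperm_up u r :
  ((u^-1)%g (lo r) < (u^-1)%g (hi r))%N -> ninv (u * sperm r)%g = (ninv u).+1.
Proof.
move=> h.
have E k : ((u * sperm r)^-1)%g k = (u^-1)%g (sperm r k).
  by rewrite invMg permM /sperm tpermV.
pose f (p : 'I_n * 'I_n) := (sperm r p.1, sperm r p.2).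
have fK : involutive f by move=> [p q]; rewrite /f /= !spermK.
have -> : ninv (u * sperm r)%g = #|(lo r, hi r) |: f @: inversions u|.
  apply: eq_card => -[p q]; rewrite /inversions !inE !E /=.
  rewrite -[(p, q) in RHS](fK (p, q)) mem_imset ?inE /=; last exact: inv_inj.
  have [[-> ->]|npq] := eqVneq (p, q) (lo r, hi r).
    by rewrite sperm_lo sperm_hi h fK eqxx /= ltnSn.
  have [[-> ->]|nqp] := eqVneq (p, q) (hi r, lo r).
    rewrite fK sperm_lo sperm_hi xpair_eqE [hi r == _]eq_sym (negbTE (lo_neq_hi r)) /=.
    by have -> : (u^-1%g (hi r) < u^-1%g (lo r))%N = false by [lia]; rewrite !andbF.
  rewrite fK (negbTE npq) orFb; congr andb.
  have D a b : (a, b) != (lo r, hi r) -> (a < b)%N -> (sperm r a < sperm r b)%N.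
    by rewrite xpair_eqE negb_and => h1 h2; apply: sperm_lt.
  apply/idP/idP => [|k]; first exact: D.
  rewrite -[p](spermK r) -[q](spermK r); apply: D => //.
  apply: contra nqp => /eqP[h1 h2].
  by rewrite -[p](spermK r) -[q](spermK r) h1 h2 sperm_lo sperm_hi.
rewrite cardsU1 card_imset; last exact: inv_inj.
suff -> : (lo r, hi r) \notin f @: inversions u by [].
rewrite -[(lo r, hi r)]fK mem_imset ?inE /=; last exact: inv_inj.
by rewrite sperm_lo sperm_hi /= ltnNge leqnSn.
Qed.

Lemma ninv_sperm_down u r :
  ((u^-1)%g (hi r) < (u^-1)%g (lo r))%N -> ninv u = (ninv (u * sperm r)%g).+1.
Proof.
move=> h; rewrite -(@ninv_sperm_up _ r).
  by congr ninv; rewrite -mulgA /sperm tperm2 mulg1.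
by rewrite invMg /sperm tpermV !permM tpermL tpermR.
Qed.

Lemma ninv1 : ninv 1 = 0%N.
Proof. by apply: eq_card0 => p; rewrite !inE invg1 !perm1; case: ltngtP. Qed.

Lemma inv_lo_hi u r : ((u^-1)%g (lo r) < (u^-1)%g (hi r))%N
   \/ ((u^-1)%g (hi r) < (u^-1)%g (lo r))%N.
Proof.
case: (ltngtP ((u^-1)%g (lo r)) ((u^-1)%g (hi r))) => [||/ord_inj/perm_inj E]; [by left|by right|].
by have := lo_neq_hi r; rewrite E eqxx.
Qed.

Lemma ninv_word w : (ninv (perm_of_word w) <= size w)%N.
Proof.
elim: w => [|r w IH] /=; first by rewrite ninv1.
case: (inv_lo_hi (perm_of_word w) r) => h; first by rewrite ninv_sperm_up.
by have := ninv_sperm_down h; move: IH; lia.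
Qed.

(** Such a permutation and its inverse are both strictly increasing, hence both send
    every k to something at least k. *)
Lemma no_descent_perm1 (u : 'S_n) :
  (forall r, (u (lo r) < u (hi r))%N) -> u = 1%g.
Proof.
move=> h.
have adj (p q : 'I_n) : q = p.+1 :> nat -> (u p < u q)%N.
  move=> hq; have hn : (p < n.-1)%N by move: (ltn_ord q); rewrite hq; lia.
  have := h (Ordinal hn); congr (u _ < u _)%N; exact: val_inj.
have step (k : nat) (p q : 'I_n) : q = (p + k.+1)%N :> nat -> (u p < u q)%N.
  elim: k q => [|k IH] q hq; first by apply: adj; rewrite hq addn1.
  have hn : (p + k.+1 < n)%N by move: (ltn_ord q); rewrite hq; lia.
  by apply: ltn_trans (IH (Ordinal hn) erefl) (adj _ _ _); rewrite hq /= addnS.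
have mono (p q : 'I_n) : (p < q)%N -> (u p < u q)%N.
  by move=> pq; apply: (step (q - p.+1)%N); rewrite addnS -addSn subnKC.
have ge (v : 'S_n) : (forall p q : 'I_n, (p < q)%N -> (v p < v q)%N) ->
    forall (k : nat) (p : 'I_n), p = k :> nat -> (p <= v p)%N.
  move=> hv; elim=> [|k IH] p hp; first by rewrite hp.
  have hk : (k < n)%N by apply: ltn_trans (ltn_ord p); rewrite hp.
  have h1 : (v (Ordinal hk) < v p)%N by apply: hv; rewrite hp.
  by rewrite hp; apply: leq_ltn_trans (IH (Ordinal hk) erefl) h1.
have mono' (p q : 'I_n) : (p < q)%N -> ((u^-1)%g p < (u^-1)%g q)%N.
  move=> pq; case: ltngtP => // [k|/ord_inj/perm_inj E]; last by move: pq; rewrite E ltnn.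
  by have := mono _ _ k; rewrite !permKV ltnNge ltnW.
apply/permP => p; rewrite perm1; apply: val_inj; apply/eqP; rewrite eqn_leq (ge _ mono _ _ erefl).
by have := ge _ mono' _ (u p) erefl; rewrite permK => ->.
Qed.
End Inversions.

(** * Standard two-column tableaux *)

Section Tableau.
Variables (n : nat) (lam : par2 n).
Implicit Types (t : tableau n lam) (r s : 'I_n.-1) (p q : 'I_n).

Definition trow t p : nat := (val (t p)).1.
Definition tcol t p : nat := (val (t p)).2.

Lemma std_inj t : is_std t -> injective t.
Proof. by case/and4P => /injectiveP. Qed.

Lemma std_eq t p q : is_std t -> trow t p = trow t q -> tcol t p = tcol t q -> p = q.
Proof.
move=> st h1 h2; apply: (std_inj st); apply: val_inj.
by move: h1 h2; rewrite /trow /tcol; case: (val _) (val _) => ? ? [? ?] /= -> ->.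
Qed.

Lemma std_onto t A : is_std t -> A \in young lam -> exists p, val (t p) = A.
Proof.
case/and4P => _ /forallP h _ _ hA; have /existsP[p /eqP hp] := h (SeqSub hA).
by exists p; rewrite hp.
Qed.

Lemma std_row t p q : is_std t -> trow t p = trow t q -> (tcol t p < tcol t q)%N -> (p < q)%N.
Proof.
case/and4P => _ _ /forallP/(_ p)/forallP/(_ q) + _ h1 h2.
by move: h1 h2; rewrite /trow /tcol => -> ->; rewrite eqxx.
Qed.

Lemma std_col t p q : is_std t -> tcol t p = tcol t q -> (trow t p < trow t q)%N -> (p < q)%N.
Proof.
case/and4P => _ _ _ /forallP/(_ p)/forallP/(_ q) h1 h2.
by move: h1 h2; rewrite /trow /tcol => + h2 h3; rewrite h2 h3 eqxx.
Qed.

Definition swap t r : tableau n lam := [ffun p => t (sperm r p)].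

Lemma swapE t r p : swap t r p = t (sperm r p). Proof. by rewrite ffunE. Qed.
Lemma swap_lo t r : swap t r (lo r) = t (hi r). Proof. by rewrite swapE sperm_lo. Qed.
Lemma swap_hi t r : swap t r (hi r) = t (lo r). Proof. by rewrite swapE sperm_hi. Qed.
Lemma swap_far t r p : p != r :> nat -> p != r.+1 :> nat -> swap t r p = t p.
Proof. by move=> h1 h2; rewrite swapE sperm_far. Qed.
Lemma swapK t r : swap (swap t r) r = t.
Proof. by apply/ffunP => p; rewrite !swapE spermK. Qed.

(** A transposition of neighbours changes the order of no other pair of entries, so
    standardness can only fail at the two exchanged nodes. *)
Lemma swap_std t r : is_std t -> trow t (lo r) != trow t (hi r) ->
  tcol t (lo r) != tcol t (hi r) -> is_std (swap t r).
Proof.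
move=> st hr hc.
have key p q : (sperm r p < sperm r q)%N ->
    (trow t (sperm r p) = trow t (sperm r q)) \/ (tcol t (sperm r p) = tcol t (sperm r q)) ->
    (p < q)%N.
  move=> h1 h2; rewrite -[p](spermK r) -[q](spermK r); apply: sperm_lt => //.
  rewrite -negb_and; apply/negP => /andP[/eqP h3 /eqP h4].
  by move: h2 hr hc; rewrite h3 h4 => -[->|->]; rewrite eqxx.
apply/and4P; split.
- by apply/injectiveP => p q; rewrite !swapE => /(std_inj st)/perm_inj.
- apply/forallP => A; have [p hp] := std_onto st (valP A).
  by apply/existsP; exists (sperm r p); rewrite swapE spermK; apply/eqP/val_inj.
- apply/forallP => p; apply/forallP => q; apply/implyP => /eqP h1; apply/implyP => h2.
  rewrite !swapE in h1 h2; apply: key; last by left.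
  exact: std_row st h1 h2.
- apply/forallP => p; apply/forallP => q; apply/implyP => /eqP h1; apply/implyP => h2.
  rewrite !swapE in h1 h2; apply: key; last by right.
  exact: std_col st h1 h2.
Qed.

(** The first letters of the reduced words of [dperm t] are the r with this property
    ([reduced_cons], [cons_reduced]). *)
Definition descent t r : bool := (trow t (hi r) < trow t (lo r))%N.

Definition col_count t (c k : nat) : nat := #|[set p : 'I_n | (p < k)%N && (tcol t p == c)]|.

Lemma col_countS t c p : col_count t c p.+1 = (col_count t c p + (tcol t p == c))%N.
Proof.
rewrite /col_count; have [h|h] := eqVneq (tcol t p) c.
  rewrite addn1 (_ : [set q : 'I_n | _] = p |: [set q : 'I_n | (q < p)%N && (tcol t q == c)]).
    by rewrite cardsU1 inE ltnn.
  apply/setP => q; rewrite !inE ltnS leq_eqVlt andb_orl; congr (_ || _).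
  by apply/andP/eqP => [[/eqP/ord_inj]|->] //; rewrite h !eqxx.
rewrite addn0; apply: eq_card => q; rewrite !inE ltnS leq_eqVlt andb_orl.
case: eqP => //= /ord_inj ->; by rewrite (negbTE h) ltnn.
Qed.

Lemma col_count0 t c : col_count t c 0 = 0%N.
Proof. by apply: eq_card0 => q; rewrite inE. Qed.

Lemma col_count_mono t c k l : (k <= l)%N -> (col_count t c k <= col_count t c l)%N.
Proof.
move=> kl; apply/subset_leq_card/subsetP => q; rewrite !inE => /andP[h ->].
by rewrite andbT (leq_trans h).
Qed.
End Tableau.

Section TwoColumn.
Variables (n x y : nat) (lam : par2 n).
Hypothesis E : par2_val lam = two_col x y.
Implicit Types (t : tableau n lam) (r s : 'I_n.-1) (p q : 'I_n).

Lemma two_col_size : (x.*2 + y)%N = n.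
Proof. by have := size_young_par2 lam; rewrite E young_two_col size_map size_iota. Qed.

Lemma mem_shape a b : reflect
  (0 < a /\ (b = 1 /\ a <= x + y \/ b = 2 /\ a <= x))%N ((a, b) \in young lam).
Proof. by rewrite E; apply: young_two_colP. Qed.

Lemma nodeP t p : (0 < trow t p /\
  (tcol t p = 1 /\ trow t p <= x + y \/ tcol t p = 2 /\ trow t p <= x))%N.
Proof.
by apply/mem_shape; rewrite /trow /tcol -surjective_pairing; exact: (valP (t p)).
Qed.

Lemma std_at t a b : is_std t ->
  (0 < a /\ (b = 1 /\ a <= x + y \/ b = 2 /\ a <= x))%N ->
  exists p, trow t p = a /\ tcol t p = b.
Proof.
move=> st /mem_shape h; have [p hp] := std_onto st h.
by exists p; rewrite /trow /tcol hp.
Qed.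

(** Columns increase downwards, so the entries of a column fill its nodes from the top.
    A standard tableau is thus determined by the columns of its entries, that is, by
    a lattice path. *)
Lemma trow_col_count t p : is_std t -> trow t p = (col_count t (tcol t p) p).+1.
Proof.
move=> st; set c := tcol t p; set b := trow t p.
have hp := nodeP t p; rewrite -/b -/c in hp.
suff : perm_eq [seq trow t q | q <- enum [set q : 'I_n | (q < p)%N && (tcol t q == c)]]
    (iota 1 b.-1).
  by move/perm_size; rewrite size_map size_iota -cardE /col_count; lia.
apply: uniq_perm; last move=> a.
- rewrite map_inj_in_uniq ?enum_uniq // => q s.
  rewrite !mem_enum !inE => /andP[_ /eqP h1] /andP[_ /eqP h2] h3.
  by apply: (std_eq st) => //; rewrite h1 h2.
- exact: iota_uniq.
rewrite mem_iota; apply/mapP/idP => [[q]|ha].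
  rewrite mem_enum inE => /andP[h1 /eqP h2] ->.
  have [h _] := nodeP t q; rewrite h /=.
  have [h3|h3|h3] := ltngtP (trow t q) b; first by lia.
    by have := std_col st (esym h2) h3; lia.
  by have := std_eq st h3 h2 => hh; rewrite hh ltnn in h1.
have [|q [h1 h2]] := @std_at t a c st; first by lia.
exists q; rewrite // mem_enum inE h2 eqxx andbT.
by apply: (std_col st) => //; lia.
Qed.

Lemma col_count_sum t k : (k <= n)%N -> (col_count t 1 k + col_count t 2 k)%N = k.
Proof.
elim: k => [|k IH] hk; first by rewrite !col_count0.
have := col_countS t 1 (Ordinal hk); have := col_countS t 2 (Ordinal hk); rewrite /= => -> ->.
have := IH (ltnW hk); have := nodeP t (Ordinal hk).
by case=> _ [[-> _]|[-> _]] /=; lia.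
Qed.

Lemma trow_col1 t p : is_std t -> tcol t p = 1%N -> trow t p = (col_count t 1 p).+1.
Proof. by move=> st h; rewrite trow_col_count // h. Qed.
Lemma trow_col2 t p : is_std t -> tcol t p = 2 -> trow t p = (col_count t 2 p).+1.
Proof. by move=> st h; rewrite trow_col_count // h. Qed.

(** The node to the left of the one that holds p carries a smaller entry: the path
    never goes below height 0. *)
Lemma col_count_ballot t p : is_std t -> tcol t p = 2 -> (col_count t 2 p < col_count t 1 p)%N.
Proof.
move=> st h; have := nodeP t p; rewrite h trow_col2 // => hp.
have [|q [h1 h2]] := @std_at t (col_count t 2 p).+1 1 st; first by lia.
have qp : (q < p)%N by apply: (std_row st); rewrite ?h1 ?h2 ?h ?trow_col2.
have := col_count_mono t 1 qp; rewrite col_countS h2 eqxx.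
by have := trow_col1 st h2; rewrite h1; lia.
Qed.

(** As steps of a path: a peak ending above height 0, a peak ending at height 0, a
    valley, and two equal steps. Where the two columns differ, the sum of the rows is
    the number of entries so far, which determines the height of the path. *)
Variant local_spec t r : Prop :=
| LocDesc of descent t r & tcol t (lo r) = 1%N & tcol t (hi r) = 2
    & (trow t (lo r) + trow t (hi r) = r.+2)%N
| LocBase of trow t (lo r) = trow t (hi r) & tcol t (lo r) = 1%N & tcol t (hi r) = 2
    & (trow t (lo r) + trow t (hi r) = r.+2)%N
| LocAsc of (trow t (lo r) < trow t (hi r))%N & tcol t (lo r) = 2 & tcol t (hi r) = 1%N
    & (trow t (lo r) + trow t (hi r) = r.+2)%N
| LocSame of tcol t (hi r) = tcol t (lo r) & trow t (hi r) = (trow t (lo r)).+1.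

Lemma localP t r : is_std t -> local_spec t r.
Proof.
move=> st.
have L : nat_of_ord (lo r) = r by []. have H : nat_of_ord (hi r) = r.+1 by [].
have ls c : col_count t c (hi r) = (col_count t c r + (tcol t (lo r) == c))%N by rewrite H -L col_countS.
have rn : (r <= n)%N by have := ltn_ord r; lia.
have s12 := col_count_sum t rn.
have rl := trow_col_count (lo r) st; have rh := trow_col_count (hi r) st; rewrite L in rl.
have [_ [[h1 _]|[h1 _]]] := nodeP t (lo r); have [_ [[h2 _]|[h2 _]]] := nodeP t (hi r).
- by apply: LocSame; rewrite ?h1 ?h2 // rl rh h1 h2 ls h1 eqxx; lia.
- have := col_count_ballot st h2; rewrite !ls h1 /= => hb.
  move: rl rh; rewrite h1 h2 ls h1 /= => rl rh.
  have [h|h] := ltnP (trow t (hi r)) (trow t (lo r)).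
    by apply: LocDesc => //; lia.
  by apply: LocBase => //; lia.
- have := col_count_ballot st h1; rewrite L => hb.
  move: rl rh; rewrite h1 h2 ls h1 /= => rl rh.
  by apply: LocAsc => //; lia.
- by apply: LocSame; rewrite ?h1 ?h2 // rl rh h1 h2 ls h1 eqxx; lia.
Qed.

Lemma descent_local t r : is_std t -> descent t r ->
  [/\ tcol t (lo r) = 1%N, tcol t (hi r) = 2 & (trow t (lo r) + trow t (hi r) = r.+2)%N].
Proof. by rewrite /descent; move=> st; case: (localP r st) => [|->|+ _ _ _|_ ->] //; lia. Qed.

Lemma descent_swap_std t r : is_std t -> descent t r -> is_std (swap t r).
Proof.
move=> st hd; have [h1 h2 _] := descent_local st hd.
by apply: swap_std => //; rewrite ?h1 ?h2 //; move: hd; rewrite /descent; lia.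
Qed.

Lemma row_tini p : trow (tini lam) p = (two_col_node x p).1.
Proof. by rewrite /trow (tiniE _ E). Qed.
Lemma col_tini p : tcol (tini lam) p = (two_col_node x p).2.
Proof. by rewrite /tcol (tiniE _ E). Qed.

Lemma tini_lex p q : (p < q)%N ->
  (trow (tini lam) p < trow (tini lam) q \/
   trow (tini lam) p = trow (tini lam) q /\ tcol (tini lam) p < tcol (tini lam) q)%N.
Proof.
rewrite !row_tini !col_tini /two_col_node => pq.
have := odd_double_half p; have := odd_double_half q.
by case: ifP => h1; case: ifP => h2 /=; case: (odd p); case: (odd q) => /=; lia.
Qed.

Lemma tini_std : is_std (tini lam).
Proof.
have tot p q : p != q -> (p < q)%N \/ (q < p)%N.
  by move=> h; have : p != q :> nat by []; lia.
apply/and4P; split.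
- apply/injectiveP => p q h; apply/eqP/negPn/negP => /tot.
  by case=> /tini_lex; rewrite /trow /tcol h; lia.
- apply/forallP => A; apply/existsP.
  have hA := valP A; rewrite /= -index_mem size_young_par2 in hA.
  exists (Ordinal hA); apply/eqP/val_inj; rewrite ffunE /=.
  by rewrite nth_index //; exact: (valP A).
- apply/forallP => p; apply/forallP => q; apply/implyP => /eqP h1; apply/implyP => h2.
  have [h|] := eqVneq p q; first by rewrite h ltnn in h2.
  by case/tot => // /tini_lex; rewrite /trow /tcol; lia.
- apply/forallP => p; apply/forallP => q; apply/implyP => /eqP h1; apply/implyP => h2.
  have [h|] := eqVneq p q; first by rewrite h ltnn in h2.
  by case/tot => // /tini_lex; rewrite /trow /tcol; lia.
Qed.


Lemma dpermP t p : is_std t -> t (dperm t p) = tini lam p.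
Proof.
move=> st; rewrite /dperm; case: pickP => [d /forallP/(_ p)/eqP //|h].
have ex q : exists s : 'I_n, t s == tini lam q.
  have [s hs] := std_onto st (valP (tini lam q)).
  by exists s; apply/eqP/val_inj.
pose f q := xchoose (ex q).
have fE q : t (f q) = tini lam q by apply/eqP/(xchooseP (ex q)).
have fI : injective f.
  by move=> q s h1; apply: (std_inj tini_std); rewrite -!fE h1.
by have /forallP[] := h (perm fI) => q; rewrite permE fE.
Qed.

Lemma dperm_uniq t (d : 'S_n) : is_std t -> (forall p, t (d p) = tini lam p) -> dperm t = d.
Proof. by move=> st h; apply/permP => p; apply: (std_inj st); rewrite dpermP. Qed.

Lemma dpermV t p : is_std t -> t p = tini lam ((dperm t)^-1 p)%g.
Proof. by move=> st; rewrite -(dpermP _ st) permKV. Qed.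

Lemma dperm_tini : dperm (tini lam) = 1%g.
Proof. by apply: dperm_uniq => [|p]; rewrite ?perm1 //; exact: tini_std. Qed.

Lemma dperm_swap t r : is_std t -> is_std (swap t r) ->
  dperm (swap t r) = (dperm t * sperm r)%g.
Proof.
move=> st st'; apply: dperm_uniq => // p.
by rewrite swapE permM spermK dpermP.
Qed.

Lemma descentE t r : is_std t ->
  descent t r = ((dperm t)^-1%g (hi r) < (dperm t)^-1%g (lo r))%N.
Proof.
move=> st; rewrite /descent /trow !(dpermV _ st) -!/(trow _ _).
set a := _ (hi r); set b := _ (lo r).
have ab : a != b.
  by apply/eqP => /perm_inj h; have := lo_neq_hi r; rewrite h eqxx.
have ab' : a != b :> nat by [].
have [h|h] : (a < b)%N \/ (b < a)%N by lia.
  rewrite h; have [//|[h1 h2]] := tini_lex h.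
  have := @std_row _ _ t (hi r) (lo r) st.
  by rewrite /trow /tcol !(dpermV _ st) -!/(trow _ _) -!/(tcol _ _) -/a -/b => /(_ h1 h2) /=; lia.
by have := tini_lex h; lia.
Qed.

(** Without descents the reading positions of the entries 1, ..., n increase, and
    [no_descent_perm1] applies. *)
Lemma exists_descent t : is_std t -> t = tini lam \/ exists r, descent t r.
Proof.
move=> st; have [/existsP|/existsPn h] := boolP [exists r, descent t r]; first by right.
left; have u1 : ((dperm t)^-1 = 1)%g.
  apply: no_descent_perm1 => r; have := h r; rewrite descentE //.
  by case: (inv_lo_hi (dperm t) r) => // ->.
by apply/ffunP => p; rewrite (dpermV _ st) u1 perm1.
Qed.

(** The length of [dperm t], that is, the number of valleys that must be turned into
    peaks to obtain t from the initial tableau. *)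
Definition swap_length t := ninv (dperm t).

Lemma swap_length_descent t r : is_std t -> descent t r -> swap_length t = (swap_length (swap t r)).+1.
Proof.
move=> st hd; rewrite /swap_length dperm_swap //; last exact: descent_swap_std.
by apply: ninv_sperm_down; rewrite -descentE.
Qed.

(** Removing descents one at a time writes [dperm t] with as many letters as it has
    inversions; by [ninv_word] no shorter word exists, so reduced words of [dperm t]
    are recognized by their size. *)
Lemma std_word t : is_std t ->
  exists w, perm_of_word w = dperm t /\ size w = ninv (dperm t).
Proof.
move: {2}(swap_length t) (erefl (swap_length t)) => m; elim: m t => [|m IH] t hm st.
  case: (exists_descent st) => [->|[r /(swap_length_descent st)]]; last by rewrite hm.
  by exists [::]; rewrite dperm_tini ninv1.
case: (exists_descent st) => [E0|[r hd]]; first by move: hm; rewrite E0 /swap_length dperm_tini ninv1.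
have st' := descent_swap_std st hd; have hl := swap_length_descent st hd.
have hm' : swap_length (swap t r) = m by lia.
have [w [h1 h2]] := IH _ hm' st'.
exists (r :: w); rewrite /= h1 h2 -/(swap_length t) hl; split=> //.
by rewrite dperm_swap // -mulgA /sperm tperm2 mulg1.
Qed.

Lemma reducedP t w : is_std t ->
  reduced_expr (dperm t) w <-> perm_of_word w = dperm t /\ size w = swap_length t.
Proof.
move=> st; have [w0 [h1 h2]] := std_word st; split=> [[h3 h4]|[h3 h4]]; split=> //.
  by apply/eqP; rewrite eqn_leq /swap_length -{1}h2 (h4 _ h1) -h3 ninv_word.
by move=> w' h5; rewrite h4 /swap_length -h5 ninv_word.
Qed.

(** The letter r shortens the word, so s_r removes an inversion of [dperm t], and the
    inversions removed by an adjacent transposition are the descents of t. *)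
Lemma reduced_cons t r w : is_std t -> reduced_expr (dperm t) (r :: w) ->
  descent t r /\ reduced_expr (dperm (swap t r)) w.
Proof.
move=> st /(reducedP _ st)[/= h1 h2].
have h3 : perm_of_word w = (dperm t * sperm r)%g.
  by rewrite -h1 -mulgA /sperm tperm2 mulg1.
have hd : descent t r.
  rewrite descentE //; case: (inv_lo_hi (dperm t) r) => // h.
  by have := ninv_word w; rewrite h3 (ninv_sperm_up h) -/(swap_length t) -h2 ltnNge leqnSn.
have st' := descent_swap_std st hd; split=> //.
apply/reducedP => //; split; first by rewrite dperm_swap.
by apply: succn_inj; rewrite -swap_length_descent.
Qed.

Lemma cons_reduced t r w : is_std t -> descent t r ->
  reduced_expr (dperm (swap t r)) w -> reduced_expr (dperm t) (r :: w).
Proof.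
move=> st hd /(reducedP _ (descent_swap_std st hd))[h1 h2]; apply/reducedP => //=.
rewrite h1 h2 (swap_length_descent st hd); split=> //.
rewrite dperm_swap //; last exact: descent_swap_std.
by rewrite -mulgA /sperm tperm2 mulg1.
Qed.

(** A descent has its first entry in column 1 and its second in column 2, so two
    different descents cannot share an entry. *)
Lemma descents_far t r s : is_std t -> descent t r -> descent t s -> r != s ->
  (r.+1 < s)%N || (s.+1 < r)%N.
Proof.
move=> st hr hs rs; have [a1 a2 _] := descent_local st hr; have [b1 b2 _] := descent_local st hs.
have h1 : r != s :> nat by [].
have h2 : r.+1 != s :> nat.
  by apply/eqP => h; move: b1; rewrite (_ : lo s = hi r) ?a2 //; apply: val_inj.
have h3 : s.+1 != r :> nat.
  by apply/eqP => h; move: a1; rewrite (_ : lo r = hi s) ?b2 //; apply: val_inj.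
lia.
Qed.

Lemma swap_far_lo t r s : (r.+1 < s)%N || (s.+1 < r)%N -> swap t r (lo s) = t (lo s).
Proof. by move=> h; apply: swap_far => /=; lia. Qed.
Lemma swap_far_hi t r s : (r.+1 < s)%N || (s.+1 < r)%N -> swap t r (hi s) = t (hi s).
Proof. by move=> h; apply: swap_far => /=; lia. Qed.

Lemma descent_swap_far t r s : (r.+1 < s)%N || (s.+1 < r)%N -> descent (swap t r) s = descent t s.
Proof. by move=> h; rewrite /descent /trow swap_far_lo // swap_far_hi. Qed.

Lemma swapC t r s : (r.+1 < s)%N || (s.+1 < r)%N -> swap (swap t r) s = swap (swap t s) r.
Proof.
move=> h; apply/ffunP => p; rewrite !swapE; congr (t _).
case: (spermP s p) => [->|->|a b]; rewrite ?sperm_lo ?sperm_hi.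
- by rewrite !(@sperm_far _ r) ?sperm_lo // -val_eqE /=; lia.
- by rewrite !(@sperm_far _ r) ?sperm_hi // -val_eqE /=; lia.
- case: (spermP r p) => [_|_|_ _]; by rewrite sperm_far // -val_eqE /=; lia.
Qed.
End TwoColumn.

(** * The vectors v^t *)

Section StdInd.
Variables (n x y : nat) (lam : par2 n).
Hypothesis E : par2_val lam = two_col x y.
Implicit Types (t : tableau n lam) (r s : 'I_n.-1).

Lemma std_ind (P : tableau n lam -> Prop) :
  P (tini lam) -> (forall t r, is_std t -> descent t r -> P (swap t r) -> P t) ->
  forall t, is_std t -> P t.
Proof.
move=> P0 PS t; move: {2}(swap_length t) (erefl (swap_length t)) => m; elim: m t => [|m IH] t hm st;
  case: (exists_descent E st) => [->//|[r hd]]; have hl := swap_length_descent E st hd.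
  by rewrite hm in hl.
by apply: (PS t r) => //; apply: IH; [lia | exact: (descent_swap_std E)].
Qed.
End StdInd.

(** The defining relations of a Specht module are stated for an arbitrary vector of a
    module over any ring that satisfies the KLR relations, because they are used for
    the generator of one Specht module and for the vector v^T of another one. *)
Record specht_vector e n (lam : par2 n) (A : pzRingType) (Id : iseq e n -> A)
    (Ps : 'I_n.-1 -> A) (Y : 'I_n -> A) (V : lmodType A) (v : V) : Prop := SpechtVector {
  sv_idem : forall i, Id i *: v = (i == ires lam e)%:R *: v;
  sv_y : forall p, Y p *: v = 0;
  sv_row : forall r, trow (tini lam) (lo r) = trow (tini lam) (hi r) -> Ps r *: v = 0;
  sv_garnir1 : forall r a b,
    val (tini lam (lo r)) = (a, b) -> (a.+1, b) \in young lam ->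
    nth 0%N lam a.-1 = 1%N -> Ps r *: v = 0;
  sv_garnir2 : forall (r s : 'I_n.-1) a,
    val (tini lam (lo r)) = (a, 1%N) -> (a.+1, 1%N) \in young lam ->
    nth 0%N lam a.-1 = 2 -> s = r.+1 :> nat -> (Ps r * Ps s) *: v = 0;
  sv_garnir3 : forall (r s : 'I_n.-1) a,
    val (tini lam (lo r)) = (a, 2) -> (a.+1, 2) \in young lam ->
    s = r.+1 :> nat -> (Ps s * Ps r) *: v = 0 }.

Section Vectors.
Variables (e n x y : nat) (lam : par2 n) (rex : 'S_n -> seq 'I_n.-1).
Hypothesis E : par2_val lam = two_col x y.
Hypothesis hrex : forall w : 'S_n, reduced_expr w (rex w).
Variables (A : pzRingType) (Id : iseq e n -> A) (Ps : 'I_n.-1 -> A) (Y : 'I_n -> A).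
Hypothesis relE : forall l r, klr_rel Id Ps Y l r -> l = r.
Variables (V : lmodType A) (v : V).
Hypothesis hv : specht_vector lam Id Ps Y v.
Implicit Types (t : tableau n lam) (r s : 'I_n.-1) (i : iseq e n).

Lemma psi_comm r s : (r.+1 < s)%N || (s.+1 < r)%N -> Ps r * Ps s = Ps s * Ps r.
Proof. exact: (CyclotomicFactor.psiC relE). Qed.

Lemma sactK r : involutive (sact r : iseq e n -> _).
Proof. exact: CyclotomicFactor.sactK. Qed.

Lemma idem_psi i r : Id i * Ps r = Ps r * Id (sact r i).
Proof. by rewrite (CyclotomicFactor.psi_idem relE) sactK. Qed.

Definition psiw (w : seq 'I_n.-1) : A := \prod_(r <- w) Ps r.
(** [vtab], built on an arbitrary vector v of an arbitrary module. *)
Definition vtab_of t : V := psiw (rex (dperm t)) *: v.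

(** Two reduced words starting with different letters r and s can both be compared with
    words starting with r s and s r, since the descents r and s of t are far apart;
    there only the commutation of psi_r and psi_s is used. *)
Lemma psiw_indep t w1 w2 : is_std t ->
  reduced_expr (dperm t) w1 -> reduced_expr (dperm t) w2 -> psiw w1 *: v = psiw w2 *: v.
Proof.
move: {2}(swap_length t) (erefl (swap_length t)) => m; elim/ltn_ind: m t w1 w2 => m IH t w1 w2 hm st.
case: w1 => [|r w1] h1; case: w2 => [|s w2] h2 //.
- by have [[_ h] [_ h']] := ((reducedP E _ st).1 h1, (reducedP E _ st).1 h2); rewrite -h' in h.
- by have [[_ h] [_ h']] := ((reducedP E _ st).1 h1, (reducedP E _ st).1 h2); rewrite -h' in h.
have [hr h1'] := reduced_cons E st h1; have [hs h2'] := reduced_cons E st h2.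
have str := descent_swap_std E st hr; have sts := descent_swap_std E st hs.
have hlr := swap_length_descent E st hr; have hls := swap_length_descent E st hs.
rewrite /psiw !big_cons -!/(psiw _) -!scalerA.
have [rs|rs] := eqVneq r s.
  by subst s; congr (_ *: _); rewrite (IH _ _ _ _ _ erefl str h1' h2') // -hm hlr.
have far := descents_far E st hr hs rs.
have far' : (s.+1 < r)%N || (r.+1 < s)%N by rewrite orbC.
have hrs : descent (swap t r) s by rewrite descent_swap_far.
have hsr : descent (swap t s) r by rewrite descent_swap_far.
pose w := rex (dperm (swap (swap t r) s)).
have hw1 : reduced_expr (dperm (swap t r)) (s :: w)
  by exact: (cons_reduced E str hrs (hrex _)).
have hw2 : reduced_expr (dperm (swap t s)) (r :: w).
  by apply: (cons_reduced E) => //; rewrite -swapC //; exact: hrex.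
have lr : (swap_length (swap t r) < m)%N by rewrite -hm hlr.
have ls : (swap_length (swap t s) < m)%N by rewrite -hm hls.
rewrite (IH _ lr _ _ _ erefl str h1' hw1) (IH _ ls _ _ _ erefl sts h2' hw2).
by rewrite /psiw !big_cons !scalerA !mulrA psi_comm.
Qed.

Lemma vtab_peel t r : is_std t -> descent t r -> vtab_of t = Ps r *: vtab_of (swap t r).
Proof.
move=> st hd; have h := cons_reduced E st hd (hrex _).
by rewrite /vtab_of [LHS](psiw_indep st (hrex _) h) /psiw big_cons scalerA.
Qed.

Lemma vtab_tini : vtab_of (tini lam) = v.
Proof.
have h0 : reduced_expr (dperm (tini lam)) [::].
  by rewrite (dperm_tini E); split.
by rewrite /vtab_of [LHS](psiw_indep (tini_std E) (hrex _) h0) /psiw big_nil scale1r.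
Qed.

Definition tab_res t : iseq e n := [ffun p => res e (val (t p))].

Lemma tab_res_swap t r : tab_res (swap t r) = sact r (tab_res t).
Proof. by apply/ffunP => p; rewrite !ffunE. Qed.

Lemma tab_res_tini : tab_res (tini lam) = ires lam e.
Proof. by apply/ffunP => p; rewrite !ffunE. Qed.

Lemma vtab_idem t i : is_std t -> Id i *: vtab_of t = (i == tab_res t)%:R *: vtab_of t.
Proof.
move=> st; elim/(std_ind E): st i => [|{}t r st hd IH] i.
  by rewrite vtab_tini tab_res_tini (sv_idem hv).
rewrite (vtab_peel st hd) scalerA idem_psi -scalerA IH tab_res_swap (inj_eq (inv_inj (sactK r))).
by case: eqP => _; rewrite ?scale1r // !scale0r scaler0.
Qed.

(** If t agrees with the initial tableau on the first m entries, then its word only uses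
    letters s >= m: the node of a descent below m would already be occupied. *)
Lemma vtab_commute (m : nat) (z : A) t :
  (forall s, (m <= s)%N -> z * Ps s = Ps s * z) ->
  z *: v = 0 -> is_std t -> (forall p : 'I_n, (p < m)%N -> t p = tini lam p) ->
  z *: vtab_of t = 0.
Proof.
move=> hz zv st; elim/(std_ind E): st => [|{}t r st hd IH] ht; first by rewrite vtab_tini.
have mr : (m <= r)%N.
  rewrite leqNgt; apply/negP => rm; move: hd; rewrite (descentE E) //.
  have h1 : (dperm t)^-1%g (lo r) = lo r.
    by apply: (std_inj (tini_std E)); rewrite -(dpermV E) // ht.
  rewrite h1; set q := _ (hi r) => qr.
  have h2 : t q = t (hi r) by rewrite ht ?(dpermV E (hi r)) // (leq_trans qr) // ltnW.
  by move: qr; rewrite (std_inj st h2) /=; lia.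
rewrite (vtab_peel st hd) scalerA hz // -scalerA IH ?scaler0 // => p pm.
by rewrite swap_far ?ht //; lia.
Qed.
End Vectors.

(** * Addable and removable nodes *)

Section Diagrams.
Implicit Types (x y a b : nat) (D : seq (nat * nat)).
Local Open Scope nat_scope.

Lemma mem_young nu a b :
  ((a, b) \in young nu) = (0 < a <= size nu) && (0 < b <= nth 0 nu a.-1).
Proof.
apply/allpairsPdep/andP => [[a' [b' [h1 h2 [-> ->]]]]|[h1 h2]].
  by move: h1 h2; rewrite !mem_iota !add1n !ltnS.
by exists a, b; rewrite !mem_iota !add1n !ltnS h1 h2.
Qed.

Lemma young_uniq nu : uniq (young nu).
Proof.
apply: allpairs_uniq_dep => [|a _|[a b] [a' b'] _ _ [-> ->]//]; exact: iota_uniq.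
Qed.

Lemma mem_two_col x y a b : ((a, b) \in young (two_col x y)) =
  (0 < a) && ((b == 1) && (a <= x + y) || (b == 2) && (a <= x)).
Proof. by apply/young_two_colP/idP; lia. Qed.

Lemma size_two_col x y : size (two_col x y) = x + y.
Proof. by rewrite size_cat !size_nseq. Qed.

Lemma nth_two_col x y k : nth 0 (two_col x y) k = (k < x + y) + (k < x).
Proof.
rewrite nth_cat size_nseq; have [h1|h1] := ltnP k x; rewrite nth_nseq.
  by rewrite h1 ltn_addr.
by rewrite addn0 ltn_subLR //; case: ifP.
Qed.

Lemma two_col_partition x y : is_partition (two_col x y).
Proof.
apply/andP; split; last by rewrite mem_cat !mem_nseq !andbF.
rewrite /two_col; case: y => [|y]; first by rewrite cats0; elim: x => // -[].
elim: x => [|x IH] /=; first by elim: y.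
by case: x IH => //= IH; elim: y {IH}.
Qed.

Lemma foldr_maxn_le s m : (foldr maxn 0 s <= m) = all (leq^~ m) s.
Proof. by elim: s => //= k s IH; rewrite geq_max IH. Qed.

Lemma row_lengths_two_col x y D :
  perm_eq D (young (two_col x y)) -> row_lengths D = two_col x y.
Proof.
move=> hD; rewrite /row_lengths.
have hm A : (A \in D) = (A \in young (two_col x y)) by apply: perm_mem.
have -> : foldr maxn 0 (unzip1 D) = x + y.
  apply/eqP; rewrite eqn_leq foldr_maxn_le; apply/andP; split.
    by apply/allP => a /mapP[[a' b]]; rewrite hm mem_two_col => + -> /=; lia.
  have [h|h] := posnP (x + y); first by lia.
  have : all (leq^~ (foldr maxn 0 (unzip1 D))) (unzip1 D) by rewrite -foldr_maxn_le.
  by move/allP; apply; apply/mapP; exists (x + y, 1); rewrite // hm mem_two_col; lia.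
apply: (@eq_from_nth _ 0) => [|k]; rewrite size_map size_iota ?size_two_col // => hk.
rewrite (nth_map 0) ?size_iota // nth_iota // nth_two_col (seq.permP hD).
rewrite -size_filter.
suff h : perm_eq [seq A <- young (two_col x y) | A.1 == 1 + k]
    [seq (k.+1, b) | b <- iota 1 ((k < x + y) + (k < x))].
  by rewrite (perm_size h) size_map size_iota.
apply: uniq_perm; first by rewrite filter_uniq ?young_uniq.
  by rewrite map_inj_uniq ?iota_uniq // => b b' [].
move=> [a b]; rewrite mem_filter mem_two_col /=.
apply/idP/mapP => [h|[c]]; first by exists b; [rewrite mem_iota; lia|congr (_, _); lia].
by rewrite mem_iota => hc [-> ->]; lia.
Qed.

Lemma two_col_diagram x y D : perm_eq D (young (two_col x y)) -> is_diagram D.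
Proof.
move=> h; rewrite /is_diagram (row_lengths_two_col h) two_col_partition.
by rewrite perm_sym.
Qed.

Lemma diagram_up D a b : is_diagram D -> (a.+2, b) \in D -> (a.+1, b) \in D.
Proof.
case/andP => /andP[hs _] /perm_mem h; rewrite -!h !mem_young /= => /andP[h1 h2].
have gt : transitive geq by move=> p q r /= h3 h4; exact: leq_trans h4 h3.
have := sorted_leq_nth gt leqnn 0 hs.
by move/(_ a a.+1); rewrite !inE /geq /=; lia.
Qed.

Lemma diagram_left D a b : is_diagram D -> (a, b.+2) \in D -> (a, b.+1) \in D.
Proof. by case/andP => _ /perm_mem h; rewrite -!h !mem_young /=; lia. Qed.

Section Shape.
Variables (x y : nat) (D : seq (nat * nat)).
Hypothesis hD : perm_eq D (young (two_col x y)).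

Lemma shape_mem a b : ((a, b) \in D) =
  (0 < a) && ((b == 1) && (a <= x + y) || (b == 2) && (a <= x)).
Proof. by rewrite (perm_mem hD) mem_two_col. Qed.

Lemma shape_uniq : uniq D.
Proof. by rewrite (perm_uniq hD) young_uniq. Qed.

(** Any other node addable to a two-column shape is at the end of row 1, hence below no
    node; this is why rows a > 1 suffice for degrees. *)
Lemma addable_below a b : 1 < a -> addable D (a, b) =
  ((a, b) == ((x + y).+1, 1)) || ((a, b) == (x.+1, 2)) && (0 < y).
Proof.
move=> a1; rewrite !xpair_eqE /addable shape_mem; apply/andP/idP => [[h hd]|h].
  case: a a1 h hd => [|[|a]] // _ h hd.
  have mem0 b' : (a.+2, b') \notin (a.+2, b) :: D -> ~~ ((a.+2, b') \in D).
    by rewrite inE negb_or => /andP[].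
  have := diagram_up hd (mem_head _ _); rewrite inE shape_mem xpair_eqE.
  have : 0 < b.
    by move: hd => /andP[_ /perm_mem/(_ (a.+2, b))]; rewrite mem_head mem_young; lia.
  case: b h hd mem0 => [|[|b]] // h hd _ _; first by move: h; lia.
  have := diagram_left hd (mem_head _ _); rewrite inE shape_mem xpair_eqE.
  by move: h; lia.
split; first by lia.
case/orP: h => [/andP[/eqP-> /eqP->]|/andP[/andP[/eqP-> /eqP->] y0]].
- apply: (@two_col_diagram x y.+1); apply: uniq_perm; rewrite ?young_uniq //=.
    by rewrite shape_uniq shape_mem andbT; lia.
  by move=> [a' b']; rewrite inE shape_mem mem_two_col xpair_eqE; lia.
- apply: (@two_col_diagram x.+1 y.-1); apply: uniq_perm; rewrite ?young_uniq //=.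
    by rewrite shape_uniq shape_mem andbT; lia.
  by move=> [a' b']; rewrite inE shape_mem mem_two_col xpair_eqE; lia.
Qed.

Lemma removableE a b : removable D (a, b) =
  ((a, b) == (x + y, 1)) && (0 < y) || ((a, b) == (x, 2)) && (0 < x).
Proof.
have mr A B : (A \in rem B D) = (A != B) && (A \in D).
  by rewrite mem_rem_uniq ?shape_uniq.
rewrite !xpair_eqE /removable shape_mem; apply/andP/idP => [[h hd]|h].
  case: a h hd => [|a] // h hd.
  have := @diagram_up _ a b hd; rewrite !mr !shape_mem !xpair_eqE.
  have : b = 1 -> ((a.+1, 2) \in rem (a.+1, b) D) = false.
    move=> b1; apply/negP => /(@diagram_left _ a.+1 0 hd).
    by rewrite mr b1 eqxx.
  by rewrite mr shape_mem xpair_eqE; move: h; lia.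
split; first by lia.
case/orP: h => [/andP[/andP[/eqP-> /eqP->] y0]|/andP[/andP[/eqP-> /eqP->] x0]].
- apply: (@two_col_diagram x y.-1); apply: uniq_perm; rewrite ?young_uniq ?rem_uniq ?shape_uniq //=.
  by move=> [a' b']; rewrite mr shape_mem mem_two_col xpair_eqE; lia.
- apply: (@two_col_diagram x.-1 y.+1); apply: uniq_perm; rewrite ?young_uniq ?rem_uniq ?shape_uniq //=.
  by move=> [a' b']; rewrite mr shape_mem mem_two_col xpair_eqE; lia.
Qed.
End Shape.

Lemma count_unique (T : eqType) (s : seq T) (P : pred T) B (c : bool) :
  uniq s -> B \in s -> (forall A, A \in s -> P A = (A == B) && c) -> count P s = c.
Proof.
move=> us Bs h; rewrite (eq_in_count h); case: c {h}.
  rewrite (eq_count (a2 := pred1 B)) ?count_uniq_mem ?Bs // => A /=; exact: andbT.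
by rewrite (eq_count (a2 := pred0)) ?count_pred0 // => A /=; exact: andbF.
Qed.

Lemma box_uniq m : uniq (box m).
Proof. by apply: allpairs_uniq; rewrite ?iota_uniq // => -[a b] [a' b']. Qed.

Lemma mem_box m a b : ((a, b) \in box m) = (0 < a <= m) && (0 < b <= m).
Proof.
apply/allpairsP/idP => [[[a' b'] /= [h1 h2 [-> ->]]]|h].
  by move: h1 h2; rewrite !mem_iota; lia.
by exists (a, b); rewrite /= !mem_iota; split=> //; lia.
Qed.
End Diagrams.

(** * The degree as a sum over steps *)

Section Degree.
Variables (e n x y : nat) (lam : par2 n).
Hypothesis E : par2_val lam = two_col x y.
Implicit Types (t : tableau n lam) (r s : 'I_n.-1) (p : 'I_n).

(** The contribution to the degree of the entry k + 1 in the node N. A node of column 1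
    contributes nothing. For a node in row b of column 2 the height of the path after
    this step is h = k + 1 - 2b, and the contribution is 1 if h = -2, and -1 if h = -1,
    modulo e. *)
Definition step_weight (k : nat) (N : nat * nat) : int :=
  if N.2 == 2 then
    (k.+1%:R - N.1%:R * 2 + 2 == 0 :> 'Z_e)%:R - (k.+1%:R - N.1%:R * 2 + 1 == 0 :> 'Z_e)%:R
  else 0.

Lemma eq_of_sub (a b c d : 'Z_e) : a - b = d - c -> (a == b) = (c == d).
Proof. by move=> h; rewrite -subr_eq0 h subr_eq0 eq_sym. Qed.

Lemma Z1_neq0 : (1 == 0 :> 'Z_e) = false. Proof. exact: oner_eq0. Qed.

(** Below (a, 2) only the addable node (a + b + 1, 1) and the removable node (a + b, 1)
    can have its residue 2 - a; they do when b + 2 = 0, respectively b + 1 = 0, modulo e.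
    The addable node (a + 1, 2) has the wrong residue. *)
Lemma dnode2 a b D : perm_eq D (young (two_col a b)) -> (0 < a)%N ->
  dnode e D (a, 2) = step_weight (a.*2 + b).-1 (a, 2).
Proof.
move=> hD a0; have sD : size D = (a.*2 + b)%N.
  by rewrite (perm_size hD) size_young sumn_cat !sumn_nseq; lia.
have k1 : 1%:R = 1 :> 'Z_e by [].
have k2 : 2%:R = 2 :> 'Z_e by [].
have hadd : count (fun B => [&& addable D B, res e B == res e (a, 2)%N & ((a, 2).1 < B.1)%N])
    (box (size D).+1) = (b%:R + 2 == 0 :> 'Z_e).
  apply: (count_unique (B := ((a + b).+1, 1)%N)); first exact: box_uniq.
    by rewrite mem_box sD; lia.
  move=> [c d]; rewrite mem_box /= => /andP[/andP[c0 _] _].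
  have [ac|ac] := leqP c a.
    by rewrite !andbF xpair_eqE; case: eqP => // h; move: ac; rewrite h; lia.
  rewrite (addable_below hD); last by lia.
  have [[-> ->]|_] := eqVneq (c, d) ((a + b).+1, 1)%N.
    by rewrite /= andbT; apply: eq_of_sub; rewrite /res /= -(addn1 (a + b)) !natrD; ring.
  rewrite /=; case: eqP => [[-> ->]|//] /=.
  rewrite andbT; case: eqP => [h|_]; last by rewrite andbF.
  have := Z1_neq0; rewrite -[X in X == _](_ : res e (a, 2)%N - res e (a.+1, 2)%N = 1 :> 'Z_e).
    by rewrite h subrr eqxx.
  by rewrite /res /= -(addn1 a) natrD; ring.
have hrem : count (fun B => [&& removable D B, res e B == res e (a, 2)%N & ((a, 2).1 < B.1)%N])
    (box (size D).+1) = (b%:R + 1 == 0 :> 'Z_e).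
  apply: (count_unique (B := (a + b, 1)%N)); first exact: box_uniq.
    by rewrite mem_box sD; lia.
  move=> [c d]; rewrite mem_box /= (removableE hD) => /andP[/andP[c0 _] _].
  have [[-> ->]|_] := eqVneq (c, d) (a + b, 1)%N; last first.
    by case: eqP => [[-> _]|//]; rewrite ltnn !andbF.
  rewrite xpair_eqE andbF orbF /=.
  have [->|b0] := posnP b; first by rewrite add0r Z1_neq0.
  have -> : (a < a + b)%N by lia.
  rewrite andbT; apply: eq_of_sub.
  by rewrite /res /= natrD; ring.
rewrite /dnode hadd hrem -!natz /step_weight /= prednK; last by lia.
have -> : (a.*2 + b)%:R - a%:R * 2 = b%:R :> 'Z_e by rewrite natrD -muln2 natrM; ring.
by [].
Qed.

(** The only addable or removable node below (a + b, 1) is the addable node just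
    underneath, and its residue is different. *)
Lemma dnode1 a b D : perm_eq D (young (two_col a b)) -> (0 < b)%N ->
  dnode e D (a + b, 1)%N = 0.
Proof.
move=> hD b0; have sD : size D = (a.*2 + b)%N.
  by rewrite (perm_size hD) size_young sumn_cat !sumn_nseq; lia.
have count0 (P : pred (nat * nat)) : (forall B, (a + b < B.1)%N -> P B ->
    B = ((a + b).+1, 1)%N) -> count (fun B => [&& P B, res e B == res e (a + b, 1)%N
    & ((a + b, 1).1 < B.1)%N]) (box (size D).+1) = 0%N.
  move=> h; apply/eqP; rewrite -leqn0 leqNgt -has_count; apply/hasPn => B _ /=.
  apply/negP => /and3P[h1 /eqP + h2]; rewrite (h _ h2 h1) => h3.
  have := Z1_neq0; rewrite -[X in X == _](_ : res e (a + b, 1)%N - res e ((a + b).+1, 1)%N = 1 :> 'Z_e).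
    by rewrite h3 subrr eqxx.
  by rewrite /res /= -(addn1 (a + b)) natrD; ring.
rewrite /dnode !count0 // => -[c d] /= h.
  by rewrite (removableE hD) !xpair_eqE; lia.
rewrite (addable_below hD) ?xpair_eqE; last by lia.
by move=> h'; congr (_, _); lia.
Qed.

Local Notation nodes t := [seq val (t p) | p <- enum 'I_n].

Lemma size_nodes t : size (nodes t) = n.
Proof. by rewrite size_map size_enum_ord. Qed.

Lemma nth_nodes t p : nth (0, 0)%N (nodes t) p = val (t p).
Proof. by rewrite (nth_map p) ?size_enum_ord // nth_ord_enum. Qed.

(** The restriction of a standard tableau to its first k entries has again a two-column
    shape, to which [dnode1] and [dnode2] apply. *)
Lemma perm_take_nodes t (k : nat) : is_std t -> (k <= n)%N ->
  (col_count t 2 k <= col_count t 1 k)%N /\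
  perm_eq (take k (nodes t)) (young (two_col (col_count t 2 k) (col_count t 1 k - col_count t 2 k))).
Proof.
move=> st; elim: k => [|k IH] kn; first by rewrite !col_count0 take0.
have [h1 h2] := IH (ltnW kn).
pose p := Ordinal kn.
have c1 := col_countS t 1 p; have c2 := col_countS t 2 p; rewrite /= in c1 c2.
have hb := col_count_ballot E (p := p) st; have hr := trow_col_count E p st; rewrite /= in hb hr.
have hc := nodeP E t p.
split; first by move: hb; rewrite c1 c2; case: hc => _ [[-> _]|[-> _]] /=; lia.
rewrite (take_nth (0, 0)%N) ?size_nodes // -[k]/(nat_of_ord p) nth_nodes.
have mem A : (A \in take k (nodes t)) =
    (A \in young (two_col (col_count t 2 k) (col_count t 1 k - col_count t 2 k))).
  exact: perm_mem.
have ut : uniq (take k (nodes t)) by rewrite (perm_uniq h2) young_uniq.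
have vE : val (t p) = (trow t p, tcol t p) by rewrite /trow /tcol; case: (val _).
apply: uniq_perm; rewrite ?young_uniq //.
  rewrite rcons_uniq ut andbT mem vE mem_two_col hr.
  by move: hb; case: hc => _ [[-> _]|[-> _]] /=; lia.
move=> [a b]; rewrite mem_rcons inE mem vE !mem_two_col hr xpair_eqE c1 c2.
by move: hb; case: hc => _ [[-> _]|[-> _]] /=; lia.
Qed.

Lemma deg_sum t : is_std t -> deg e t = \sum_(p < n) step_weight p (val (t p)).
Proof.
move=> st; rewrite /deg.
have -> : \sum_(p < n) step_weight p (val (t p)) = \sum_(0 <= k < n) step_weight k (nth (0, 0)%N (nodes t) k).
  by rewrite big_mkord; apply: eq_bigr => p _; rewrite nth_nodes.
have main (k : nat) : (k <= n)%N -> deg_rev e (rev (take k (nodes t))) =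
    \sum_(0 <= l < k) step_weight l (nth (0, 0)%N (nodes t) l).
  elim: k => [|k IH] kn; first by rewrite take0 big_geq.
  rewrite big_nat_recr //= -IH ?(ltnW kn) // addrC.
  rewrite (take_nth (0, 0)%N) ?size_nodes // rev_rcons /=; congr (_ + _).
  rewrite -rev_rcons -take_nth ?size_nodes //.
  have [h1 h2] := perm_take_nodes st kn.
  pose p := Ordinal kn; rewrite -[k in nth _ _ k]/(nat_of_ord p) nth_nodes.
  have vE : val (t p) = (trow t p, tcol t p) by rewrite /trow /tcol; case: (val _).
  have c1 := col_countS t 1 p; have c2 := col_countS t 2 p; rewrite /= in c1 c2.
  have hr := trow_col_count E p st; rewrite /= in hr.
  have h3 : perm_eq (rev (take k.+1 (nodes t)))
      (young (two_col (col_count t 2 k.+1) (col_count t 1 k.+1 - col_count t 2 k.+1))).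
    by rewrite perm_rev.
  have := col_count_sum E t kn; rewrite vE hr.
  have [_ [[hc _]|[hc _]]] := nodeP E t p; rewrite hc; rewrite hc /= in c1 c2 => s12.
    rewrite (_ : (col_count t 1 k).+1 =
      col_count t 2 k.+1 + (col_count t 1 k.+1 - col_count t 2 k.+1))%N; last by lia.
    rewrite (dnode1 h3); last by have [h0 _] := perm_take_nodes st (ltnW kn); lia.
    by rewrite /step_weight.
  rewrite (_ : (col_count t 2 k).+1 = col_count t 2 k.+1)%N; last by lia.
  by rewrite (dnode2 h3) /=; [congr step_weight; lia | lia].
by rewrite -main // take_oversize // size_nodes.
Qed.
End Degree.

(** * Cartan integers and descents *)

(** The entry c_{ab} of the Cartan matrix, in a form valid for every e: for e = 2 and
    a <> b both off-diagonal conditions hold and the value is -2. *)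
Definition cartan e (a b : 'Z_e) : int :=
  (a == b)%:R * 2 - (a == b + 1)%:R - (b == a + 1)%:R.

Section Cartan.
Variable e : nat.
Implicit Types a b : 'Z_e.

Lemma cartanC a b : cartan a b = cartan b a.
Proof. by rewrite /cartan [a == b]eq_sym -!addrA [- _ - _]addrC. Qed.

Lemma succ_neq a : (a == a + 1) = false.
Proof. by rewrite -subr_eq0 opprD addrA subrr sub0r oppr_eq0 oner_eq0. Qed.

Lemma cartan_diag a : cartan a a = 2.
Proof. by rewrite /cartan eqxx succ_neq. Qed.

Lemma cartan_no_arrow a b : no_arrow a b -> cartan a b = 0.
Proof.
case/and3P => h1 h2 h3; rewrite /cartan [a == b]eq_sym (negbTE h1) (negbTE h2).
by rewrite -subr_eq eq_sym (negbTE h3).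
Qed.

Lemma two_neq0 : (2 < e)%N -> (2 == 0 :> 'Z_e) = false.
Proof.
move=> e2; apply/negP => /eqP h; have := congr1 (@nat_of_ord _) h.
by rewrite -[2]/(2%:R) val_Zp_nat ?modn_small //; lia.
Qed.

Lemma cartan_arrow a b : to_arrow a b -> cartan a b = -1.
Proof.
case/andP => e2 /eqP->; rewrite /cartan subrK eqxx.
have -> : (a == a - 1) = false by have := succ_neq (a - 1); rewrite subrK eq_sym.
suff -> : (a - 1 == a + 1) = false by [].
by rewrite -subr_eq0 (_ : _ - _ = - 2) ?oppr_eq0 ?two_neq0 //; ring.
Qed.

Lemma Z2_cases a b : e = 2 -> a != b -> b = a + 1.
Proof.
move=> e2; subst e; case: a b => [[|[|?]] ?] [[|[|?]] ?] // h; exact: val_inj.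
Qed.

Lemma cartan_lr a b : lr_arrow a b -> cartan a b = -2.
Proof.
case/andP => /eqP e2 ab; rewrite /cartan (negbTE ab) -(Z2_cases e2 ab) eqxx.
by rewrite eq_sym in ab; rewrite -(Z2_cases e2 ab) eqxx.
Qed.
End Cartan.

Section DegreeFlip.
Variables (e n x y : nat) (lam : par2 n).
Hypothesis E : par2_val lam = two_col x y.
Implicit Types (t : tableau n lam) (r s : 'I_n.-1) (i : iseq e n).

(** Minus the degree of psi_r 1_i. *)
Definition cartan_at r i : int := cartan (i (lo r)) (i (hi r)).

(** If the peak ends at height z, its down step weighs [z+2=0] - [z+1=0], and the down step
    of the valley weighs [z+1=0] - [z=0]. The two residues of the valley differ by z + 1,
    so the difference of these weights is minus the Cartan integer. *)
Lemma deg_descent t r : is_std t -> descent t r ->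
  deg e t = deg e (swap t r) - cartan_at r (tab_res e (swap t r)).
Proof.
move=> st hd; have st' := descent_swap_std E st hd.
have [h1 h2 h3] := descent_local E st hd.
set a := trow t (lo r) in h3; set b := trow t (hi r) in h3.
have vl : val (t (lo r)) = (a, 1%N) by rewrite [LHS]surjective_pairing -h1.
have vh : val (t (hi r)) = (b, 2) by rewrite [LHS]surjective_pairing -h2.
have split2 (F : 'I_n -> int) :
    \sum_p F p = F (lo r) + (F (hi r) + \sum_(p | (p != lo r) && (p != hi r)) F p).
  by rewrite (bigD1 (lo r)) // (bigD1 (hi r)) // eq_sym lo_neq_hi.
rewrite (deg_sum e E st) (deg_sum e E st') !split2.
rewrite (eq_bigr (fun p : 'I_n => step_weight e p (val (swap t r p)))); last first.
  by move=> p /andP[p1 p2]; rewrite swapE sperm_far.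
rewrite /cartan_at ![tab_res _ _ _]ffunE swap_lo swap_hi vl vh.
move: (\sum_(p | _) _) => S.
rewrite /step_weight /res /cartan /=.
have hr : a%:R + b%:R = r.+2%:R :> 'Z_e by rewrite -natrD h3.
set z := a%:R - b%:R : 'Z_e.
have -> : (r.+2%:R - b%:R * 2 + 2 == 0 :> 'Z_e) = (z + 2 == 0) by rewrite -hr /z; congr (_ == _); ring.
have -> : (r.+2%:R - b%:R * 2 + 1 == 0 :> 'Z_e) = (z + 1 == 0) by rewrite -hr /z; congr (_ == _); ring.
have hr' : r.+1%:R = a%:R + b%:R - 1 :> 'Z_e by rewrite hr -(addn1 r.+1) natrD addrK.
have -> : (r.+1%:R - b%:R * 2 + 2 == 0 :> 'Z_e) = (z + 1 == 0) by rewrite hr' /z; congr (_ == _); ring.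
have -> : (r.+1%:R - b%:R * 2 + 1 == 0 :> 'Z_e) = (z == 0) by rewrite hr' /z; congr (_ == _); ring.
have -> : (2%:R - b%:R == 1%:R - a%:R :> 'Z_e) = (z + 1 == 0) by rewrite -subr_eq0 /z; congr (_ == _); ring.
have -> : (2%:R - b%:R == 1%:R - a%:R + 1 :> 'Z_e) = (z == 0) by rewrite -subr_eq0 /z; congr (_ == _); ring.
have -> : (1%:R - a%:R == 2%:R - b%:R + 1 :> 'Z_e) = (z + 2 == 0).
  by rewrite eq_sym -subr_eq0 /z; congr (_ == _); ring.
ring.
Qed.
End DegreeFlip.

(** * Triangularity of the action *)

Section Closure.
Variables (e n x y : nat) (lam : par2 n) (rex : 'S_n -> seq 'I_n.-1).
Hypothesis E : par2_val lam = two_col x y.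
Hypothesis hrex : forall w : 'S_n, reduced_expr w (rex w).
Variables (A : pzRingType) (Id : iseq e n -> A) (Ps : 'I_n.-1 -> A) (Y : 'I_n -> A).
Hypothesis relE : forall l r, klr_rel Id Ps Y l r -> l = r.
Variables (V : lmodType A) (v : V).
Hypothesis hv : specht_vector lam Id Ps Y v.
Implicit Types (t q o : tableau n lam) (r s : 'I_n.-1) (p : 'I_n) (i : iseq e n) (m : V).
Local Notation vt := (vtab_of rex Ps v).
Local Notation tab_res := (tab_res e).
Local Notation deg := (deg e).

(** Integer combinations as an inductive predicate, so that the effect of psi_r and y_k on
    a combination follows from their effect on its terms by induction. *)
Inductive intspan (Q : tableau n lam -> Prop) : V -> Prop :=
| Sp0 : intspan Q 0
| SpD a b : intspan Q a -> intspan Q b -> intspan Q (a + b)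
| SpN a : intspan Q a -> intspan Q (- a)
| SpG t : Q t -> intspan Q (vt t).

Lemma intspan_mono (Q Q' : tableau n lam -> Prop) m :
  (forall t, Q t -> Q' t) -> intspan Q m -> intspan Q' m.
Proof.
move=> h; elim=> [|a b _ ha _ hb|a _ ha|t /h ht]; [exact: Sp0|exact: SpD|exact: SpN|exact: SpG].
Qed.

(** The bound l on the number of swaps carries the triangularity: an operator that is
    controlled on all tableaux below l maps [hspan l] to an explicit [hspan l']. *)
Definition hspan (l : nat) (d : int) i : V -> Prop :=
  intspan (fun t => [/\ is_std t, (swap_length t < l)%N, deg t = d & tab_res t = i]).

Lemma hspan_mono l l' d i m : (l <= l')%N -> hspan l d i m -> hspan l' d i m.
Proof.
by move=> h; apply: intspan_mono => t [h1 h2 h3 h4]; split=> //; apply: leq_trans h.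
Qed.

Lemma hspan_vt t l : is_std t -> (swap_length t < l)%N -> hspan l (deg t) (tab_res t) (vt t).
Proof. by move=> st h; apply: SpG. Qed.

Lemma hspan_idem l d i m : hspan l d i m -> Id i *: m = m.
Proof.
elim=> [|a b _ ha _ hb|a _ ha|t [st _ _ ht]]; rewrite ?scaler0 ?scalerDr ?scalerN ?ha ?hb //.
by rewrite (vtab_idem E hrex relE hv) // ht eqxx scale1r.
Qed.

Lemma hspan_natmul l d i m (k : nat) : hspan l d i m -> hspan l d i (k%:R *: m).
Proof.
move=> hm; elim: k => [|k IH]; first by rewrite scale0r; exact: Sp0.
by rewrite mulrS scalerDl scale1r; apply: SpD.
Qed.

(** The valleys of the path, where psi_r v^t is the vector of a tableau one swap further
    from the initial one. *)
Definition ascent t r : bool := (tcol t (lo r) == 2) && (tcol t (hi r) == 1%N).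

Lemma ascent_swap t r : is_std t -> ascent t r -> is_std (swap t r) /\ descent (swap t r) r.
Proof.
move=> st /andP[/eqP h1 /eqP h2].
have hr : (trow t (lo r) < trow t (hi r))%N.
  by case: (localP E r st); rewrite h1 h2.
split; last by rewrite /descent /trow swap_lo swap_hi.
by apply: (swap_std st); rewrite ?h1 ?h2 //; move: hr; lia.
Qed.

(** What the grading predicts for the generators on v^t, with strictly fewer swaps. *)
Definition tame t : Prop :=
  (forall p, hspan (swap_length t) (deg t + 2) (tab_res t) (Y p *: vt t)) /\
  (forall r, ~~ ascent t r ->
     hspan (swap_length t) (deg t - cartan_at r (tab_res t)) (sact r (tab_res t)) (Ps r *: vt t)).

Section Below.
Variable l : nat.
Hypothesis IH : forall t, is_std t -> (swap_length t < l)%N -> tame t.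

Lemma hspan_y k d i m p : (k <= l)%N -> hspan k d i m -> hspan k (d + 2) i (Y p *: m).
Proof.
move=> kl; elim=> [|a b _ ha _ hb|a _ ha|t [st h1 <- <-]].
- by rewrite scaler0; exact: Sp0.
- by rewrite scalerDr; exact: SpD.
- by rewrite scalerN; exact: SpN.
have [h _] := IH st (leq_trans h1 kl).
by apply: hspan_mono (h p); exact: ltnW.
Qed.

Lemma hspan_psi k d i m r : (k <= l)%N -> hspan k d i m ->
  hspan k.+1 (d - cartan_at r i) (sact r i) (Ps r *: m).
Proof.
move=> kl; elim=> [|a b _ ha _ hb|a _ ha|t [st h1 <- <-]].
- by rewrite scaler0; exact: Sp0.
- by rewrite scalerDr; exact: SpD.
- by rewrite scalerN; exact: SpN.
have [h|h] := boolP (ascent t r); last first.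
  have [_ h2] := IH st (leq_trans h1 kl).
  by apply: hspan_mono (h2 r h); lia.
have [st' hd] := ascent_swap st h.
have hl := swap_length_descent E st' hd; have hg := deg_descent e E st' hd.
have hp := vtab_peel E hrex relE v st' hd; rewrite swapK in hl hg hp.
rewrite -hp -hg -tab_res_swap; apply: hspan_vt => //.
by rewrite hl ltnS.
Qed.
End Below.

Lemma sact_eq i r : i (lo r) = i (hi r) -> sact r i = i.
Proof. by move=> h; apply/ffunP => p; rewrite ffunE; case: spermP => [->|->|]. Qed.

Lemma cartan_at_eq i r : i (lo r) = i (hi r) -> cartan_at r i = 2.
Proof. by rewrite /cartan_at => ->; exact: cartan_diag. Qed.

Lemma cartan_at_far r s i : (r.+1 < s)%N || (s.+1 < r)%N -> cartan_at s (sact r i) = cartan_at s i.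
Proof. by move=> h; rewrite /cartan_at !ffunE !sperm_far // -val_eqE /=; lia. Qed.

Lemma sactC r s i : (r.+1 < s)%N || (s.+1 < r)%N -> sact s (sact r i) = sact r (sact s i).
Proof.
move=> h; apply/ffunP => p; rewrite !ffunE; congr (i _).
case: (spermP s p) => [->|->|a b].
- by rewrite !(@sperm_far _ r) ?sperm_lo // -val_eqE /=; lia.
- by rewrite !(@sperm_far _ r) ?sperm_hi // -val_eqE /=; lia.
- case: (spermP r p) => [_|_|_ _]; by rewrite sperm_far // -val_eqE /=; lia.
Qed.

(** The quadratic relations are homogeneous: a nonzero right-hand side has degree
    -c in the y's, where c is the Cartan integer. *)
Lemma hspan_psi_sq l k d i m r : (forall t, is_std t -> (swap_length t < l)%N -> tame t) ->
  (k <= l)%N -> hspan k d i m ->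
  hspan k (d - cartan_at r i - cartan_at r i) i ((Ps r * Ps r) *: m).
Proof.
move=> IH kl hm; rewrite -(hspan_idem hm) scalerA (CyclotomicFactor.psi_sq_idem relE).
rewrite -scalerA (hspan_idem hm) /psi_sq /cartan_at.
have hB p p' d' m' : hspan k d' i m' -> hspan k (d' + 2) i ((Y p - Y p') *: m').
  by move=> h; rewrite scalerBl; apply: SpD; [|apply: SpN]; apply: (hspan_y IH).
case: ifP => _; first by rewrite scale0r; exact: Sp0.
case: ifP => [/cartan_no_arrow->|_]; first by rewrite scale1r !subr0.
case: ifP => [/cartan_arrow->|_]; first by rewrite !opprK -addrA; apply: hB.
case: ifP => [|_]; first by rewrite cartanC => /cartan_arrow->; rewrite !opprK -addrA; apply: hB.
case: ifP => [/cartan_lr->|_]; last by rewrite scale0r; exact: Sp0.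
by rewrite !opprK -scalerA; apply: (hB); apply: hB.
Qed.

(** The error term of the braid relation only occurs when the outer two residues are equal;
    it then has the degree of the words psi_r psi_s psi_r, namely -2 - 2c. *)
Lemma hspan_braid_err l k d i m r s : (forall t, is_std t -> (swap_length t < l)%N -> tame t) ->
  (k <= l)%N -> s = r.+1 :> nat -> hspan k d i m ->
  hspan k (d - cartan_at r i - cartan_at s (sact r i) - cartan_at r (sact s (sact r i)))
    (sact r (sact s (sact r i))) (braid_err Y r s i *: m).
Proof.
move=> IH kl rs hm.
have los : lo s = hi r by apply: val_inj; rewrite /= rs.
have hs1 : sperm r (hi s) = hi s by rewrite sperm_far // -val_eqE /= rs; lia.
have ls1 : sperm s (lo r) = lo r by rewrite sperm_far // -val_eqE /= rs; lia.
have hB p d' m' : hspan k d' i m' -> hspan k (d' + 2) i (Y p *: m').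
  by move=> h; apply: (hspan_y IH).
rewrite /braid_err; case: eqP => [h|_]; last by rewrite scale0r; exact: Sp0.
have -> : sact r (sact s (sact r i)) = i.
  apply/ffunP => p; rewrite !ffunE.
  case: (spermP r p) => [->|->|p1 p2].
  - by rewrite -los sperm_lo hs1.
  - by rewrite ls1 sperm_lo.
  - have [->|p3] := eqVneq p (hi s); first by rewrite sperm_hi los sperm_hi -h.
    by rewrite (@sperm_far _ s) ?sperm_far // ?los.
have -> : cartan_at s (sact r i) = 2.
  by apply: cartan_at_eq; rewrite !ffunE los sperm_hi hs1.
have -> : cartan_at r (sact s (sact r i)) = cartan_at r i.
  by rewrite /cartan_at !ffunE ls1 sperm_lo -los sperm_lo hs1 h los cartanC.
rewrite /cartan_at.
case: ifP => [/cartan_arrow->|_]; first by rewrite scale1r opprK (_ : _ - 2 + 1 = d) //; ring.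
case: ifP => [|_].
  rewrite cartanC => /cartan_arrow->; rewrite scaleN1r opprK (_ : _ - 2 + 1 = d); last by ring.
  exact: SpN.
case: ifP => [/cartan_lr->|_]; last by rewrite scale0r; exact: Sp0.
rewrite opprK (_ : _ - 2 + 2 = d + 2); last by ring.
rewrite !scalerDl scaleNr -scalerA.
by apply: SpD; [apply: SpD; [apply/SpN/hspan_natmul|]|]; apply: hB.
Qed.

Lemma deg_peel t r : is_std t -> descent t r -> forall d : int,
  deg t + d = deg (swap t r) + d - cartan_at r (tab_res (swap t r)).
Proof. by move=> st hd d; rewrite (deg_descent e E st hd) addrAC. Qed.

Lemma cartan_at_sact r i : cartan_at r (sact r i) = cartan_at r i.
Proof. by rewrite /cartan_at !ffunE sperm_lo sperm_hi cartanC. Qed.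

(** One moves y past the leading psi of v^t; the correction appears when the two residues
    are equal, and then the Cartan integer is 2, which is the degree of y. *)
Lemma tame_y t p : is_std t -> (forall q, is_std q -> (swap_length q < swap_length t)%N -> tame q) ->
  hspan (swap_length t) (deg t + 2) (tab_res t) (Y p *: vt t).
Proof.
move=> st IH; case: (exists_descent E st) => [->|[s hd]].
  by rewrite (vtab_tini E hrex relE) (sv_y hv); exact: Sp0.
have sq := descent_swap_std E st hd; have hl := swap_length_descent E st hd.
set q := swap t s in sq hl *.
have [hY _] : tame q by apply: IH; rewrite ?hl.
have tE : tab_res t = sact s (tab_res q) by rewrite -tab_res_swap swapK.
have part p' : hspan (swap_length t) (deg t + 2) (tab_res t) (Ps s *: (Y p' *: vt q)).
  rewrite (deg_peel st hd) -/q tE hl.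
  by apply: (hspan_psi IH); rewrite ?hl.
have delta : hspan (swap_length t) (deg t + 2) (tab_res t)
    ((tab_res q (lo s) == tab_res q (hi s))%:R *: vt q).
  case: eqP => [h|_]; last by rewrite scale0r; exact: Sp0.
  rewrite scale1r (deg_descent e E st hd) -/q (cartan_at_eq h) subrK tE (sact_eq h).
  by apply: hspan_vt; rewrite ?hl.
have qI : Id (tab_res q) *: vt q = vt q by rewrite (vtab_idem E hrex relE hv) // eqxx scale1r.
rewrite (vtab_peel E hrex relE v st hd) -/q scalerA.
have [->|p1] := eqVneq p (hi s).
  rewrite -qI scalerA (CyclotomicFactor.y_psi_idem relE) -scalerA qI scalerDl -scalerA.
  exact: SpD (part _) delta.
have [->|p2] := eqVneq p (lo s).
  have := CyclotomicFactor.psi_y_idem relE s (tab_res q).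
  rewrite mulrDl => /esym/(canRL (addrK _)) h.
  rewrite -qI scalerA h scalerBl -[X in X - _]scalerA -!scalerA !qI.
  exact: SpD (part _) (SpN delta).
by rewrite -(CyclotomicFactor.psi_yk relE p2 p1) -scalerA.
Qed.

Lemma tame_descent t r : is_std t -> (forall q, is_std q -> (swap_length q < swap_length t)%N -> tame q) ->
  descent t r -> hspan (swap_length t) (deg t - cartan_at r (tab_res t)) (sact r (tab_res t)) (Ps r *: vt t).
Proof.
move=> st IH hd; have sq := descent_swap_std E st hd; have hl := swap_length_descent E st hd.
rewrite (vtab_peel E hrex relE v st hd) scalerA (deg_descent e E st hd) -tab_res_swap.
set q := swap t r in sq hl *.
have -> : cartan_at r (tab_res t) = cartan_at r (tab_res q).
  by rewrite -(cartan_at_sact r (tab_res q)) -tab_res_swap swapK.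
rewrite hl; apply: (hspan_psi_sq (l := swap_length t)) => //; first by rewrite hl.
exact: hspan_vt.
Qed.

(** The letter s can be moved in front of psi_r, and induction applies to psi_r on the
    tableau with the descent s removed. *)
Lemma tame_far t r s : is_std t -> (forall q, is_std q -> (swap_length q < swap_length t)%N -> tame q) ->
  ~~ ascent t r -> descent t s -> (r.+1 < s)%N || (s.+1 < r)%N ->
  hspan (swap_length t) (deg t - cartan_at r (tab_res t)) (sact r (tab_res t)) (Ps r *: vt t).
Proof.
move=> st IH hr hd far; have sq := descent_swap_std E st hd; have hl := swap_length_descent E st hd.
have far' : (s.+1 < r)%N || (r.+1 < s)%N by rewrite orbC.
rewrite (vtab_peel E hrex relE v st hd) scalerA (psi_comm relE far) -scalerA.
set q := swap t s in sq hl *.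
have hq : ~~ ascent q r by rewrite /ascent /tcol swap_far_lo // swap_far_hi.
have [_ /(_ r hq) h] : tame q by apply: IH; rewrite ?hl.
have tE : tab_res t = sact s (tab_res q) by rewrite -tab_res_swap swapK.
rewrite (deg_peel st hd) -/q tE cartan_at_far // -sactC // -(cartan_at_far _ far) hl.
by apply: (hspan_psi IH) => //; rewrite hl.
Qed.

(** Here v^t = psi_s psi_r v^o. In psi_r psi_s psi_r v^o = psi_s psi_r psi_s v^o + error, the
    innermost psi_s acts at two equal steps of o, so that it lowers v^o, and the two
    remaining letters cannot make up for more than the two swaps between o and t. *)
Lemma tame_braid t o r s : is_std t -> (forall q, is_std q -> (swap_length q < swap_length t)%N -> tame q) ->
  s = r.+1 :> nat \/ r = s.+1 :> nat ->
  descent t s -> descent (swap t s) r -> o = swap (swap t s) r -> ~~ ascent o s ->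
  hspan (swap_length t) (deg t - cartan_at r (tab_res t)) (sact r (tab_res t)) (Ps r *: vt t).
Proof.
move=> st IH rs hs hr oE ho.
have sq := descent_swap_std E st hs; have hl := swap_length_descent E st hs.
have so := descent_swap_std E sq hr; have hl' := swap_length_descent E sq hr.
have dt := deg_descent e E st hs; have dq := deg_descent e E sq hr.
have pt := vtab_peel E hrex relE v st hs; have pq := vtab_peel E hrex relE v sq hr.
have tq : tab_res (swap t s) = sact r (tab_res o) by rewrite oE -tab_res_swap swapK.
have tt : tab_res t = sact s (sact r (tab_res o)) by rewrite -tq -tab_res_swap swapK.
rewrite tt pt pq dt dq tq -oE; rewrite -oE in so hl'.
set i := tab_res o; have hl2 : swap_length t = (swap_length o).+2 by rewrite hl hl'.
have [_ /(_ s ho)] : tame o by apply: IH; rewrite ?hl2.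
rewrite -/i => h1.
have h2 : hspan (swap_length o).+1 (deg o - cartan_at s i - cartan_at r (sact s i)) (sact r (sact s i))
    (Ps r *: (Ps s *: vt o)).
  by apply: (hspan_psi IH) h1; rewrite hl2 !leqW.
have h3 : hspan (swap_length o).+2
    (deg o - cartan_at s i - cartan_at r (sact s i) - cartan_at s (sact r (sact s i)))
    (sact s (sact r (sact s i))) (Ps s *: (Ps r *: (Ps s *: vt o))).
  by apply: (hspan_psi IH) h2; rewrite hl2 leqW.
have brd (r1 r2 : 'I_n.-1) : r2 = r1.+1 :> nat ->
   [/\ sact r1 (sact r2 (sact r1 i)) = sact r2 (sact r1 (sact r2 i)),
     cartan_at r1 (sact r2 (sact r1 i)) = cartan_at r2 i,
     cartan_at r2 (sact r1 (sact r2 i)) = cartan_at r1 i &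
     cartan_at r2 (sact r1 i) = cartan_at r1 (sact r2 i)].
  move=> h; have los := lo_hi_succ h; have ls := sperm_succ_lo h; have sh := sperm_succ_hi h.
  split; first by apply/ffunP => p; rewrite !ffunE sperm_braid.
  - by rewrite /cartan_at !ffunE ls sperm_lo -los sperm_lo sh.
  - by rewrite /cartan_at !ffunE los sperm_hi ls -los sh !sperm_hi los.
  - by rewrite /cartan_at !ffunE los sperm_hi ls sh -los sperm_lo.
have ht : hspan (swap_length o).+2 (deg o) i (vt o) by apply: hspan_vt.
have oI : Id i *: vt o = vt o by rewrite (hspan_idem ht).
have err (r1 r2 : 'I_n.-1) : r2 = r1.+1 :> nat ->
    hspan (swap_length o).+2
      (deg o - cartan_at r1 i - cartan_at r2 (sact r1 i) - cartan_at r1 (sact r2 (sact r1 i)))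
      (sact r1 (sact r2 (sact r1 i))) (braid_err Y r1 r2 i *: vt o) /\
    (Ps r1 * Ps r2 * Ps r1) *: vt o - (Ps r2 * Ps r1 * Ps r2) *: vt o =
      braid_err Y r1 r2 i *: vt o.
  move=> h; split; first by apply: (hspan_braid_err (l := swap_length t)) => //; rewrite hl2.
  have := CyclotomicFactor.psi_braid_idem relE i h.
  move/(congr1 (fun z => z *: vt o)); rewrite -[LHS]scalerA -[RHS]scalerA oI.
  by rewrite scalerBl.
rewrite hl2 2!scalerA ?mulrA; rewrite 2!scalerA ?mulrA in h3.
case: rs => rs; have [e1 e2] := err _ _ rs; have [b0 b1 b2 b3] := brd _ _ rs.
- have dE : deg o - cartan_at r i - cartan_at s (sact r i) - cartan_at r (sact s (sact r i)) =
      deg o - cartan_at s i - cartan_at r (sact s i) - cartan_at s (sact r (sact s i)).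
    by rewrite b1 b2 b3; ring.
  rewrite (canRL (subrK _) e2); apply: (SpD e1).
  by rewrite b0 dE.
- have dE : deg o - cartan_at r i - cartan_at s (sact r i) - cartan_at r (sact s (sact r i)) =
      deg o - cartan_at s i - cartan_at r (sact s i) - cartan_at s (sact r (sact s i)).
    by rewrite b1 b2 b3; ring.
  have -> : (Ps r * Ps s * Ps r) *: vt o =
      (Ps s * Ps r * Ps s) *: vt o - braid_err Y s r i *: vt o by rewrite -e2 opprB addrC subrK.
  by rewrite dE -b0; apply: (SpD h3); apply: SpN.
Qed.

Lemma val_tab t p : val (t p) = (trow t p, tcol t p).
Proof. exact: surjective_pairing. Qed.

Lemma tini_no_descent r : descent (tini lam) r = false.
Proof.
apply/negP; rewrite /descent; have : (lo r < hi r)%N by [].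
by move/(tini_lex E) => h1 h2; lia.
Qed.

(** At an r that is not a valley of the initial path, one sees either a full row or two
    nodes of column 1 below the rows of length 2: a row relation or a Garnir relation. *)
Lemma psi_tini r : ~~ ascent (tini lam) r -> Ps r *: v = 0.
Proof.
move=> hr; case: (localP E r (tini_std E)) => [|h _ _ _|_ h1 h2 _|h1 h2].
- by rewrite tini_no_descent.
- exact: (sv_row hv).
- by rewrite /ascent h1 h2 in hr.
have hn : (r.+1 < n)%N := hi_subproof r.
have hs := two_col_size E.
have [xr|rx] := leqP x.*2 r.
  apply: (sv_garnir1 hv (val_tab _ _)).
    by rewrite -h2 -h1 -val_tab; exact: valP.
  rewrite (row_tini E) E nth_two_col.
  have -> : two_col_node x (lo r) = ((r - x).+1, 1%N) by rewrite /two_col_node /= ltnNge xr.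
  by move: hn hs xr => /=; lia.
move: h1 h2; rewrite !(row_tini E) !(col_tini E) /two_col_node /= rx.
by case: ifP => /= h3; case: (odd r) (odd_double_half r) => /=; lia.
Qed.

(** Two up steps followed by a down step at s, starting at height 0. The flattened tableau
    has no descent left, since t would share any descent far from s; so it is the
    initial one, and psi_r psi_s v is a Garnir relation. *)
Lemma garnir_up t r s : is_std t -> s = r.+1 :> nat -> descent t s ->
  trow (swap t s) (lo r) = trow (swap t s) (hi r) ->
  (forall s', descent t s' -> s' = s) -> Ps r *: vt t = 0.
Proof.
move=> st rs hs hb uniq_s; have sq := descent_swap_std E st hs.
have los := lo_hi_succ rs; have [c1 c2 _] := descent_local E st hs.
set q := swap t s in hb sq *.
have qlo : q (hi r) = t (hi s) by rewrite -los /q swap_lo.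
have qhi : q (hi s) = t (lo s) by rewrite /q swap_hi.
have qc : tcol q (hi r) = 2 by rewrite /tcol qlo.
have qE : q = tini lam.
  case: (exists_descent E sq) => // -[s' hd].
  have [d1 d2 _] := descent_local E sq hd.
  have n1 : s' != s :> nat.
    apply/eqP => /val_inj h; move: d1; rewrite h los qc //.
  have n2 : s' != r :> nat.
    by apply/eqP => /val_inj h; move: hd; rewrite h /descent hb ltnn.
  have [h|n3] := eqVneq (s' : nat) s.+1.
    have [_ _ e1] := descent_local E sq hd; rewrite (lo_hi_succ h) in e1 d1.
    have e2 : (trow q (lo s) + trow q (hi s) = s.+2)%N.
      by case: (localP E s sq) => [_ k|_ k|//|k _] //; rewrite ?los ?qc ?d1 in k.
    have e3 : (trow q (lo r) + trow q (hi r) = r.+2)%N.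
      by case: (localP E r sq) => // _; rewrite hb; lia.
    by move: hd e1 e2; rewrite /descent (lo_hi_succ h) los h rs; lia.
  have far : (s.+1 < s')%N || (s'.+1 < s)%N by move: n1 n2 n3; rewrite rs; lia.
  by move: n1; rewrite (uniq_s s') ?eqxx //; rewrite -(descent_swap_far _ far).
rewrite (vtab_peel E hrex relE v st hs) -/q qE (vtab_tini E hrex relE) scalerA.
have qr1 : tcol q (lo r) = 1%N.
  by case: (localP E r sq) hb; rewrite ?qc // /descent; lia.
apply: (sv_garnir2 hv (a := trow q (lo r)) _ _ _ rs).
- by rewrite -qE val_tab qr1.
- apply/(mem_shape E); have [h1 h2] := nodeP E t (lo s); have hd := hs.
  have k1 : trow q (hi r) = trow t (hi s) by rewrite /trow qlo.
  by move: hd h2; rewrite /descent -k1 -hb c1; lia.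
- rewrite E nth_two_col; have := nodeP E q (hi r); rewrite qc -hb; lia.
Qed.

(** The mirror image of [garnir_up]: an up step at s followed by two down steps, ending at
    height 0. *)
Lemma garnir_down t r s : is_std t -> r = s.+1 :> nat -> descent t s ->
  trow (swap t s) (lo r) = trow (swap t s) (hi r) -> tcol t (hi r) = 2 ->
  (forall s', descent t s' -> s' = s) -> Ps r *: vt t = 0.
Proof.
move=> st rs hs hb cr uniq_s; have sq := descent_swap_std E st hs.
have los := lo_hi_succ rs; have [c1 c2 _] := descent_local E st hs.
set q := swap t s in hb sq *.
have qlo : q (lo s) = t (lo r) by rewrite los /q swap_lo.
have qhi : q (lo r) = t (lo s) by rewrite los /q swap_hi.
have qr : q (hi r) = t (hi r) by rewrite /q swap_far //= rs; lia.
have q1 : tcol q (lo s) = 2 by rewrite /tcol qlo los.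
have q2 : tcol q (lo r) = 1%N by rewrite /tcol qhi.
have q3 : tcol q (hi r) = 2 by rewrite /tcol qr.
have e2 : (trow q (lo s) + trow q (hi s) = s.+2)%N.
  by case: (localP E s sq) => [_ k|_ k|//|k _] //; rewrite -?los ?q1 ?q2 in k.
have e3 : (trow q (lo r) + trow q (hi r) = r.+2)%N.
  by case: (localP E r sq) => // _; rewrite hb; lia.
have qE : q = tini lam.
  case: (exists_descent E sq) => // -[s' hd].
  have [d1 d2 e1] := descent_local E sq hd.
  have n1 : s' != s :> nat.
    by apply/eqP => /val_inj h; move: d1; rewrite h q1.
  have n2 : s' != r :> nat.
    by apply/eqP => /val_inj h; move: hd; rewrite h /descent hb ltnn.
  have [h|n3] := eqVneq (s : nat) s'.+1.
    by move: hd e1 e2 e3; rewrite /descent -(lo_hi_succ h) -hb los rs h; lia.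
  have far : (s.+1 < s')%N || (s'.+1 < s)%N by move: n1 n2 n3; rewrite rs; lia.
  by move: n1; rewrite (uniq_s s') ?eqxx //; rewrite -(descent_swap_far _ far).
rewrite (vtab_peel E hrex relE v st hs) -/q qE (vtab_tini E hrex relE) scalerA.
apply: (sv_garnir3 hv (a := trow q (lo s)) _ _ rs).
  by rewrite -qE val_tab q1.
have -> : (trow q (lo s)).+1 = trow q (hi r) by move: e2 e3; rewrite -hb los rs; lia.
by rewrite -q3 -val_tab; exact: valP.
Qed.

(** Every case is an induction on the number of swaps: the quadratic relation at a descent,
    the commutation relation for a far descent, otherwise the braid or Garnir relations. *)
Theorem tame_std t : is_std t -> tame t.
Proof.
move: {2}(swap_length t) (erefl (swap_length t)) => k; elim/ltn_ind: k t => k IHk t hk st.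
have IH q : is_std q -> (swap_length q < swap_length t)%N -> tame q.
  by move=> sq hq; apply: (IHk _ _ q erefl sq); rewrite -hk.
split=> [p|r hr]; first exact: tame_y.
have [hd|nd] := boolP (descent t r); first exact: tame_descent.
have [/existsP[s /andP[hd far]]|/existsPn nf] :=
    boolP [exists s, descent t s && ((r.+1 < s)%N || (s.+1 < r)%N)].
  exact: tame_far hd far.
have near s : descent t s -> (s = r.+1 :> nat) \/ (r = s.+1 :> nat).
  move=> hd; have := nf s; rewrite hd /=.
  have : s != r :> nat by apply/eqP => /val_inj h; move: nd; rewrite -h hd.
  by lia.
case: (exists_descent E st) => [t0|[s hd]].
  have -> : Ps r *: vt t = 0 by rewrite t0 (vtab_tini E hrex relE) psi_tini // -t0.
  exact: Sp0.
have [c1 c2 _] := descent_local E st hd; have sq := descent_swap_std E st hd.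
case: (localP E r st) => [h||_ h1 h2 _|e1 e2].
- by rewrite h in nd.
- move=> _ b1 b2 _; case: (near _ hd) => /lo_hi_succ h; first by rewrite h b2 in c1.
  by rewrite h c2 in b1.
- by rewrite /ascent h1 h2 in hr.
have uniq_s s' : descent t s' -> s' = s.
  move=> hd'; have [d1 d2 _] := descent_local E st hd'; apply: val_inj => /=.
  case: (near _ hd) (near _ hd') => [h|h] [h'|h']; rewrite ?h ?h' //.
  - by move: c1 d2; rewrite (lo_hi_succ h) -(lo_hi_succ h') e1 => ->.
  - by move: c2 d1; rewrite (lo_hi_succ h') -(lo_hi_succ h) e1 => ->.
  - by move: h'; rewrite h => -[].
case: (near _ hd) => rs.
- have los := lo_hi_succ rs.
  have q1 : swap t s (lo r) = t (lo r) by rewrite swap_far //= rs; lia.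
  have q2 : swap t s (hi r) = t (hi s) by rewrite -los swap_lo.
  have [hq|hq] := boolP (descent (swap t s) r).
    apply: (tame_braid (s := s)) => //; first by left.
    by rewrite /ascent /tcol los swap_hi q1 -/(tcol t _) -e1 -los c1.
  have -> : Ps r *: vt t = 0.
    apply: (garnir_up st rs hd) => //.
    case: (localP E r sq) => //; first by rewrite (negbTE hq).
      by rewrite /tcol q1 q2 -!/(tcol t _) c2.
    by rewrite /tcol q1 q2 -!/(tcol t _) c2 -e1 -los c1.
  exact: Sp0.
- have los := lo_hi_succ rs.
  have q1 : swap t s (lo r) = t (lo s) by rewrite los swap_hi.
  have q2 : swap t s (hi r) = t (hi r) by rewrite swap_far //= rs; lia.
  have cr : tcol t (hi r) = 2 by rewrite e1 los.
  have [hq|hq] := boolP (descent (swap t s) r).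
    apply: (tame_braid (s := s)) => //; first by right.
    by rewrite /ascent /tcol -los swap_lo q2 -/(tcol t _) cr andbF.
  have -> : Ps r *: vt t = 0.
    apply: (garnir_down st rs hd) => //.
    case: (localP E r sq) => //; first by rewrite (negbTE hq).
      by rewrite /tcol q1 q2 -!/(tcol t _) c1.
    by rewrite /tcol q1 q2 -!/(tcol t _) cr c1.
  exact: Sp0.
Qed.
End Closure.

(** * The tableau T and its vector *)

Lemma natZ_eq0 e (k : nat) : (1 < e)%N -> (k%:R == 0 :> 'Z_e) = (e %| k)%N.
Proof. by move=> e1; rewrite -val_eqE /= val_Zp_nat. Qed.

Lemma cartan_pred_lt0 e (a : 'Z_e) : (1 < e)%N -> cartan a (a - 1) < 0.
Proof.
move=> e1; have [e3|e3] := ltnP 2 e.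
  by rewrite cartan_arrow // /to_arrow e3 eqxx.
rewrite cartan_lr // /lr_arrow (_ : e == 2); last by lia.
by have := succ_neq (a - 1); rewrite subrK eq_sym => ->.
Qed.

Section TheTableau.
Variables (n x y j : nat) (lam : par2 n).
Hypothesis E : par2_val lam = two_col x y.
Hypothesis jx : (j <= x)%N.
Local Notation T := (T_tab x y j lam).
Local Notation X := (x - j)%N.
Implicit Types (t : tableau n lam) (r s u : 'I_n.-1) (p : 'I_n).

Lemma T_std : is_std T. Proof. exact: T_tab_std. Qed.

Lemma T_val p : val (T p) =
  if (p < X.*2)%N then (p./2.+1, (odd p).+1)
  else if (p < X.*2 + y + j)%N then ((p - X).+1, 1%N) else ((p - (x + y)).+1, 2).
Proof.
have hs := two_col_size E; have hp := ltn_ord p.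
have [A hA AE] : exists2 A, A \in young lam & T_entry x y j A = p.+1.
  exists (if (p < X.*2)%N then (p./2.+1, (odd p).+1)
    else if (p < X.*2 + y + j)%N then ((p - X).+1, 1%N) else ((p - (x + y)).+1, 2)).
    case: ifP => h1; last case: ifP => h2; apply/(mem_shape E); lia.
  case: ifP => h1; last case: ifP => h2; rewrite /T_entry.
  - by have := odd_double_half p; rewrite ifT; lia.
  - by rewrite ifF /=; lia.
  - by rewrite ifF /=; lia.
have TE : T_entry x y j (val (T p)) = p.+1.
  by rewrite ffunE; case: pickP => [B /eqP //|/(_ (SeqSub hA))]; rewrite /= AE eqxx.
have := nodeP E T p; rewrite /trow /tcol; move: TE; case: (val (T p)) => a b /=.
move=> TE hab; have := odd_double_half p.
case: ifP => h1; last case: ifP => h2; case: (odd p); move: TE hab; (case: ifP => h3; [|case: ifP => h4]);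
  move=> TE hab ho; congr (_, _); lia.
Qed.

Lemma T_prefix p : (p < X.*2.+1)%N -> T p = tini lam p.
Proof.
move=> hp; have hn := ltn_ord p; have hs := two_col_size E.
apply: val_inj; rewrite T_val (tiniE _ E) /two_col_node.
have [h1|h1] := ltnP p X.*2; first by rewrite ifT //; lia.
have pE : nat_of_ord p = X.*2 by lia.
rewrite pE in hn *; rewrite ifT; last by lia.
case: ifP => h2; rewrite ?doubleK ?odd_double; congr (_, _); lia.
Qed.

Variable mu : par2 n.
Hypothesis F : par2_val mu = two_col X (y + 2 * j).

Lemma tini_mu_val p : val (tini mu p) =
  if (p < X.*2)%N then (p./2.+1, (odd p).+1) else ((p - X).+1, 1%N).
Proof. by rewrite (tiniE _ F). Qed.

Lemma T_dominated : is_dominated mu T.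
Proof.
apply/forallP => p; rewrite T_val tini_mu_val.
by case: ifP => h1 //; case: ifP => h2 //=; lia.
Qed.

Variable e : nat.

Lemma tail_res p : (X.*2 <= p)%N -> ires mu e p = X%:R - p%:R.
Proof.
move=> hp; rewrite ffunE tini_mu_val ltnNge hp /= /res /=.
by rewrite -(addn1 (p - X)) natrD natrB; [ring|lia].
Qed.

Lemma step_weight_tini_mu p : step_weight e p (val (tini mu p)) =
  ((p < X.*2)%N && odd p)%:R * (2 == 0 :> 'Z_e)%:R.
Proof.
rewrite tini_mu_val /step_weight; have [h1|h1] := ltnP p X.*2; last by rewrite /= mul0r.
have := odd_double_half p; rewrite /=; case: (odd p) => /= ho; last by rewrite mul0r.
have -> : p.+1%:R = p./2.+1%:R * 2 :> 'Z_e by rewrite -natrM; congr _%:R; lia.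
by rewrite subrr !add0r oner_eq0 subr0 mul1r.
Qed.

Hypothesis hy : y%:R + j%:R + 1 = 0 :> 'Z_e.

(** The final down steps of T have the residues of up steps because y + j + 1 = 0 modulo
    e. *)
Lemma T_res : tab_res e T = ires mu e.
Proof.
apply/ffunP => p; rewrite [LHS]ffunE [RHS]ffunE T_val tini_mu_val; case: ifP => // h1.
case: ifP => // h2; rewrite /res /=.
rewrite -(addn1 (p - _)) -(addn1 (p - X)) !natrD !natrB; [|lia|lia|lia].
rewrite natrD; apply/eqP; rewrite -subr_eq0; apply/eqP; rewrite -[RHS]hy; ring.
Qed.

Hypothesis e2 : (1 < e)%N.
Hypothesis j0 : (0 < j < e)%N.

(** In the final down steps the height runs from y + j - 1 to y, that is, through the
    residues -2, -3, ..., -j-1 modulo e. Only the first value has a nonzero weight, as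
    j < e. *)
Lemma step_weight_T p : step_weight e p (val (T p)) =
  step_weight e p (val (tini mu p)) + (p == (X.*2 + y + j)%N :> nat)%:R.
Proof.
rewrite T_val tini_mu_val; have hp := ltn_ord p; have hs := two_col_size E.
case: ifP => h1; first by rewrite (_ : (_ == _) = false) ?addr0 //; lia.
case: ifP => h2; first by rewrite (_ : (_ == _) = false) ?addr0 //; lia.
rewrite [step_weight _ _ (_, 1%N)]/step_weight add0r /step_weight /=.
have [i hi] : exists i, nat_of_ord p = (X.*2 + y + j + i)%N.
  by exists (p - (X.*2 + y + j))%N; lia.
have ij : (i < j)%N by lia.
have -> : (p - (x + y)).+1 = (X + i).+1 by lia.
have -> : p.+1%:R - (X + i).+1%:R * 2 + 2 = - i%:R :> 'Z_e.
  rewrite hi -(addn1 (_ + i)) -(addn1 (X + i)) -addnn !natrD; apply/eqP.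
  by rewrite -subr_eq0; apply/eqP; rewrite -[RHS]hy; ring.
have -> : p.+1%:R - (X + i).+1%:R * 2 + 1 = - i.+1%:R :> 'Z_e.
  rewrite hi -(addn1 (_ + i)) -(addn1 (X + i)) -(addn1 i) -addnn !natrD; apply/eqP.
  by rewrite -subr_eq0; apply/eqP; rewrite -[RHS]hy; ring.
rewrite !oppr_eq0 !natZ_eq0 // (gtnNdvd (ltn0Sn i)) ?subr0; last by lia.
congr (nat_of_bool _)%:R; rewrite hi -{2}[(X.*2 + y + j)%N]addn0 eqn_add2l.
by case: i ij {hi} => [|i] ij; rewrite ?dvdn0 // gtnNdvd //; lia.
Qed.

Lemma deg_T : deg e T = deg e (tini mu) + 1.
Proof.
rewrite (deg_sum e E T_std) (deg_sum e F (tini_std F)).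
under eq_bigr do rewrite step_weight_T.
rewrite big_split /=; congr (_ + _).
have hs := two_col_size E; have hn : (X.*2 + y + j < n)%N by lia.
rewrite (bigD1 (Ordinal hn)) //= eqxx big1 ?addr0 // => p hp.
by case: eqP => // h; case/eqP: hp; apply: val_inj.
Qed.

(** The tableaux whose vectors may occur in y_k v^T or in psi_u v^T with u beyond the first
    x - j rows. *)
Definition tail_swapped t : Prop :=
  tab_res e t = ires mu e \/
  exists u, (X.*2 <= u)%N /\ tab_res e t = sact u (ires mu e).

Lemma two_Z_neq0 : (2 < e)%N -> 2 != 0 :> 'Z_e.
Proof. by move=> e3; rewrite two_neq0. Qed.

Lemma tail_swapped_prefix t p : tail_swapped t -> (p < X.*2)%N ->
  tab_res e t p = ires mu e p.
Proof.
case=> [-> //|[u [hu ->]]] hp; rewrite ffunE sperm_far // -val_eqE /=; lia.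
Qed.

Lemma res_col1 t p : is_std t -> tcol t p = 1%N -> tab_res e t p = - (col_count t 1 p)%:R.
Proof.
move=> st h; rewrite ffunE /res -/(trow t p) -/(tcol t p) h (trow_col1 E st h).
by rewrite -(addn1 (col_count _ _ _)) natrD; ring.
Qed.

Lemma res_col2 t p : is_std t -> tcol t p = 2 -> tab_res e t p = 1 - (col_count t 2 p)%:R.
Proof.
move=> st h; rewrite ffunE /res -/(trow t p) -/(tcol t p) h (trow_col2 E st h).
by rewrite -(addn1 (col_count _ _ _)) natrD; ring.
Qed.

(** Near height 0 a residue determines the step: the alternative to going down from height 1
    has residue differing by 2, and going down from height 0 is impossible. *)
Lemma prefix_forced t (k : nat) : (2 < e)%N -> is_std t -> tail_swapped t ->
  (k <= X.*2)%N -> col_count t 2 k = k./2.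
Proof.
move=> e3 st ht; elim: k => [|k IH] kX; first by rewrite col_count0.
have hk := IH (ltnW kX); have hs := two_col_size E.
have kn : (k < n)%N by lia.
pose p := Ordinal kn; have := col_countS t 2 p; rewrite /= => ->; rewrite hk.
have hc := col_count_sum E t (ltnW kn); rewrite hk in hc.
have [_ [[h1 _]|[h1 _]]] := nodeP E t p; rewrite h1 /=; have := odd_double_half k.
  case ok : (odd k) => /= ho; last by lia.
  have hr := tail_swapped_prefix ht (p := p) kX.
  have : 2 = 0 :> 'Z_e.
    have := hr; rewrite res_col1 // ffunE tini_mu_val /= kX ok /res /=.
    have -> : col_count t 1 k = k./2.+1 by lia.
    move/eqP; rewrite -(addn1 k./2) natrD -subr_eq0 => /eqP hz.
    by rewrite -[RHS]oppr0 -hz; ring.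
  by move/eqP; rewrite (negbTE (two_Z_neq0 e3)).
case ok : (odd k) => /= ho; first by lia.
by have := col_count_ballot E st h1; rewrite /= hk; lia.
Qed.

(** Let c be the number of down steps before p. A down step of the prescribed residue weighs
    at most 1, and this only if c = x - j modulo e; as c lies between x - j and x - 1, then
    c = x - j. The two
    exchanged positions shift this residue by one in either direction; the shift to
    c = x - j + 1 would need a preceding step whose residue forces 2 = 0 modulo e. *)
Lemma tail_weight t p : (2 < e)%N -> is_std t -> tail_swapped t ->
  step_weight e p (val (t p)) <= (val (t p) == (X.+1, 2))%:R.
Proof.
move=> e3 st ht; rewrite /step_weight -/(tcol t p) -/(trow t p).
case: eqP => [h2|_]; last exact: ler0n.
have rE := trow_col2 E st h2; have hx := nodeP E t p; rewrite h2 rE in hx.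
have -> : (val (t p) == (X.+1, 2)) = (col_count t 2 p == X).
  by rewrite [val _]surjective_pairing -/(trow t p) -/(tcol t p) xpair_eqE h2 rE eqSS andbT.
rewrite rE; set c := col_count t 2 p.
have cx : (c < x)%N by move: hx; lia.
have [hp|hp] := ltnP p X.*2.
  have hb := col_count_ballot E st h2; have hc := col_count_sum E t (ltnW (ltn_ord p)).
  have cE : c = p./2 by apply: prefix_forced => //; exact: ltnW.
  have -> : p.+1%:R = c.+1%:R * 2 :> 'Z_e.
    rewrite -natrM; congr _%:R; have := odd_double_half p; rewrite -cE.
    by move: hb hc; rewrite -/c; case: (odd p) => /=; lia.
  by rewrite subrr !add0r oner_eq0 (negbTE (two_Z_neq0 e3)) subr0 ler0n.
have cX : (X <= c)%N.
  have := col_count_mono t 2 hp; rewrite prefix_forced // doubleK //.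
suff H : (p.+1%:R - c.+1%:R * 2 + 2 == 0 :> 'Z_e) -> c = X.
  have : (p.+1%:R - c.+1%:R * 2 + 2 == 0 :> 'Z_e)%:R <= (c == X)%:R :> int.
    by rewrite ler_nat; case: eqP => // /eqP /H ->; rewrite eqxx.
  by apply: le_trans; rewrite gerBl ler0n.
have -> : p.+1%:R - c.+1%:R * 2 + 2 = p%:R - c%:R * 2 + 1 :> 'Z_e.
  by rewrite -(addn1 p) -(addn1 c) !natrD; ring.
have small (d : nat) : (0 < d < e)%N -> (d%:R == 0 :> 'Z_e) = false.
  by move=> hd; rewrite natZ_eq0 // gtnNdvd //; lia.
have rc : tab_res e t p = 1 - c%:R by rewrite res_col2.
(* The weight is read off from p = c + (x - j) - 1 modulo e. *)
have main : (tab_res e t p = X%:R - p%:R) ->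
    (p%:R - c%:R * 2 + 1 == 0 :> 'Z_e) -> c = X.
  rewrite rc => h /eqP h3.
  have z1 : (c - X)%:R = 0 :> 'Z_e.
    rewrite natrB // -[LHS](_ : - (p%:R - c%:R * 2 + 1) + (1 - c%:R - (X%:R - p%:R)) = _).
      by rewrite h3 h subrr oppr0 addr0.
    by ring.
  have := small (c - X)%N; rewrite z1 eqxx => H.
  apply/eqP; rewrite eqn_leq cX andbT leqNgt; apply/negP => k.
  by have : true = false by apply: H; lia.
case: (ht) => [h|[u [hu h]]]; first by apply: main; rewrite h tail_res.
have := main; move: rc; rewrite h [sact u _ _]ffunE.
case: spermP => [pl|ph|p1 p2].
- (* The earlier exchanged position: the weight would need c + 1 = x - j modulo e. *)
  rewrite tail_res /=; last by lia.
  move=> rc _ /eqP h3; have := small (c.+1 - X)%N.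
  have pu : p%:R = u%:R :> 'Z_e by rewrite pl.
  have z1 : (c.+1 - X)%:R = 0 :> 'Z_e.
    rewrite natrB; last by lia.
    rewrite -(addn1 u) natrD in rc; rewrite -(addn1 c) natrD.
    rewrite -[LHS](_ : - (p%:R - c%:R * 2 + 1) + (1 - c%:R - (X%:R - (u%:R + 1))) = _).
      by rewrite h3 -rc subrr oppr0 addr0.
    by rewrite pu; ring.
  by rewrite z1 eqxx => H; have : true = false by apply: H; lia.
- (* The later one: the weight would need c = x - j + 1, so that exactly one down step of
     the tail precedes p, either at u or before u. *)
  rewrite tail_res // => rc _ /eqP h3.
  have pu : p%:R = u%:R + 1 :> 'Z_e by rewrite ph -natr1.
  have z1 : X%:R - c%:R + 1 = 0 :> 'Z_e.
    rewrite -h3 pu; have -> : u%:R = X%:R - (1 - c%:R) :> 'Z_e by rewrite -rc; ring.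
    by ring.
  have [//|cX'] := eqVneq c X.
  have cE : c = X.+1.
    have := small (c - X.+1)%N; rewrite natrB; last by lia.
    rewrite -(addn1 X) natrD -[_ - _]opprK (_ : - (_ - _) = X%:R - c%:R + 1); last by ring.
    rewrite z1 oppr0 eqxx => H; apply/eqP; rewrite eqn_leq addn1; apply/andP; split; last by lia.
    by rewrite leqNgt; apply/negP => k; have : true = false by apply: H; lia.
  have ru : tab_res e t (lo u) = X%:R - (u%:R + 1).
    by rewrite h [LHS]ffunE sperm_lo tail_res /=; [rewrite -natr1 | lia].
  have cp : c = (col_count t 2 u + (tcol t (lo u) == 2))%N by rewrite /c ph; exact: (col_countS t 2 (lo u)).
  have un : (u <= n)%N by have := ltn_ord u; lia.
  have c12 := col_count_sum E t un.
  suff : 2 = 0 :> 'Z_e by move/eqP; rewrite (negbTE (two_Z_neq0 e3)).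
  move: ru; case: (nodeP E t (lo u)) => _ [[d _]|[d _]]; rewrite d /= in cp.
    rewrite (res_col1 st d) /=; have -> : col_count t 1 u = (u - X.+1)%N by lia.
    rewrite natrB; last by lia.
    rewrite -natr1 => /eqP; rewrite -subr_eq0 => /eqP <-; ring.
  rewrite (res_col2 st d) /=; have -> : col_count t 2 u = X by lia.
  move/eqP; rewrite -subr_eq0 => /eqP hz.
  move: rc; rewrite cE -natr1 => /eqP; rewrite -subr_eq0 => /eqP hz'.
  rewrite -[LHS](_ : (1 - X%:R - (X%:R - (u%:R + 1))) + (X%:R - u%:R - (1 - (X%:R + 1))) = _).
    by rewrite hz hz' addr0.
  by ring.
- by rewrite tail_res // => rc hm; apply: hm.
Qed.

Lemma deg_T_ge1 : 1 <= deg e T.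
Proof.
rewrite deg_T -{1}[1]add0r lerD2r (deg_sum e F (tini_std F)).
by apply: sumr_ge0 => p _; rewrite step_weight_tini_mu mulr_ge0 // ler0n.
Qed.

Lemma count_col2 t : is_std t ->
  \sum_(p < n) (tcol t p == 2)%:R = \sum_(p < n) (tcol (tini lam) p == 2)%:R :> int.
Proof.
move=> st; rewrite (reindex_inj (@perm_inj _ (dperm t))) /=.
by apply: eq_bigr => p _; rewrite /tcol (dpermP E).
Qed.

(** For e = 2 every down step of T has the largest possible weight 1, and all tableaux have
    equally many down steps. For e > 2 the residues leave room for at most one step of
    positive weight, and T has degree at least 1. *)
Lemma deg_le_T t : is_std t -> tail_swapped t -> deg e t <= deg e T.
Proof.
move=> st ht; have hs := two_col_size E.
have [e3|] := ltnP 2 e.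
  apply: le_trans deg_T_ge1; rewrite (deg_sum e E st).
  apply: le_trans (ler_sum _ (fun p _ => tail_weight p e3 st ht)) _.
  have [|q [q1 q2]] := std_at E (t := t) (a := X.+1) (b := 2) st; first by lia.
  rewrite (bigD1 q) //= big1 => [|p pq]; first by rewrite addr0 lern1 leq_b1.
  case: eqP => // h; case/eqP: pq; apply: (std_eq st).
    by rewrite q1 /trow /= h.
  by rewrite q2 /tcol /= h.
move=> e3; have ee : e = 2 by lia.
have z2 : 2 = 0 :> 'Z_e by apply/eqP; rewrite -[2]/(2%:R) natZ_eq0 // ee.
have jj : j = 1%N by lia.
have wT p : step_weight e p (val (T p)) = (tcol T p == 2)%:R.
  rewrite step_weight_T step_weight_tini_mu z2 eqxx mulr1 /tcol T_val.
  have hp := ltn_ord p.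
  case: ifP => h1; first by rewrite /= (_ : (_ == _) = false) ?addr0 //; [case: (odd p)|lia].
  rewrite add0r; case: ifP => h2 /=; first by rewrite (_ : (_ == _) = false) //; lia.
  by rewrite (_ : (_ == _) = true) //; lia.
rewrite (deg_sum e E st) (deg_sum e E T_std).
under [leRHS]eq_bigr do rewrite wT.
rewrite (count_col2 T_std) -(count_col2 st); apply: ler_sum => p _.
rewrite /step_weight -/(tcol t p); case: eqP => // _.
by case: (_ + 2 == 0); case: (_ + 1 == 0).
Qed.

Variable rex : 'S_n -> seq 'I_n.-1.
Hypothesis hrex : forall w : 'S_n, reduced_expr w (rex w).
Variables (A : pzRingType) (Id : iseq e n -> A) (Ps : 'I_n.-1 -> A) (Y : 'I_n -> A).
Hypothesis relE : forall l r : A, klr_rel Id Ps Y l r -> l = r.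
Variables (V : lmodType A) (v : V).
Hypothesis hv : specht_vector lam Id Ps Y v.
Local Notation vt := (vtab_of rex Ps v).
Local Notation hspan := (@hspan e n lam rex A Ps V v).

Lemma hspan_eq0 l d i m : (forall t, is_std t -> deg e t = d -> tab_res e t = i -> False) ->
  hspan l d i m -> m = 0.
Proof.
move=> h; elim=> [//|a b _ -> _ ->|a _ ->|t [st _ hd hi]]; rewrite ?addr0 ?oppr0 //.
by case: (h t).
Qed.

Lemma T_not_ascent r : (X.*2 <= r)%N -> ~~ ascent (T : tableau n lam) r.
Proof.
move=> hr; rewrite /ascent /tcol !T_val /=.
by do !case: ifP => //=; lia.
Qed.

(** The y-relations and the Garnir relations for nodes in rows of length 1 would produce
    vectors of degree larger than deg T, excluded by [deg_le_T]; the other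
    relations on the psi's involve the first x - j rows and commute with the word of T. *)
Lemma T_specht_vector : specht_vector mu Id Ps Y (vt T).
Proof.
have sT := T_std; have TT := tame_std E hrex relE hv sT.
have tT := T_res.
have pre := T_prefix.
have far r s : (r.+1 <= X.*2)%N -> (X.*2.+1 <= s)%N -> Ps r * Ps s = Ps s * Ps r.
  by move=> h1 h2; apply: (psi_comm relE); apply/orP; left; lia.
have zero := vtab_commute E hrex relE (v := v) (m := X.*2.+1) _ _ sT pre.
have tini_eq p : (p < X.*2)%N -> val (tini mu p) = val (tini lam p).
  by move=> hp; rewrite (tiniE _ E) (tiniE _ F) /two_col_node hp ifT //; lia.
have val_lt p a b : val (tini mu p) = (a, b) -> (a <= X)%N -> (p < X.*2)%N.
  by rewrite tini_mu_val; case: ifP => // h [<- _]; lia.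
split.
- by move=> i; rewrite (vtab_idem E hrex relE hv) // tT.
- move=> p; have [h _] := TT; apply: hspan_eq0 (h p) => t st hd ht.
  have := deg_le_T st (or_introl (etrans ht tT)); rewrite hd; lia.
- move=> r; rewrite /trow !tini_mu_val /= => hr.
  have hX : (r.+1 < X.*2)%N by move: hr; do 2!case: ifP => /=; lia.
  apply: zero => [s hs|]; first by apply: far => //; exact: ltnW.
  by apply: (sv_row hv); rewrite /trow -!tini_eq //= ?(ltnW hX) // !tini_mu_val.
- move=> r a b hr hab; rewrite F nth_two_col => ha.
  have hX : (X.*2 <= r)%N.
    move: hr; rewrite tini_mu_val /=; case: ifP => h; last by lia.
    by move=> [h1 _]; move: ha; rewrite -h1 /=; lia.
  have [_ h] := TT; apply: hspan_eq0 (h r (T_not_ascent hX)) => t st hd ht.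
  have hts : tail_swapped t by right; exists r; rewrite ht tT.
  have := deg_le_T st hts.
  rewrite hd tT /cartan_at !tail_res //=; last by lia.
  have -> : X%:R - r.+1%:R = X%:R - r%:R - 1 :> 'Z_e by rewrite -natr1; ring.
  by rewrite gerBl leNgt cartan_pred_lt0.
- move=> r s a hr ha; rewrite F nth_two_col => h2 rs.
  have a0 : (0 < a)%N by move: hr; rewrite tini_mu_val; case: ifP => _ [<-].
  have hr0 : (r < X.*2)%N by apply: (val_lt _ _ _ hr); lia.
  have aE : r = (a.-1).*2 :> nat.
    move: hr; rewrite tini_mu_val /= hr0 => -[<-].
    by have := odd_double_half r; case: (odd r) => /=; lia.
  apply: zero => [k hk|].
    by rewrite -mulrA (far s k) // ?mulrA ?(far r k) //; lia.
  apply: (sv_garnir2 hv (a := a)) => //; first by rewrite -tini_eq.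
    by apply/(mem_shape E); lia.
  by rewrite E nth_two_col; lia.
- move=> r s a hr ha rs.
  have hX : (a.+1 <= X)%N by move: ha => /(mem_shape F); lia.
  have hr0 : (r < X.*2)%N by apply: (val_lt _ _ _ hr); lia.
  have aE : r.+1 = a.*2 :> nat.
    move: hr; rewrite tini_mu_val /= hr0 => -[<-].
    by have := odd_double_half r; case: (odd r) => /=; lia.
  apply: zero => [k hk|].
    by rewrite -mulrA (far r k) // ?mulrA ?(far s k) //; lia.
  apply: (sv_garnir3 hv (a := a)) => //; first by rewrite -tini_eq.
  by apply/(mem_shape E); lia.
Qed.
End TheTableau.

(** * Homomorphisms out of a Specht module *)

Lemma vgen_specht_vector e n (lam : par2 n) :
  specht_vector lam (@idem e n) (@psi e n) (@yk e n) (vgen e lam).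
Proof.
have rel0 l : specht_rel lam l 0 -> l *: vgen e lam = 0.
  by move/vgen_rel; rewrite scale0r.
split.
- by move=> i; apply/vgen_rel/sp_idem.
- by move=> p; apply/rel0/sp_y.
- by move=> r hr; apply/rel0/sp_row.
- by move=> r a b h1 h2 h3; apply: rel0; apply: sp_garnir1 h1 h2 h3.
- by move=> r s a h1 h2 h3 h4; apply: rel0; apply: sp_garnir2 h1 h2 h3 h4.
- by move=> r s a h1 h2 h3; apply: rel0; apply: sp_garnir3 h1 h2 h3.
Qed.

Section Lift.
Variables (e n : nat) (mu lam : par2 n) (w : specht e lam).
Hypothesis hw : specht_vector mu (@idem e n) (@psi e n) (@yk e n) w.

Lemma specht_vector_rel l r : specht_rel mu l r -> l *: w = r *: w.
Proof.
case=> [i|p|r' h|r' a b h1 h2 h3|r' s a h1 h2 h3 h4|r' s a h1 h2 h3]; rewrite ?scale0r.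
- exact: (sv_idem hw).
- exact: (sv_y hw).
- exact: (sv_row hw).
- exact: (sv_garnir1 hw) h1 h2 h3.
- exact: (sv_garnir2 hw) h1 h2 h3 h4.
- exact: (sv_garnir3 hw) h1 h2 h3.
Qed.

(** Elements of the left ideal that defines the Specht module of mu annihilate w, so w is the
    image of the generator under a homomorphism. *)
Lemma lideal_kill a : a \in lideal (specht_rel mu) -> a *: w = 0.
Proof.
move/lidealP; elim=> [|b l r s lr _ IH]; first by rewrite scale0r.
by rewrite scalerDl IH addr0 -scalerA scalerBl (specht_vector_rel lr) subrr scaler0.
Qed.

Definition specht_lift of specht_vector mu (@idem e n) (@psi e n) (@yk e n) w :
  cspecht e mu -> cspecht e lam := fun m => cyclic_repr (m : specht e mu) *: w.

Lemma specht_liftE a : specht_lift hw (a *: vgen e mu : specht e mu) = a *: w.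
Proof.
apply: (@subr0_eq (specht e lam)); rewrite /specht_lift -scalerBl.
by apply: lideal_kill; apply/cyclic_eq; rewrite cyclic_reprK cyclic_piE.
Qed.

Lemma specht_genE (m : specht e mu) : m = cyclic_repr m *: vgen e mu.
Proof. by rewrite -cyclic_piE cyclic_reprK. Qed.

Lemma specht_liftZ a (m : specht e mu) :
  specht_lift hw (a *: m) = a *: (specht_lift hw m : specht e lam).
Proof. by rewrite [m in LHS]specht_genE scalerA specht_liftE -scalerA. Qed.

Fact specht_lift_linear : linear (specht_lift hw).
Proof.
move=> u m m'.
have -> : u *: m + m' = ((qring_repr u * cyclic_repr m + cyclic_repr m') *: vgen e mu : specht e mu).
  by rewrite scalerDl -scalerA -!specht_genE.
by rewrite specht_liftE scalerDl -scalerA.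
Qed.

HB.instance Definition _ := GRing.isLinear.Build (cklr e n) (cspecht e mu) (cspecht e lam)
  *:%R (specht_lift hw) specht_lift_linear.
End Lift.

(** * Integer spans and the theorem *)

Section IntegerSpan.
Variables (V : zmodType) (I : finType) (P : pred I) (f : I -> V).

Definition zspan (m : V) : Prop := exists c : I -> int, m = \sum_(i | P i) f i *~ c i.

Lemma zspan0 : zspan 0.
Proof. by exists (fun=> 0); rewrite big1. Qed.

Lemma zspanD m m' : zspan m -> zspan m' -> zspan (m + m').
Proof.
move=> [c ->] [c' ->]; exists (fun i => c i + c' i).
by rewrite -big_split; apply: eq_bigr => i _; rewrite mulrzDr.
Qed.

Lemma zspanN m : zspan m -> zspan (- m).
Proof.
move=> [c ->]; exists (fun i => - c i).
by rewrite -sumrN; apply: eq_bigr => i _; rewrite mulrNz.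
Qed.

Lemma zspan_gen i : P i -> zspan (f i).
Proof.
move=> Pi; exists (fun i' => (i' == i)%:R).
rewrite (bigD1 i) //= eqxx mulr1z big1 ?addr0 // => i' /andP[_ /negbTE ->].
exact: mulr0z.
Qed.

Lemma zspanMz m (c : int) : zspan m -> zspan (m *~ c).
Proof.
move=> h; have hk (k : nat) : zspan (m *+ k).
  by elim: k => [|k IH]; [exact: zspan0 | rewrite mulrS; exact: zspanD].
by case: c => k; [exact: hk | rewrite NegzE mulrNz; exact/zspanN/hk].
Qed.
End IntegerSpan.

Lemma hspan_homogeneous e n (lam : par2 n) (rex : 'S_n -> seq 'I_n.-1) (l : nat) (d : int) (i : iseq e n)
    (m : specht e lam) :
  hspan lam rex (@psi e n) (vgen e lam) l d i m -> homogeneous_elt rex d m.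
Proof.
rewrite /homogeneous_elt /in_span.
elim=> [|a b _ ha _ hb|a _ ha|t [st _ ht _]].
- exact: zspan0.
- exact: zspanD ha hb.
- exact: zspanN ha.
- by apply: (zspan_gen (@vtab e n rex lam)); rewrite st ht eqxx.
Qed.

Theorem theorem5p6 (e n x y j : nat) (lam mu : par2 n)
    (rex : 'S_n -> seq 'I_n.-1) :
  (2 <= e)%N ->
  (forall w : 'S_n, reduced_expr w (rex w)) ->
  par2_val lam = two_col x y ->
  (y%:Z = - j%:Z - 1 %[mod e%:Z])%Z ->
  (1 <= j < e)%N ->
  (j <= x)%N ->
  par2_val mu = two_col (x - j) (y + 2 * j) ->
  exists phi : {linear cspecht e mu -> cspecht e lam},
    [/\ phi (vgen e mu) = vtab e rex (T_tab x y j lam),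
        dominated rex phi
      & homogeneous rex phi 1].
Proof.
move=> e2 hrex E hyZ j0 jx F.
have hy : y%:R + j%:R + 1 = 0 :> 'Z_e.
  apply/eqP; rewrite -!natrD natr1 natZ_eq0 //.
  move/eqP: hyZ; rewrite eqz_mod_dvd.
  by have -> : (y%:Z - (- j%:Z - 1) = (y + j).+1%:Z)%R by lia.
have hv := vgen_specht_vector e lam.
have relE := @klr_relE e n.
set T := T_tab x y j lam.
have sT : is_std T by exact: T_std.
have hw := T_specht_vector E jx F hy e2 j0 hrex relE hv.
exists (specht_lift hw).
have gen : specht_lift hw (vgen e mu) = vtab e rex T.
  by rewrite -[vgen e mu]scale1r specht_liftE scale1r.
split; first exact: gen.
  change (in_span rex (@is_dominated n lam mu) (specht_lift hw (vgen e mu))).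
  rewrite gen.
  by apply: (zspan_gen (@vtab e n rex lam)); rewrite sT; exact: T_dominated.
have shift (s : tableau n mu) : is_std s -> exists l,
    hspan lam rex (@psi e n) (vgen e lam) l (deg e s + 1) (tab_res e s)
      (specht_lift hw (vtab_of rex (@psi e n) (vgen e mu) s)).
  move=> ss; elim/(std_ind F): ss => [|{}s r ss hd [l IH]].
    exists (swap_length T).+1; rewrite (vtab_tini F hrex relE) gen -(deg_T E jx F hy e2 j0).
    by rewrite tab_res_tini -(T_res E jx F hy); apply: hspan_vt.
  exists l.+1; rewrite (vtab_peel F hrex relE _ ss hd) specht_liftZ.
  have -> : deg e s + 1 = deg e (swap s r) + 1 - cartan_at r (tab_res e (swap s r)).
    by rewrite (deg_descent e F ss hd) addrAC.
  have -> : tab_res e s = sact r (tab_res e (swap s r)) by rewrite -tab_res_swap swapK.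
  have tame_lam (t : tableau n lam) : is_std t -> (swap_length t < l)%N ->
      tame e rex (@psi e n) (@yk e n) (vgen e lam) t.
    by move=> st _; exact: (tame_std E hrex relE hv).
  exact: (hspan_psi E hrex relE tame_lam r (leqnn l) IH).
move=> k m [c ->].
rewrite raddf_sum; elim/big_rec: _ => [|s m' /andP[ss /eqP <-] IH]; first exact: zspan0.
apply: zspanD IH; rewrite raddfMz; apply: zspanMz.
by have [l /hspan_homogeneous] := shift s ss.
Qed.
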